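(* Let $\delta>0$, let $\{x_j:j\in\mathbb{N}\}$ be a complete interpolating sequence for $S_\delta=[-\delta,\delta]^2$ with Riesz basis constant $B\ge1$, and let $\alpha\ge A_\delta:=\delta^{-1}\ln\big(\sqrt2/(\sqrt2-1)\big)$. Then the Poisson interpolation operator $I_\alpha:PW_{S_\delta}\to L^2(\mathbb{R}^2)$ is bounded, and for every $f\in PW_{S_\delta}$, \[ \|I_\alpha[f]\|_{L^2(\mathbb{R}^2)}\le 13B^4e^{\alpha\delta(\sqrt2-1)}\|f\|_{L^2(\mathbb{R}^2)}. \]
   Context: Fourier transform on $\mathbb{R}^2$: $\hat g(\xi)=(2\pi)^{-1}\int g(x)e^{-i\langle\xi,x\rangle}dx$, extended to $L^2$. $PW_S=\{f\in L^2(\mathbb{R}^2):\hat f=0\text{ a.e. outside }S\}$. $\{x_j\}$ is a complete interpolating sequence for $S_\delta$ if $\{e^{i\langle\cdot,x_j\rangle}\}$ is a Riesz basis of $L^2(S_\delta)$; its Riesz basis constant is $B\ge1$ with $B^{-1}\|c\|_{\ell^2}\le\|\sum_jc_je^{i\langle\cdot,x_j\rangle}\|_{L^2(S_\delta)}\le B\|c\|_{\ell^2}$ for all $c\in\ell^2$. Poisson kernel $g_\alpha(x)=(2\pi)^{-1}\alpha(\alpha^2+|x|^2)^{-3/2}$. For $f\in PW_{S_\delta}$, the Poisson interpolant is $I_\alpha[f](x)=\sum_ja_jg_\alpha(x-x_j)$, where $\{a_j\}\in\ell^2$ is the (unique) sequence with $I_\alpha[f](x_k)=f(x_k)$ for all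 $k$. *)

(* Defs.v *)
(* Complex numbers/complex-valued functions are
   represented by pairs (real part, imaginary part) of reals. *)
From HB Require Import structures.
From mathcomp Require Import all_boot all_order all_algebra.
From mathcomp Require Import all_classical all_reals all_analysis.
Set Implicit Arguments. Unset Strict Implicit. Unset Printing Implicit Defensive.
Import Order.TTheory GRing.Theory Num.Theory.
Import numFieldNormedType.Exports.
Local Open Scope classical_set_scope.
Local Open Scope ring_scope.

Section PoissonDefs.
Variable R : realType.

Definition leb2 := (@lebesgue_measure R \x @lebesgue_measure R)%E.

Definition dot2 (u v : R * R) : R := u.1 * v.1 + u.2 * v.2.

Definition csq (p : R * R) : R := p.1 ^+ 2 + p.2 ^+ 2.

Definition Sq (d : R) : set (R * R) :=
  [set p | (- d <= p.1 <= d) /\ (- d <= p.2 <= d)].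

Definition L2on (D : set (R * R)) (F : R * R -> R * R) : Prop :=
  measurable_fun D (fun p => (F p).1) /\ measurable_fun D (fun p => (F p).2) /\
  (\int[leb2]_(p in D) (csq (F p))%:E < +oo)%E.

Definition L2norm (D : set (R * R)) (F : R * R -> R * R) : R :=
  Num.sqrt (fine (\int[leb2]_(p in D) (csq (F p))%:E)%E).

(* F(xi) * e^{i <xi, x>}  (complex product, as a pair) *)
Definition cmul_exp (F : R * R -> R * R) (x xi : R * R) : R * R :=
  ((F xi).1 * cos (dot2 xi x) - (F xi).2 * sin (dot2 xi x),
   (F xi).1 * sin (dot2 xi x) + (F xi).2 * cos (dot2 xi x)).

(* Paley-Wiener space PW_S: f in L^2(R^2) with Fourier transform vanishing
   outside S, represented by its continuous representative
   f(x) = (2 pi)^{-1} int_S fhat(xi) e^{i<xi,x>} dxi, fhat in L^2(S). *)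
Definition PW (S : set (R * R)) (f : R * R -> R * R) : Prop :=
  exists F : R * R -> R * R, L2on S F /\
    forall x, f x = ((2 * pi)^-1 * Rintegral leb2 S (fun xi => (cmul_exp F x xi).1),
                     (2 * pi)^-1 * Rintegral leb2 S (fun xi => (cmul_exp F x xi).2)).

Definition expsum (x c : nat -> R * R) (n : nat) (xi : R * R) : R * R :=
  (\sum_(j < n) ((c j).1 * cos (dot2 xi (x j)) - (c j).2 * sin (dot2 xi (x j))),
   \sum_(j < n) ((c j).1 * sin (dot2 xi (x j)) + (c j).2 * cos (dot2 xi (x j)))).

(* completeness of {e^{i<.,x_j>}} in L^2(S): the only element of L^2(S)
   orthogonal to all of them is 0 (a.e. on S) *)
Definition exp_complete (S : set (R * R)) (x : nat -> R * R) : Prop :=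
  forall G : R * R -> R * R, L2on S G ->
    (forall j, Rintegral leb2 S
                 (fun xi => (G xi).1 * cos (dot2 xi (x j)) + (G xi).2 * sin (dot2 xi (x j))) = 0 /\
               Rintegral leb2 S
                 (fun xi => (G xi).2 * cos (dot2 xi (x j)) - (G xi).1 * sin (dot2 xi (x j))) = 0) ->
    {ae leb2, forall xi, S xi -> G xi = (0, 0)}.

(* Riesz inequalities with constant B (stated for all finitely supported
   coefficient sequences c, i.e. c_j = 0 for j >= n) *)
Definition riesz_bounds (S : set (R * R)) (x : nat -> R * R) (B : R) : Prop :=
  forall (n : nat) (c : nat -> R * R),
    B^-1 * Num.sqrt (\sum_(j < n) csq (c j)) <= L2norm S (expsum x c n) /\
    L2norm S (expsum x c n) <= B * Num.sqrt (\sum_(j < n) csq (c j)).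

Definition CIS_with_const (S : set (R * R)) (x : nat -> R * R) (B : R) : Prop :=
  exp_complete S x /\ riesz_bounds S x B.

Definition poisson (a : R) (y : R * R) : R :=
  (2 * pi)^-1 * a * powR (a ^+ 2 + y.1 ^+ 2 + y.2 ^+ 2) (- (3 / 2)).

Definition pser_re (al : R) (x a : nat -> R * R) (y : R * R) : nat -> R :=
  series (fun j => (a j).1 * poisson al (y - x j)).
Definition pser_im (al : R) (x a : nat -> R * R) (y : R * R) : nat -> R :=
  series (fun j => (a j).2 * poisson al (y - x j)).

Definition l2seq (a : nat -> R * R) : Prop := cvgn (series (fun j => csq (a j))).

Definition interpolates (al : R) (x a : nat -> R * R) (f : R * R -> R * R) : Prop :=
  forall k, (pser_re al x a (x k) @ \oo --> (f (x k)).1) /\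
            (pser_im al x a (x k) @ \oo --> (f (x k)).2).

Definition poisson_interp (al : R) (x a : nat -> R * R) (y : R * R) : R * R :=
  (limn (pser_re al x a y), limn (pser_im al x a y)).

End PoissonDefs.

(* Main.v *)
Require Import Defs.
From HB Require Import structures.
From mathcomp Require Import all_boot all_order all_algebra.
From mathcomp Require Import all_classical all_reals all_analysis.
From mathcomp Require Import measurable_realfun ring lra.
Import Order.TTheory GRing.Theory Num.Theory.
Import numFieldNormedType.Exports.
Local Open Scope classical_set_scope.
Local Open Scope ring_scope.
Set Implicit Arguments. Unset Strict Implicit. Unset Printing Implicit Defensive.

(** The Fourier transform of W(xi) = exp(- alpha |xi|) is (2 pi)^2 g_alpha, so with
    E_c = sum_j c_j e^(-i <., x_j>) the interpolant of a finite sequence c is (2 pi)^-2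
    times the Fourier transform of W E_c, and the matrix g_alpha(x_k - x_j) is the Gram
    matrix of the weighted form (c, d) |-> (2 pi)^-2 int W <E_c, E_d>.  By the Riesz
    bounds this form is coercive, which gives the interpolating sequence.

    Let q = exp(- alpha delta), k = q + 8 q / (1 - q^2)^2, and let a^N be the truncations
    of the interpolating sequence, h_N = E_(a^N).  Summing over the shells around S and
    using that translations of S only rotate the coefficients, the part of
    int W |E_c|^2 outside S is at most k B^2 |c|^2.  In the limit, testing the
    interpolation equations
    - against h_N bounds |h_N|_S by 2 pi |F|_S e^(sqrt 2 alpha delta), and
    - against sums E_b close to W h_N on S (the exponentials are complete)
      bounds |W h_N|_S by 2 pi |F|_S + k B^4 |h_N|_S.
    Bessel's inequality for W h_N on the whole plane, Plancherel for F, Fatou's lemma and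
    q <= 1 - 1/sqrt 2 give the constant 13. *)

(** The interpolating sequence is only square summable, so its exponential sum has no pointwise
    meaning. The estimates are therefore made for truncations, which satisfy the tested equations up
    to a residual s |b|_W, and s goes to 0 only in the final bound.

    The exponent sqrt 2 - 1 comes from a cancellation. Coercivity costs e^(sqrt 2 alpha delta) = M /
    q with M = e^(alpha delta (sqrt 2 - 1)). On S the function W h_N, not h_N, is bounded by
    duality, so M / q enters only multiplied by the tail constant k, which is of order q. Outside S
    the weight of the energy is W^2, whose tail constant is of order q^2 and meets (M / q)^2. Of the
    power B^4, one B^2 is the upper Riesz bound on the translates of S, the other returns from
    coefficients to the norm on S.

    Plancherel enters as two opposite inequalities. The upper one (Bessel) is Schur's test for a
    smoothed kernel. The lower one is first proved for Lipschitz functions cut off by S, where the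
    smoothing error is explicit, and then extended by density of the exponentials. *)

HB.instance Definition _ (R : realType) := Measure.on (@leb2 R).

Lemma leb2_sigma_finite (R : realType) : sigma_finite setT (@leb2 R).
Proof.
have /sigma_finiteP[F [TF ndF Foo]] := sigma_finiteT (@lebesgue_measure R).
exists (fun n => F n `*` F n).
 rewrite -setXTT TF predeqE => -[x y]; split.
    move=> [/= [n _ Fnx] [k _ Gky]]; exists (maxn n k) => //; split.
    - by move: x Fnx; exact/subsetPset/ndF/leq_maxl.
    - by move: y Gky; exact/subsetPset/ndF/leq_maxr.
  by move=> [n _ []/= ? ?]; split; exists n.
move=> k; have [? ?] := Foo k.
split; first exact: measurableX.
by rewrite /leb2 product_measure1E// lte_mul_pinfty// ge0_fin_numE.
Qed.

HB.instance Definition _ (R : realType) :=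
  Measure_isSigmaFinite.Build _ _ _ (@leb2 R) (@leb2_sigma_finite R).

(** * Measurability and integration of real-valued functions *)

Definition meas {d} {T : measurableType d} {R : realType} (f : T -> R) :=
  measurable_fun [set: T] f.

Notation intg m f := (integrable m setT (EFin \o f)).
Notation "'I[' m ] f" := (Rintegral m setT f) (at level 10, f at level 9).

Section measurability.
Context {d} {T : measurableType d} {R : realType}.
Implicit Types f g : T -> R.

Lemma meas_cst (c : R) : meas (fun _ : T => c). Proof. exact: measurable_cst. Qed.
Lemma measD f g : meas f -> meas g -> meas (fun x => f x + g x).
Proof. exact: measurable_funD. Qed.
Lemma measB f g : meas f -> meas g -> meas (fun x => f x - g x).
Proof. exact: measurable_funB. Qed.
Lemma measM f g : meas f -> meas g -> meas (fun x => f x * g x).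
Proof. exact: measurable_funM. Qed.
Lemma measN f : meas f -> meas (fun x => - f x).
Proof. exact: measurable_funN. Qed.
Lemma measX f n : meas f -> meas (fun x => f x ^+ n).
Proof. exact: measurable_funX. Qed.
Lemma meas_cont (phi : R -> R) f : continuous phi -> meas f -> meas (fun x => phi (f x)).
Proof.
move=> /continuous_measurable_fun cphi mf.
exact: (measurableT_comp cphi mf).
Qed.
Lemma meas_norm f : meas f -> meas (fun x => `|f x|).
Proof. by move=> mf; exact: (measurableT_comp _ mf). Qed.
Lemma meas_comp d' (T' : measurableType d') (phi : T' -> T) f :
  measurable_fun setT phi -> meas f -> meas (fun x => f (phi x)).
Proof. by move=> mphi mf; exact: (measurableT_comp mf mphi). Qed.
Lemma meas_indic (D : set T) : measurable D -> meas (\1_D : T -> R).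
Proof. exact: measurable_indic. Qed.

End measurability.

Section integration.
Context {d} {T : measurableType d} {R : realType} (m : {measure set T -> \bar R}).
Implicit Types f g : T -> R.

Lemma intg_meas f : intg m f -> meas f.
Proof. by move/integrableP => [/measurable_EFinP]. Qed.

Lemma intg_le f g : meas f -> intg m g -> (forall x, `|f x| <= g x) -> intg m f.
Proof.
move=> mf ig fg; apply: (le_integrable _ _ _ ig) => //; first exact/measurable_EFinP.
by move=> x _ /=; rewrite lee_fin (le_trans (fg x))// ler_norm.
Qed.

Lemma intg_cst0 : intg m (fun=> 0).
Proof. by have := integrable0 m setT; congr (integrable _ _ _). Qed.

Lemma intg_abs f : intg m f -> intg m (fun x => `|f x|).
Proof. by move=> h; have := integrable_abse h. Qed.

Lemma intgD f g : intg m f -> intg m g -> intg m (fun x => f x + g x).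
Proof. by move=> hf hg; have := integrableD measurableT hf hg. Qed.

Lemma intgB f g : intg m f -> intg m g -> intg m (fun x => f x - g x).
Proof. by move=> hf hg; have := integrableB measurableT hf hg. Qed.

Lemma intgZ c f : intg m f -> intg m (fun x => c * f x).
Proof. by move=> hf; have := integrableZl measurableT c hf. Qed.

Lemma intgN f : intg m f -> intg m (fun x => - f x).
Proof. by move=> hf; have := integrableN hf. Qed.

Lemma intg_sum (J : Type) (s : seq J) (h : J -> T -> R) :
  (forall i, intg m (h i)) -> intg m (fun x => \sum_(i <- s) h i x).
Proof.
move=> hh; elim: s => [|a s IH].
  by under [X in EFin \o X]funext do rewrite big_nil; exact: intg_cst0.
by under [X in EFin \o X]funext do rewrite big_cons; exact: intgD.
Qed.

Lemma intgMb f h (C : R) : intg m f -> meas h -> (forall x, `|h x| <= C) ->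
  intg m (fun x => f x * h x).
Proof.
move=> hf mh hC; apply: (@intg_le _ (fun x => C * `|f x|)).
- by apply: measM => //; exact: intg_meas.
- exact/intgZ/intg_abs.
- by move=> x; rewrite normrM mulrC ler_wpM2r.
Qed.

Lemma I_EFin f : intg m f -> (\int[m]_x (f x)%:E)%E = (I[m] f)%:E.
Proof. by move=> h; rewrite /Rintegral fineK//; exact: integrable_fin_num. Qed.

Lemma I_D f g : intg m f -> intg m g -> I[m] (fun x => f x + g x) = I[m] f + I[m] g.
Proof. exact: RintegralD. Qed.
Lemma I_B f g : intg m f -> intg m g -> I[m] (fun x => f x - g x) = I[m] f - I[m] g.
Proof. exact: RintegralB. Qed.
Lemma I_Z c f : intg m f -> I[m] (fun x => c * f x) = c * I[m] f.
Proof. exact: RintegralZl. Qed.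
Lemma I_0 : I[m] (fun=> 0) = 0 :> R.
Proof. by rewrite /Rintegral integral0. Qed.
Lemma I_N f : intg m f -> I[m] (fun x => - f x) = - I[m] f.
Proof.
by move=> h; rewrite -mulN1r -I_Z//; congr (I[m] _); apply/funext => x; rewrite mulN1r.
Qed.
Lemma I_sum (J : Type) (s : seq J) (h : J -> T -> R) : (forall i, intg m (h i)) ->
  I[m] (fun x => \sum_(i <- s) h i x) = \sum_(i <- s) I[m] (h i).
Proof.
move=> hh; elim: s => [|a s IH].
  by rewrite big_nil -[RHS]I_0; congr (I[m] _); apply/funext => x; rewrite big_nil.
rewrite big_cons -IH -I_D//; last exact: intg_sum.
by congr (I[m] _); apply/funext => x; rewrite big_cons.
Qed.
Lemma I_le f g : intg m f -> intg m g -> (forall x, f x <= g x) -> I[m] f <= I[m] g.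
Proof. by move=> hf hg fg; apply: le_Rintegral. Qed.
Lemma I_ge0 f : (forall x, 0 <= f x) -> 0 <= I[m] f.
Proof. by move=> h; apply: Rintegral_ge0. Qed.
Lemma I_abs f : intg m f -> `|I[m] f| <= I[m] (fun x => `|f x|).
Proof. exact: le_normr_Rintegral. Qed.

Lemma intg_ge0P f : meas f -> (forall x, 0 <= f x) ->
  (\int[m]_x (f x)%:E < +oo)%E -> intg m f.
Proof.
move=> mf f0 h; apply/integrableP; split; first exact/measurable_EFinP.
by under eq_integral => x _ do rewrite /= ger0_norm//.
Qed.

Lemma intg_eqE f r : meas f -> (forall x, 0 <= f x) ->
  (\int[m]_x (f x)%:E = r%:E)%E -> intg m f /\ I[m] f = r.
Proof.
move=> mf f0 h; split; first by apply: intg_ge0P => //; rewrite h ltry.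
by rewrite /Rintegral h.
Qed.

Lemma intg_leE f r : meas f -> (forall x, 0 <= f x) ->
  (\int[m]_x (f x)%:E <= r%:E)%E -> intg m f /\ I[m] f <= r.
Proof.
move=> mf f0 h; have i : intg m f.
  by apply: intg_ge0P => //; rewrite (le_lt_trans h)// ltry.
by split => //; rewrite -lee_fin -I_EFin.
Qed.

Lemma I_ae0 f : meas f -> {ae m, forall x, f x = 0} -> I[m] f = 0.
Proof.
move=> mf h; rewrite /Rintegral (@ae_eq_integral _ _ _ m setT (cst 0%E))//.
- by rewrite integral0.
- exact/measurable_EFinP.
- by apply: filterS h => x /= -> _.
Qed.

(** Evaluate at the vertex - b / a; if a = 0 and b is not 0, the affine function takes the value -1.
    This is the source of the Cauchy-Schwarz inequalities below and of the residual estimate in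
    [near_minimizer]. *)
Lemma psd_discr (a b c : R) : 0 <= a -> (forall t, 0 <= a * t ^+ 2 + 2 * b * t + c) ->
  b ^+ 2 <= a * c.
Proof.
move=> a0 h; have [a00|an0] := eqVneq a 0.
  rewrite a00 mul0r; have [->|bn0] := eqVneq b 0; first by rewrite expr0n.
  have := h (- (c + 1) / (2 * b)); rewrite a00 mul0r add0r.
  have -> : 2 * b * (- (c + 1) / (2 * b)) + c = -1 by field.
  by rewrite ler0N1.
have := h (- b / a); have -> : a * (- b / a) ^+ 2 + 2 * b * (- b / a) + c = (a * c - b ^+ 2) / a by field.
by rewrite pmulr_lge0 ?invr_gt0 ?lt_def ?an0// subr_ge0.
Qed.

End integration.

(** * Fubini's theorem under a bound by a product a(x) b(y) *)

Section fubini_dominated.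
Context {d1 d2} {T1 : measurableType d1} {T2 : measurableType d2} {R : realType}.
Variables (m1 : {sigma_finite_measure set T1 -> \bar R})
          (m2 : {sigma_finite_measure set T2 -> \bar R}).
Variables (phi : T1 * T2 -> R) (a : T1 -> R) (b : T2 -> R).
Hypotheses (mphi : meas phi) (ia : intg m1 a) (ib : intg m2 b).
Hypothesis dom : forall x y, `|phi (x, y)| <= a x * b y.

Let mab : meas (fun p : T1 * T2 => a p.1 * b p.2).
Proof.
apply: measM.
- exact: (meas_comp (phi:=fst) measurable_fst (intg_meas ia)).
- exact: (meas_comp (phi:=snd) measurable_snd (intg_meas ib)).
Qed.

Lemma dom_intg : intg (m1 \x m2)%E phi.
Proof.
apply/integrable12ltyP; first exact/measurable_EFinP.
apply: (@le_lt_trans _ _ (\int[m1]_x \int[m2]_y (`|a x| * `|b y|)%:E)%E).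
  apply: ge0_le_integral => //.
  - by move=> x _; exact: integral_ge0.
  - apply: (measurable_fun_fubini_tonelli_F (fun p => (`|phi p|)%:E)) => //.
    exact/measurable_EFinP/meas_norm.
  - apply: (measurable_fun_fubini_tonelli_F (fun p => (`|a p.1| * `|b p.2|)%:E)) => //.
    apply/measurable_EFinP.
    by under [X in measurable_fun _ X]funext do rewrite -normrM; exact: meas_norm.
  - move=> x _; apply: ge0_le_integral => //.
    + apply/measurable_EFinP/meas_norm; exact: (meas_comp (phi:=pair x) (measurable_pair1 x) mphi).
    + by apply/measurable_EFinP; apply: measM; [exact: meas_cst|exact: (meas_norm (intg_meas ib))].
    + by move=> y _; rewrite lee_fin -normrM (le_trans (dom x y))// ler_norm.
under eq_integral => x _.
  under eq_integral => y _ do rewrite EFinM.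
  rewrite integralZl//; last exact: intg_abs.
  rewrite I_EFin; last exact: intg_abs.
  over.
rewrite ge0_integralZr//.
- by rewrite I_EFin ?ltry//; exact: intg_abs.
- exact/measurable_EFinP/(meas_norm (intg_meas ia)).
- by rewrite lee_fin I_ge0.
Qed.

Lemma dom_intg1 x : intg m2 (fun y => phi (x, y)).
Proof.
apply: (intg_le _ (intgZ (a x) ib)) => //.
exact: (meas_comp (phi:=pair x) (measurable_pair1 x) mphi).
Qed.

Lemma dom_intg2 y : intg m1 (fun x => phi (x, y)).
Proof.
apply: (intg_le _ (intgZ (b y) ia)) => //.
  exact: (meas_comp (phi:=fun x => (x, y)) (measurable_pair2 y) mphi).
by move=> x; rewrite mulrC.
Qed.

Lemma dom_intgI1 : intg m1 (fun x => I[m2] (fun y => phi (x, y))).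
Proof.
have := integrable_fubini_F dom_intg; congr (integrable _ _ _).
apply/funext => x; rewrite /fubini_F /=; exact: (I_EFin (dom_intg1 x)).
Qed.

Lemma dom_intgI2 : intg m2 (fun y => I[m1] (fun x => phi (x, y))).
Proof.
apply: (@intg_le _ _ _ _ _ (fun y => (I[m1] a) * b y)).
- have := measurable_fubini_G dom_intg.
  rewrite (_ : fubini_G m1 _ = EFin \o (fun y => I[m1] (fun x => phi (x, y)))).
    by move/measurable_EFinP.
  by apply/funext => y; exact: (I_EFin (dom_intg2 y)).
- exact: intgZ.
- move=> y; apply: (le_trans (I_abs (dom_intg2 y))).
  rewrite mulrC -I_Z//; apply: I_le.
  + exact: intg_abs (dom_intg2 y).
  + exact: intgZ.
  + by move=> x; rewrite mulrC.
Qed.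

Lemma dom_prod : I[(m1 \x m2)%E] phi = I[m1] (fun x => I[m2] (fun y => phi (x, y))).
Proof.
apply: EFin_inj; rewrite -!I_EFin//; [|exact: dom_intgI1|exact: dom_intg].
rewrite -(integral12_prod_meas1 dom_intg); apply: eq_integral => x _.
exact: (I_EFin (dom_intg1 x)).
Qed.

Lemma dom_swap :
  I[m1] (fun x => I[m2] (fun y => phi (x, y))) = I[m2] (fun y => I[m1] (fun x => phi (x, y))).
Proof.
apply: EFin_inj; rewrite -!I_EFin//; [|exact: dom_intgI2|exact: dom_intgI1].
transitivity (\int[m1]_x \int[m2]_y (EFin \o phi) (x, y))%E.
  by apply: eq_integral => x _; rewrite -(I_EFin (dom_intg1 x)).
rewrite (Fubini dom_intg).
by apply: eq_integral => y _; rewrite -(I_EFin (dom_intg2 y)).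
Qed.

End fubini_dominated.

(** * Derivatives, improper integrals, folding of the line at 0 *)

Section calculus.
Context {R : realType}.
Implicit Types (f g : R -> R) (x a b : R).

Definition hd f x a := is_derive x (1 : R) f a.

Lemma hd_eq f x a b : hd f x a -> a = b -> hd f x b. Proof. by move=> h <-. Qed.
Lemma hdc (c : R) x : hd (fun=> c) x 0. Proof. exact: is_derive_cst. Qed.
Lemma hdi x : hd (fun t => t) x 1. Proof. exact: is_derive_id. Qed.
Lemma hdD f g x a b : hd f x a -> hd g x b -> hd (fun t => f t + g t) x (a + b).
Proof. exact: is_deriveD. Qed.
Lemma hdN f x a : hd f x a -> hd (fun t => - f t) x (- a).
Proof. exact: is_deriveN. Qed.
Lemma hdM f g x a b : hd f x a -> hd g x b -> hd (fun t => f t * g t) x (a * g x + f x * b).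
Proof.
move=> h1 h2; have := is_deriveM h1 h2; congr (is_derive _ _ _ _).
by rewrite /GRing.scale/= addrC [g x * a]mulrC.
Qed.
Lemma hdV f x a : f x != 0 -> hd f x a -> hd (fun t => (f t)^-1) x (- a / f x ^+ 2).
Proof.
move=> f0 h; have := is_deriveV f0 h; congr (is_derive _ _ _ _).
by rewrite /GRing.scale/= !mulNr mulrC.
Qed.
Lemma hd_comp f g x a b : hd f (g x) a -> hd g x b -> hd (fun t => f (g t)) x (a * b).
Proof. by move=> h1 h2; have := is_derive1_comp h1 h2; congr (is_derive _ _ _ _); rewrite /GRing.scale/= mulrC. Qed.
Lemma hd_exp g x b : hd g x b -> hd (fun t => expR (g t)) x (expR (g x) * b).
Proof. by move=> h; exact: (hd_comp (is_derive_expR _) h). Qed.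
Lemma hd_cos g x b : hd g x b -> hd (fun t => cos (g t)) x (- sin (g x) * b).
Proof. by move=> h; exact: (hd_comp (is_derive_cos _) h). Qed.
Lemma hd_sin g x b : hd g x b -> hd (fun t => sin (g t)) x (cos (g x) * b).
Proof. by move=> h; exact: (hd_comp (is_derive_sin _) h). Qed.
Lemma hd_atan g x b : hd g x b -> hd (fun t => atan (g t)) x ((1 + g x ^+ 2)^-1 * b).
Proof. by move=> h; exact: (hd_comp (is_derive1_atan _) h). Qed.

Lemma hdX f x a n : hd f x a -> hd (fun t => f t ^+ n) x ((n%:R * f x ^+ n.-1) * a).
Proof.
move=> h; have -> : (fun t => f t ^+ n) = f ^+ n; last exact: is_deriveX.
by apply/funext => t; elim: n => [|n IH]; rewrite ?expr0// !exprS IH.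
Qed.

Lemma hd_cont f x a : hd f x a -> {for x, continuous f}.
Proof. by move=> [df _]; exact/differentiable_continuous/derivable1_diffP. Qed.

Lemma cvgy_inv f l C : (forall t, 0 < t -> `|f t - l| <= C / t) -> f t @[t --> +oo] --> l.
Proof.
move=> h; apply/cvgrPdist_le => e e0; near=> t.
have t0 : 0 < t by near: t; exact: nbhs_pinfty_gt.
rewrite distrC; apply: (le_trans (h _ t0)).
rewrite ler_pdivrMr// mulrC -ler_pdivrMr//.
Unshelve. all: end_near. Qed.

Lemma ftc_y f F (l : R) : (forall t, hd F t (f t)) -> (forall t, 0 <= t -> 0 <= f t) ->
  continuous f -> F t @[t --> +oo] --> l ->
  (\int[lebesgue_measure]_(t in `[0%R, +oo[) (f t)%:E = (l - F 0)%R%:E)%E.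
Proof.
move=> dF f0 cf Fl; rewrite EFinB; apply: ge0_continuous_FTC2y => //.
- exact: continuous_subspaceT.
- by move=> x _; have [] := dF x.
- exact/cvg_at_right_filter/(hd_cont (dF 0)).
- by move=> x _; have [_] := dF x; rewrite derive1E.
Qed.

Lemma int_split_sym (f : R -> \bar R) : measurable_fun setT f -> (forall x, 0 <= f x)%E ->
  (\int[lebesgue_measure]_x f x = \int[lebesgue_measure]_(x in `[0%R, +oo[) (f x + f (- x)%R))%E.
Proof.
move=> mf f0.
have mfN : measurable_fun setT (fun x => f (- x)).
  by apply: (measurableT_comp mf); exact: measurable_funN.
rewrite ge0_integralD//; [|exact: measurable_funS mf|exact: measurable_funS mfN].
have -> : (\int[lebesgue_measure]_(x in `[0%R, +oo[) f (- x)%R =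
           \int[lebesgue_measure]_(x in `]-oo, 0%R]) f x)%E.
  rewrite (ge0_integration_by_substitution0 (f := fun x => f (- x)))//.
  by apply: eq_integral => x _; rewrite opprK.
rewrite addeC -(@integral_itv_obnd_cbnd _ 0 _ f); last exact: measurable_funS mf.
rewrite -ge0_integral_setU//=.
- by congr (integral _ _ _); rewrite itv_setU_setT.
- exact: measurable_funS mf.
- by apply/disj_setPS => x /=; rewrite !in_itv/= => -[]; rewrite andbT; case: leP.
Qed.

End calculus.

(** Differentiates along the syntactic shape of the function. What it leaves open is that
    denominators do not vanish, and any function of another shape. *)
Ltac hd_auto := lazymatch goal with
  | |- hd (fun _ => ?c) _ _ => exact: hdc
  | |- hd (fun t => t) _ _ => exact: hdi
  | |- hd (fun t => @?f t + @?g t) _ _ => apply: (@hdD _ f g); hd_auto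
  | |- hd (fun t => - @?f t) _ _ => apply: (@hdN _ f); hd_auto
  | |- hd (fun t => @?f t * @?g t) _ _ => apply: (@hdM _ f g); hd_auto
  | |- hd (fun t => @?f t ^+ ?n) _ _ => apply: (@hdX _ f _ _ n); hd_auto
  | |- hd (fun t => (@?f t)^-1) _ _ => apply: (@hdV _ f); [|hd_auto]
  | |- hd (fun t => expR (@?f t)) _ _ => apply: (@hd_exp _ f); hd_auto
  | |- hd (fun t => cos (@?f t)) _ _ => apply: (@hd_cos _ f); hd_auto
  | |- hd (fun t => sin (@?f t)) _ _ => apply: (@hd_sin _ f); hd_auto
  | |- hd (fun t => atan (@?f t)) _ _ => apply: (@hd_atan _ f); hd_auto
  | |- _ => idtac
  end.

(** * Laplace integrals and the Fourier transform of the Poisson kernel *)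

Section explicit_integrals.
Context {R : realType}.
Implicit Types (A c t r : R).
Local Notation leb := (@lebesgue_measure R).

Lemma expR_mul_le1 A t : 0 < A -> 0 <= t -> expR (- (A * t)) * t <= A^-1.
Proof.
move=> A0 t0; rewrite expRN mulrC ler_pdivrMr ?expR_gt0// ler_pdivlMl//.
by rewrite (le_trans _ (expR_ge1Dx _))// lerDr.
Qed.

Lemma expR_mul_le2 A t : 0 < A -> 0 <= t -> expR (- (A * t)) * t ^+ 2 <= 2 / A ^+ 2.
Proof.
move=> A0 t0; have At0 : 0 <= A * t by rewrite mulr_ge0// ltW.
rewrite expRN ler_pdivlMr ?exprn_gt0// -mulrA ler_pdivrMl ?expR_gt0//.
have := expR_ge1Dxn 1 At0; rewrite (_ : 2`!%:R = 2)// exprMn; lra.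
Qed.

(** Multiplied by r the expression stays bounded, by the two preceding estimates, so it is
    O(1/r). *)
Lemma expR_affine_cvg0 A K1 K2 (phi : R -> R) : 0 < A -> 0 <= K1 -> 0 <= K2 ->
  (forall r, 0 < r -> `|phi r| <= K1 * r + K2) ->
  expR (- (A * r)) * phi r @[r --> +oo] --> (0 : R).
Proof.
move=> A0 K10 K20 h; apply: (cvgy_inv (C := K1 * (2 / A ^+ 2) + K2 * A^-1)) => r r0.
rewrite subr0 normrM gtr0_norm ?expR_gt0// ler_pdivlMr//.
have h1 := expR_mul_le1 A0 (ltW r0); have h2 := expR_mul_le2 A0 (ltW r0).
have e0 := expR_gt0 (- (A * r)).
apply: (@le_trans _ _ (expR (- (A * r)) * (K1 * r + K2) * r)).
  by rewrite ler_pM2r// ler_pM2l// h.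
rewrite (_ : _ * _ * r = K1 * (expR (- (A * r)) * r ^+ 2) + K2 * (expR (- (A * r)) * r)); last by ring.
by rewrite lerD// ler_wpM2l.
Qed.

(** Real part of - e^(-zr) / z with z = A - ic: a primitive of e^(-Ar) cos(cr). *)
Definition lap1_prim A c r : R :=
  expR (- (A * r)) * ((c * sin (c * r) - A * cos (c * r)) / (A ^+ 2 + c ^+ 2)).

Lemma sq_addr_gt0 A c : 0 < A -> 0 < A ^+ 2 + c ^+ 2.
Proof. by move=> A0; rewrite ltr_pwDl ?exprn_gt0 ?sqr_ge0. Qed.

Lemma hd_lap1_prim A c r : 0 < A -> hd (lap1_prim A c) r (expR (- (A * r)) * cos (c * r)).
Proof.
move=> A0; have N0 := lt0r_neq0 (sq_addr_gt0 c A0).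
rewrite /lap1_prim; apply: hd_eq; first by hd_auto.
by cbn beta; field.
Qed.

Lemma lap1_prim_cvg0 A c : 0 < A -> lap1_prim A c r @[r --> +oo] --> (0 : R).
Proof.
move=> A0; apply: (@expR_affine_cvg0 A 0 ((`|c| + A) / (A ^+ 2 + c ^+ 2))) => //.
  by apply: divr_ge0; [rewrite addr_ge0// ltW|rewrite ltW// sq_addr_gt0].
move=> r r0; rewrite mul0r add0r normrM [X in _ * X]gtr0_norm ?invr_gt0 ?sq_addr_gt0//.
rewrite ler_wpM2r ?invr_ge0 ?(ltW (sq_addr_gt0 _ _))//.
apply: (le_trans (ler_normB _ _)); rewrite !normrM (gtr0_norm A0).
by rewrite lerD// ler_piMr ?normr_ge0 ?sin_max ?cos_max// ltW.
Qed.

Lemma lap1_prim0 A c : lap1_prim A c 0 = - (A / (A ^+ 2 + c ^+ 2)).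
Proof. by rewrite /lap1_prim !mulr0 oppr0 expR0 sin0 cos0 mulr0 mulr1 mul1r sub0r mulNr. Qed.

(* primitive of r e^(-Ar) cos(cr), the real part of - e^(-zr) (r/z + 1/z^2), z = A - ic *)
Definition lap2_prim A c r : R :=
  expR (- (A * r)) * (sin (c * r) * (r * c / (A ^+ 2 + c ^+ 2) + 2 * A * c / (A ^+ 2 + c ^+ 2) ^+ 2)
   - cos (c * r) * (r * A / (A ^+ 2 + c ^+ 2) + (A ^+ 2 - c ^+ 2) / (A ^+ 2 + c ^+ 2) ^+ 2)).

(** Real part of 1 / z^2 with z = A - ic: the integral of r e^(-Ar) cos(cr) over r >= 0. *)
Definition lap2 A c : R := (A ^+ 2 - c ^+ 2) / (A ^+ 2 + c ^+ 2) ^+ 2.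

Lemma hd_lap2_prim A c r : 0 < A -> hd (lap2_prim A c) r (r * expR (- (A * r)) * cos (c * r)).
Proof.
move=> A0; have N0 := lt0r_neq0 (sq_addr_gt0 c A0).
rewrite /lap2_prim; apply: hd_eq; first by hd_auto.
by cbn beta; field.
Qed.

Lemma lap2_prim_cvg0 A c : 0 < A -> lap2_prim A c r @[r --> +oo] --> (0 : R).
Proof.
move=> A0; set N := A ^+ 2 + c ^+ 2; have N0 : 0 < N := sq_addr_gt0 c A0.
apply: (@expR_affine_cvg0 A (`|c| / N + A / N)
   (`|2 * A * c / N ^+ 2| + `|(A ^+ 2 - c ^+ 2) / N ^+ 2|)) => //.
- by rewrite addr_ge0 ?divr_ge0 ?normr_ge0// ltW.
- move=> r r0; apply: (le_trans (ler_normB _ _)).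
  have rA : r * A / N = `|r * A / N| by rewrite gtr0_norm// divr_gt0// mulr_gt0.
  have -> : (`|c| / N + A / N) * r + (`|2 * A * c / N ^+ 2| + `|(A ^+ 2 - c ^+ 2) / N ^+ 2|) =
     (`|r * c / N| + `|2 * A * c / N ^+ 2|) + (`|r * A / N| + `|(A ^+ 2 - c ^+ 2) / N ^+ 2|).
    by rewrite -rA !(normrM _ N^-1) (normrM r c) (gtr0_norm r0) [`|N^-1|]gtr0_norm ?invr_gt0//; ring.
  rewrite lerD// normrM.
  + by apply: (le_trans (ler_piMl _ (sin_max _))) => //; exact: ler_normD.
  + by apply: (le_trans (ler_piMl _ (cos_max _))) => //; exact: ler_normD.
Qed.

Lemma lap2_prim0 A c : lap2_prim A c 0 = - lap2 A c.
Proof.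
by rewrite /lap2_prim /lap2 !mulr0 !mul0r oppr0 expR0 sin0 cos0 !mul0r sub0r add0r !mul1r.
Qed.

(** The summand 1 keeps the integrand nonnegative, as [ftc_y] requires; the factor 2 is that of
    folding an even function at 0. *)
Lemma int_lap1 A c : 0 < A ->
  (\int[leb]_(r in `[0%R, +oo[) (2 * (expR (- (A * r)) * (1 + cos (c * r))))%:E =
   (2 * (A^-1 + A / (A ^+ 2 + c ^+ 2)))%R%:E)%E.
Proof.
move=> A0; rewrite (@ftc_y _ _ (fun r => 2 * (lap1_prim A 0 r + lap1_prim A c r)) (2 * (0 + 0))).
- congr (_%:E); rewrite !lap1_prim0; have := sq_addr_gt0 c A0 => /lt0r_neq0 N0.
  by field; rewrite N0 gt_eqF//= expr0n addr0 expf_neq0// gt_eqF.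
- move=> r; apply: hd_eq; first by apply: hdM; [exact: hdc|apply: hdD; exact: hd_lap1_prim].
  by rewrite !mul0r cos0; ring.
- by move=> r _; rewrite mulr_ge0 ?mulr_ge0 ?expR_ge0// -lerBlDl sub0r cos_geN1.
- move=> r; apply: hd_cont; hd_auto.
- by apply: cvgMl_tmp; apply: cvgD; exact: lap1_prim_cvg0.
Qed.

(** The half cosines arise from a product of two cosines, and the summand 1 again ensures
    nonnegativity. *)
Lemma int_lap2 A c1 c2 : 0 < A ->
  (\int[leb]_(r in `[0%R, +oo[)
     (r * expR (- (A * r)) * (1 + 2^-1 * cos (c1 * r) + 2^-1 * cos (c2 * r)))%:E =
   (A ^- 2 + 2^-1 * lap2 A c1 + 2^-1 * lap2 A c2)%R%:E)%E.
Proof.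
move=> A0; rewrite (@ftc_y _ _ (fun r => lap2_prim A 0 r + 2^-1 * lap2_prim A c1 r +
   2^-1 * lap2_prim A c2 r) (0 + 2^-1 * 0 + 2^-1 * 0)).
- congr (_%:E); rewrite !lap2_prim0 /lap2 expr0n/= subr0 addr0.
  have -> : A ^+ 2 / (A ^+ 2) ^+ 2 = A ^- 2 by field; rewrite gt_eqF.
  by ring.
- move=> r; apply: hd_eq.
    apply: hdD; [apply: hdD; [exact: hd_lap2_prim|]|]; (apply: hdM; [exact: hdc|exact: hd_lap2_prim]).
  by rewrite mul0r cos0; ring.
- move=> r r0; rewrite mulr_ge0 ?mulr_ge0 ?expR_ge0//.
  have := cos_geN1 (c1 * r); have := cos_geN1 (c2 * r); lra.
- move=> r; apply: hd_cont; hd_auto.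
- apply: cvgD; [apply: cvgD; [exact: lap2_prim_cvg0|]|]; apply: cvgMl_tmp; exact: lap2_prim_cvg0.
Qed.

End explicit_integrals.

Section quadratic_integral.
Context {R : realType}.
Implicit Types (a b t : R).
Local Notation leb := (@lebesgue_measure R).
Variable al : R.
Hypothesis al0 : 0 < al.

(** This is A^2 + c^2 for A = alpha sqrt(1 + t^2) and c = a + b t, expanded in powers of t so that
    no square root is differentiated. *)
Let den a b t : R := (al ^+ 2 + b ^+ 2) * t ^+ 2 + 2 * (a * b) * t + (al ^+ 2 + a ^+ 2).
Let h a b : R := Num.sqrt (al ^+ 2 + a ^+ 2 + b ^+ 2).
Let kp a b : R := al ^+ 2 / (al ^+ 2 + a ^+ 2 + b ^+ 2).

Let denE a b t : den a b t = al ^+ 2 * (1 + t ^+ 2) + (a + b * t) ^+ 2.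
Proof. by rewrite /den; ring. Qed.

Let den_ge a b t : al ^+ 2 * (1 + t ^+ 2) <= den a b t.
Proof. by rewrite denE lerDl sqr_ge0. Qed.

Let al2 : 0 < al ^+ 2. Proof. by rewrite exprn_gt0. Qed.
Let pt0 t : 0 < 1 + t ^+ 2. Proof. by rewrite ltr_pwDl ?sqr_ge0. Qed.
Let den0 a b t : 0 < den a b t.
Proof. by rewrite (lt_le_trans _ (den_ge _ _ _))// mulr_gt0. Qed.
Let q0 a b : 0 < al ^+ 2 + a ^+ 2 + b ^+ 2.
Proof. by rewrite ltr_pwDl ?sqr_ge0// ltr_pwDl ?sqr_ge0. Qed.
Let h0 a b : 0 < h a b. Proof. by rewrite sqrtr_gt0. Qed.
Let hE a b : h a b ^+ 2 = al ^+ 2 + a ^+ 2 + b ^+ 2. Proof. by rewrite sqr_sqrtr// ltW. Qed.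
Let p0 b : 0 < al ^+ 2 + b ^+ 2. Proof. by rewrite ltr_pwDl ?sqr_ge0. Qed.

Let sqE t : (al * Num.sqrt (1 + t ^+ 2)) ^+ 2 = al ^+ 2 * (1 + t ^+ 2).
Proof. by rewrite exprMn sqr_sqrtr// ltW. Qed.

(* u, v and the factor of atan are determined by matching coefficients in the derivative *)
Let prim a b t : R :=
  ((kp a b + 1 - 2 * al ^+ 2 / (al ^+ 2 + b ^+ 2)) * t + a * b * (kp a b + 1) / (al ^+ 2 + b ^+ 2))
     / den a b t
  + al / h a b ^+ 3 * atan (((al ^+ 2 + b ^+ 2) * t + a * b) / (al * h a b)).

Let hd_prim a b t : hd (prim a b) t (lap2 (al * Num.sqrt (1 + t ^+ 2)) (a + b * t)).
Proof.
rewrite /prim; apply: hd_eq.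
  by rewrite /den; hd_auto; exact: lt0r_neq0 (den0 a b t).
cbn beta; rewrite -/(den a b t) /lap2 sqE -denE.
set s := al * h a b; set p := al ^+ 2 + b ^+ 2; set D := den a b t.
have s2 : s ^+ 2 = al ^+ 2 * (al ^+ 2 + a ^+ 2 + b ^+ 2) by rewrite exprMn hE.
have sp : s != 0 by rewrite lt0r_neq0// mulr_gt0.
have Dn : D != 0 := lt0r_neq0 (den0 a b t).
have pn : p != 0 := lt0r_neq0 (p0 b).
have hn : h a b != 0 := lt0r_neq0 (h0 a b).
have qn : al ^+ 2 + a ^+ 2 + b ^+ 2 != 0 := lt0r_neq0 (q0 a b).
have aln : al != 0 by rewrite gt_eqF.
have -> : (1 + ((p * t + a * b) / s) ^+ 2)^-1 = s ^+ 2 / (p * D).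
  have e : s ^+ 2 + (p * t + a * b) ^+ 2 = p * D by rewrite s2 /p /D /den; ring.
  have -> : 1 + ((p * t + a * b) / s) ^+ 2 = (p * D) / s ^+ 2 by rewrite -e; field.
  by rewrite invfM invrK mulrC.
have -> : al / h a b ^+ 3 = kp a b / s.
  by rewrite /kp -hE /s; field; rewrite hn.
rewrite /kp; rewrite /D /den -/p in Dn *; rewrite /p in pn Dn *.
by field; rewrite sp qn pn Dn.
Qed.

Let cvg_affine_atan a b : atan (((al ^+ 2 + b ^+ 2) * t + a * b) / (al * h a b)) @[t --> +oo] --> pi / 2.
Proof.
apply: (cvg_comp _ _ _ (@cvgy_atan R)); apply/cvgryPge => M; near=> t.
rewrite ler_pdivlMr ?mulr_gt0// -lerBlDr -ler_pdivrMl//.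
Unshelve. all: end_near. Qed.

Let cvg_prim a b : prim a b t @[t --> +oo] --> al / h a b ^+ 3 * (pi / 2).
Proof.
rewrite -[X in _ --> X]add0r; apply: cvgD; last by apply: cvgMl_tmp; exact: cvg_affine_atan.
set u := (kp a b + 1 - _); set v := a * b * _ / _.
apply: (cvgy_inv (C := (`|u| + `|v|) / al ^+ 2)) => t t0.
rewrite subr0 normrM [X in _ * X]gtr0_norm ?invr_gt0// ler_pdivrMr// mulrAC ler_pdivlMr//.
apply: (@le_trans _ _ ((`|u| * t + `|v|) * t)).
  rewrite ler_pM2r// (le_trans (ler_normD _ _))// normrM (gtr0_norm t0)//.
apply: (@le_trans _ _ ((`|u| + `|v|) * (1 + t ^+ 2))); last first.
  by rewrite -mulrA ler_wpM2l ?addr_ge0// ler_pdivlMl.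
have := normr_ge0 u; have := normr_ge0 v; have := sqr_ge0 (t - 1); nra.
Qed.

(** At t = 0 the primitive is odd in b. Pairing a + b t with a - b t thus makes the lower limits
    cancel. *)
Let prim0 a b : prim a b 0 + prim a (- b) 0 = 0.
Proof.
have hN : h a (- b) = h a b by rewrite /h sqrrN.
have kN : kp a (- b) = kp a b by rewrite /kp sqrrN.
rewrite /prim /den hN kN !sqrrN !mulr0 !add0r expr0n/= !mulr0 !add0r !mulrN !mulNr atanN; ring.
Qed.

Lemma int_quadratic a b :
  (\int[leb]_(t in `[0%R, +oo[) (4 * ((al * Num.sqrt (1 + t ^+ 2)) ^- 2
      + 2^-1 * lap2 (al * Num.sqrt (1 + t ^+ 2)) (a + b * t)
      + 2^-1 * lap2 (al * Num.sqrt (1 + t ^+ 2)) (a - b * t)))%:E =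
   (2 * pi / al ^+ 2 + 2 * pi * al / Num.sqrt (al ^+ 2 + a ^+ 2 + b ^+ 2) ^+ 3)%R%:E)%E.
Proof.
have hN : h a (- b) = h a b by rewrite /h sqrrN.
rewrite (@ftc_y _ _ (fun t => 4 * (al ^- 2 * atan t + 2^-1 * (prim a b t + prim a (- b) t)))
   (4 * (al ^- 2 * (pi / 2) + 2^-1 * (al / h a b ^+ 3 * (pi / 2) + al / h a (- b) ^+ 3 * (pi / 2))))).
- congr (_%:E); rewrite prim0 atan0 hN -/(h a b); field.
  by rewrite !gt_eqF.
- move=> t; apply: hd_eq.
    apply: hdM; [exact: hdc|apply: hdD; first by hd_auto].
    apply: hdM; [exact: hdc|apply: hdD; exact: hd_prim].
  rewrite sqE [lap2 _ (a + - b * t)](_ : _ = lap2 (al * Num.sqrt (1 + t ^+ 2)) (a - b * t)) ?mulNr//.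
  by field; rewrite !gt_eqF.
- move=> t _.
  have H c : 0 <= (al * Num.sqrt (1 + t ^+ 2)) ^- 2 + lap2 (al * Num.sqrt (1 + t ^+ 2)) c.
    rewrite /lap2; set A2 := (al * _) ^+ 2.
    have A20 : 0 < A2 by rewrite /A2 sqE mulr_gt0.
    have N0 : 0 < A2 + c ^+ 2 by rewrite ltr_pwDl ?sqr_ge0.
    have -> : A2^-1 + (A2 - c ^+ 2) / (A2 + c ^+ 2) ^+ 2 =
      (2 * A2 ^+ 2 + A2 * c ^+ 2 + (c ^+ 2) ^+ 2) / (A2 * (A2 + c ^+ 2) ^+ 2).
      by field; rewrite !gt_eqF.
    have c2 := sqr_ge0 c.
    by apply: divr_ge0; [nra|rewrite mulr_ge0 ?sqr_ge0// ltW].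
  have := H (a + b * t); have := H (a - b * t); move=> h1 h2; apply: mulr_ge0 => //; lra.
- have cq c d : continuous (fun t : R => lap2 (al * Num.sqrt (1 + t ^+ 2)) (c + d * t)).
    have -> : (fun t : R => lap2 (al * Num.sqrt (1 + t ^+ 2)) (c + d * t)) =
        (fun t => (al ^+ 2 * (1 + t ^+ 2) - (c + d * t) ^+ 2) / den c d t ^+ 2).
      by apply/funext => t; rewrite /lap2 sqE -denE.
    move=> t; apply: hd_cont; rewrite /den; hd_auto.
    by rewrite expf_neq0// gt_eqF//; exact: den0.
  have cq2 : continuous (fun t : R => (al * Num.sqrt (1 + t ^+ 2)) ^- 2).
    have -> : (fun t : R => (al * Num.sqrt (1 + t ^+ 2)) ^- 2) =
        (fun t => (al ^+ 2 * (1 + t ^+ 2))^-1) by apply/funext => t; rewrite sqE.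
    move=> t; apply: hd_cont; hd_auto.
    by rewrite mulf_neq0 ?gt_eqF.
  have cq3 : continuous (fun t : R => lap2 (al * Num.sqrt (1 + t ^+ 2)) (a - b * t)).
    have -> : (fun t : R => lap2 (al * Num.sqrt (1 + t ^+ 2)) (a - b * t)) =
        (fun t => lap2 (al * Num.sqrt (1 + t ^+ 2)) (a + - b * t)).
      by apply/funext => t; rewrite mulNr.
    exact: cq.
  move=> t; apply: cvgMl_tmp; apply: cvgD; [apply: cvgD; first exact: cq2|].
    by apply: cvgMl_tmp; exact: cq.
  by apply: cvgMl_tmp; exact: cq3.
- apply: cvgMl_tmp; apply: cvgD; first by apply: cvgMl_tmp; exact: cvgy_atan.
  by apply: cvgMl_tmp; apply: cvgD; exact: cvg_prim.
Qed.

End quadratic_integral.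

(** * Plane integrals as iterated integrals over the positive quadrant *)

Section quadrants.
Context {R : realType}.
Local Notation leb := (@lebesgue_measure R).
Local Notation P2 := (measurableTypeR R * measurableTypeR R)%type.
Local Notation pos := `[0%R, +oo[%classic.

Lemma integral_pos_indic (f : R -> R) :
  (\int[leb]_(x in `[0%R, +oo[) (f x)%:E = \int[leb]_x (f x * \1_(`[0%R, +oo[) x)%:E)%E.
Proof.
rewrite integral_mkcond; apply: eq_integral => x _.
by rewrite patchE indicE; case: ifP => _; rewrite ?mulr1 ?mulr0.
Qed.

Lemma meas_inner (G : P2 -> R) : meas G -> (forall x t, 0 <= x -> 0 <= t -> 0 <= G (x, t)) ->
  measurable_fun (pos : set (measurableTypeR R)) (fun x => \int[leb]_(t in `[0%R, +oo[) (G (x, t))%:E)%E.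
Proof.
move=> mG G0.
(* G is nonnegative on the quadrant only; the maximum with 0 extends it to a nonnegative function on
   the plane, to which Tonelli applies. *)
pose H (p : P2) := (Num.max 0 (G p) * \1_pos p.2)%:E.
have mH : measurable_fun setT H.
  apply/measurable_EFinP; apply: measM.
    by apply: measurable_maxr => //; exact: measurable_cst.
  by apply: (meas_comp (phi := snd) measurable_snd); exact: meas_indic.
have H0 p : (0 <= H p)%E by rewrite lee_fin mulr_ge0// le_max lexx.
apply: (eq_measurable_fun (fun x => \int[leb]_t H (x, t))%E); last first.
  apply: measurable_funTS; exact: (@measurable_fun_fubini_tonelli_F _ _ (measurableTypeR R) (measurableTypeR R) R leb H mH H0).
move=> x; rewrite inE/= in_itv/= andbT => x0; rewrite integral_pos_indic.
apply: eq_integral => t _; rewrite /H /= !indicE; case: (boolP (t \in _)); rewrite ?mulr0// !mulr1.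
by rewrite inE/= in_itv/= andbT => t0; rewrite max_r// G0.
Qed.

Lemma tonelli_pos (G : P2 -> R) : meas G -> (forall x t, 0 <= x -> 0 <= t -> 0 <= G (x, t)) ->
  (\int[leb]_(x in `[0%R, +oo[) \int[leb]_(t in `[0%R, +oo[) (G (x, t))%:E =
   \int[leb]_(t in `[0%R, +oo[) \int[leb]_(x in `[0%R, +oo[) (G (x, t))%:E)%E.
Proof.
move=> mG G0.
pose H (p : P2) := (G p * (\1_pos p.1 * \1_pos p.2))%:E.
have mi : meas (\1_pos : measurableTypeR R -> R) by apply: meas_indic.
have mH : measurable_fun setT H.
  apply/measurable_EFinP; apply: measM => //; apply: measM.
    exact: (meas_comp (phi := fst) measurable_fst mi).
  exact: (meas_comp (phi := snd) measurable_snd mi).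
have H0 p : (0 <= H p)%E.
  case: p => x t; rewrite lee_fin /= !indicE.
  case: (boolP (x \in _)) => [/set_mem|_]; last by rewrite mul0r mulr0.
  case: (boolP (t \in _)) => [/set_mem|_]; last by rewrite mulr0 mulr0.
  by rewrite /= !in_itv/= !andbT => t0 x0; rewrite !mulr1 G0.
have := @fubini_tonelli _ _ (measurableTypeR R) (measurableTypeR R) R leb leb H mH H0.
rewrite [in X in _ -> X = _]integral_mkcond [in X in _ -> _ = X]integral_mkcond.
have E1 x : ((fun x => \int[leb]_(t in `[0%R, +oo[) (G (x, t))%:E) \_ pos)%E x = (\int[leb]_t H (x, t))%E.
  rewrite patchE /H; case: ifPn => xp.
    by rewrite integral_pos_indic; apply: eq_integral => t _; rewrite /= !indicE xp mul1r.
  by rewrite integral0_eq// => t _; rewrite /= !indicE (negbTE xp) mul0r mulr0.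
have E2 t : ((fun t => \int[leb]_(x in `[0%R, +oo[) (G (x, t))%:E) \_ pos)%E t = (\int[leb]_x H (x, t))%E.
  rewrite patchE /H; case: ifPn => tp.
    by rewrite integral_pos_indic; apply: eq_integral => x _; rewrite /= !indicE tp mulr1.
  by rewrite integral0_eq// => x _; rewrite /= !indicE (negbTE tp) !mulr0.
move=> F; transitivity (\int[leb]_x \int[leb]_t H (x, t))%E.
  by apply: eq_integral => x _; exact: E1.
by rewrite F; apply: eq_integral => t _; rewrite E2.
Qed.

Lemma integral_quadrants (h : P2 -> \bar R) : measurable_fun setT h -> (forall p, 0 <= h p)%E ->
  (\int[@leb2 R]_p h p = \int[leb]_(x in `[0%R, +oo[) \int[leb]_(y in `[0%R, +oo[)
     (h (x, y) + h (x, - y)%R + (h ((- x)%R, y) + h ((- x)%R, (- y)%R))))%E.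
Proof.
move=> mh h0.
have mN : measurable_fun setT (-%R : measurableTypeR R -> measurableTypeR R).
  by apply: measurable_funN; exact: measurable_id.
have m1 x : measurable_fun setT (fun y => h (x, y)).
  by apply: (measurableT_comp mh); exact: measurable_pair1.
have m1' x : measurable_fun setT (fun y : measurableTypeR R => h (x, - y)).
  exact: (measurableT_comp (m1 x) mN).
rewrite /leb2 fubini_tonelli1//.
rewrite int_split_sym; [|exact: measurable_fun_fubini_tonelli_F|]; last first.
  by move=> x; exact: integral_ge0.
apply: eq_integral => x _; rewrite /fubini_F /=.
rewrite !int_split_sym//; [|exact: m1..].
rewrite -ge0_integralD//.
- by move=> y _; rewrite adde_ge0.
- by apply: (measurable_funS (E := setT)) => //; apply: emeasurable_funD; [exact: m1|exact: m1'].
- by move=> y _; rewrite adde_ge0.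
- by apply: (measurable_funS (E := setT)) => //; apply: emeasurable_funD; [exact: m1|exact: m1'].
Qed.

End quadrants.

Notation plane R := (measurableTypeR R * measurableTypeR R)%type.

Section plane_measurability.
Context {R : realType}.
Local Notation P2 := (plane R).

Lemma meas1 : meas (fun p : P2 => p.1 : R). Proof. exact: measurable_fst. Qed.
Lemma meas2 : meas (fun p : P2 => p.2 : R). Proof. exact: measurable_snd. Qed.
Lemma meas_dot (x : R * R) : meas (fun p : P2 => dot2 p x).
Proof.
apply: measD; apply: measM; [exact: meas1|exact: meas_cst|exact: meas2|exact: meas_cst].
Qed.
Lemma meas_cos d (T : measurableType d) (f : T -> R) : meas f -> meas (fun t => cos (f t)).
Proof. by apply: meas_cont; exact: continuous_cos. Qed.
Lemma meas_sin d (T : measurableType d) (f : T -> R) : meas f -> meas (fun t => sin (f t)).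
Proof. by apply: meas_cont; exact: continuous_sin. Qed.
Lemma meas_exp d (T : measurableType d) (f : T -> R) : meas f -> meas (fun t => expR (f t)).
Proof. by apply: meas_cont; exact: continuous_expR. Qed.
Lemma meas_sqrt d (T : measurableType d) (f : T -> R) : meas f -> meas (fun t => Num.sqrt (f t)).
Proof. by apply: meas_cont; exact: sqrt_continuous. Qed.

Definition wexp (al : R) (p : P2) : R := expR (- (al * Num.sqrt (p.1 ^+ 2 + p.2 ^+ 2))).

Lemma meas_wexp al : meas (wexp al).
Proof.
apply/meas_exp/measN/measM; first exact: meas_cst.
by apply/meas_sqrt/measD; apply: measX; [exact: meas1|exact: meas2].
Qed.

Lemma wexp_gt0 al p : 0 < wexp al p. Proof. exact: expR_gt0. Qed.
Lemma wexp_le1 al p : 0 < al -> wexp al p <= 1.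
Proof. by move=> a0; rewrite -expR0 ler_expR oppr_le0 mulr_ge0 ?sqrtr_ge0// ltW. Qed.

End plane_measurability.

Section poisson_fourier.
Context {R : realType}.
Local Notation leb := (@lebesgue_measure R).
Local Notation P2 := (plane R).
Variable al : R.
Hypothesis al0 : 0 < al.

Let cosM (u v : R) : cos u * cos v = 2^-1 * cos (u + v) + 2^-1 * cos (u - v).
Proof. by rewrite cosD cosB; field. Qed.

(** The integral of W (1 + cos(a x + b y)); its first summand is the integral of W alone. *)
Let total a b : R := 2 * pi / al ^+ 2 + 2 * pi * al / Num.sqrt (al ^+ 2 + a ^+ 2 + b ^+ 2) ^+ 3.

(* the substitution y = x t turns the quadrant integral into int_lap2 followed by int_quadratic *)
Let quadrant a b :
  (\int[leb]_(x in `[0%R, +oo[) \int[leb]_(y in `[0%R, +oo[)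
     (4 * wexp al (x, y) * (1 + cos (a * x) * cos (b * y)))%R%:E = (total a b)%:E)%E.
Proof.
pose G (p : P2) : R := 4 * (p.1 * expR (- (al * Num.sqrt (1 + p.2 ^+ 2) * p.1)) *
   (1 + 2^-1 * cos ((a + b * p.2) * p.1) + 2^-1 * cos ((a - b * p.2) * p.1))).
have mG : meas G.
  have m1 := @meas1 R; have m2 := @meas2 R.
  apply: measM; first exact: meas_cst.
  apply: measM.
    apply: measM => //; apply/meas_exp/measN; apply: measM => //; apply: measM; first exact: meas_cst.
    by apply/meas_sqrt/measD; [exact: meas_cst|exact: measX].
  apply: measD; first (apply: measD; first exact: meas_cst).
    apply: measM; first exact: meas_cst.
    apply/meas_cos/measM => //; apply: measD; first exact: meas_cst.
    by apply: measM => //; exact: meas_cst.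
  apply: measM; first exact: meas_cst.
  apply/meas_cos/measM => //; apply: measB; first exact: meas_cst.
  by apply: measM => //; exact: meas_cst.
have Gpos x t : 0 <= x -> 0 <= G (x, t).
  move=> x0; rewrite /G mulr_ge0// mulr_ge0//= ?mulr_ge0 ?expR_ge0//.
  have := cos_geN1 ((a + b * t) * x); have := cos_geN1 ((a - b * t) * x); lra.
have G0 x t : 0 <= x -> 0 <= t -> 0 <= G (x, t) by move=> + _; exact: Gpos.
have kpos (x y : R) : 0 <= 1 + cos (a * x) * cos (b * y).
  rewrite cosM; have := cos_geN1 (a * x + b * y); have := cos_geN1 (a * x - b * y); lra.
have k0 (x y : R) : 0 <= x -> 0 <= y -> 0 <= 4 * wexp al (x, y) * (1 + cos (a * x) * cos (b * y)).
  by move=> _ _; rewrite !mulr_ge0// ltW// wexp_gt0.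
have sub_pos : ([set` `]0, +oo[] : set R) `<=` [set` `[0, +oo[].
  by move=> z; rewrite /= !in_itv/= !andbT => /ltW.
have mk : meas (fun p : P2 => 4 * wexp al p * (1 + cos (a * p.1) * cos (b * p.2))).
  apply: measM; first by apply: measM; [exact: meas_cst|exact: meas_wexp].
  apply: measD; first exact: meas_cst.
  by apply: measM; apply/meas_cos/measM; [exact: meas_cst|exact: meas1|exact: meas_cst|exact: meas2].
transitivity (\int[leb]_(x in `[0%R, +oo[) \int[leb]_(t in `[0%R, +oo[) (G (x, t))%:E)%E.
  (* The point x = 0 is dropped, since y = x t is a substitution only for x > 0. *)
  transitivity (\int[leb]_(x in `]0%R, +oo[) \int[leb]_(y in `[0%R, +oo[)
     (4 * wexp al (x, y) * (1 + cos (a * x) * cos (b * y)))%R%:E)%E.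
    rewrite integral_itv_obnd_cbnd//; apply: measurable_funS (meas_inner mk k0) => //.
  transitivity (\int[leb]_(x in `]0%R, +oo[) \int[leb]_(t in `[0%R, +oo[) (G (x, t))%:E)%E; last first.
    rewrite integral_itv_obnd_cbnd//; apply: measurable_funS (meas_inner mG G0) => //.
  apply: eq_integral => x; rewrite inE/= in_itv/= andbT => x0.
  pose Fx (t : R) : R := x * t.
  have dx : derive1 Fx = cst x.
    by apply/funext => t; rewrite derive1E; have [_ ->] := hdM (hdc x t) (hdi t); rewrite mul0r add0r mulr1.
  have := @increasing_ge0_integration_by_substitutiony _ Fx (fun y =>
    4 * wexp al (x, y) * (1 + cos (a * x) * cos (b * y))) 0.
  have F0 : Fx 0 = 0 by rewrite /Fx mulr0.
  rewrite F0 dx => ->.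
  - apply: eq_integral => t; rewrite inE/= in_itv/= andbT => t0; congr (_%:E).
    change (4 * wexp al (x, Fx t) * (1 + cos (a * x) * cos (b * Fx t)) * x = G (x, t)).
    rewrite /G /wexp /Fx /= cosM.
    have -> : x ^+ 2 + (x * t) ^+ 2 = x ^+ 2 * (1 + t ^+ 2) by ring.
    rewrite sqrtrM ?sqr_ge0// sqrtr_sqr gtr0_norm//.
    have -> : a * x + b * (x * t) = (a + b * t) * x by ring.
    have -> : a * x - b * (x * t) = (a - b * t) * x by ring.
    have -> : al * (x * Num.sqrt (1 + t ^+ 2)) = al * Num.sqrt (1 + t ^+ 2) * x by ring.
    by rewrite addrA; ring.
  - by move=> u v _ _ uv; rewrite ltr_pM2l.
  - by move=> t _; exact: cst_continuous.
  - exact: is_cvg_cst.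
  - exact: is_cvg_cst.
  - split; first by move=> t _; have [] := hdM (hdc x t) (hdi t).
    exact/cvg_at_right_filter/(hd_cont (hdM (hdc x 0) (hdi 0))).
  - apply/cvgryPge => M; near=> t; rewrite /Fx -ler_pdivrMl//.
  - apply: continuous_subspaceT => y.
    have c1 : continuous (fun y : R => 1 + cos (a * x) * cos (b * y)).
      by move=> z; apply: hd_cont; hd_auto.
    have c2 : continuous (fun y : R => x ^+ 2 + y ^+ 2).
      by move=> z; apply: hd_cont; hd_auto.
    have c3' : continuous (fun y : R => Num.sqrt (x ^+ 2 + y ^+ 2)).
      by move=> z; exact: (continuous_comp (c2 z) (@sqrt_continuous R _)).
    have c3 : continuous (fun y : R => - (al * Num.sqrt (x ^+ 2 + y ^+ 2))).
      move=> z; apply: (@cvgN R R); apply: cvgM; first exact: cvg_cst.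
      exact: c3'.
    have c4 : continuous (fun y : R => wexp al (x, y)).
      by move=> z; exact: (continuous_comp (c3 z) (@continuous_expR R _)).
    apply: cvgM; last exact: c1.
    by apply: cvgM; [exact: cvg_cst|exact: c4].
  - by move=> y _; apply: mulr_ge0 => //; rewrite mulr_ge0// ltW// wexp_gt0.
rewrite tonelli_pos//.
transitivity (\int[leb]_(t in `[0%R, +oo[) (4 * ((al * Num.sqrt (1 + t ^+ 2)) ^- 2
      + 2^-1 * lap2 (al * Num.sqrt (1 + t ^+ 2)) (a + b * t)
      + 2^-1 * lap2 (al * Num.sqrt (1 + t ^+ 2)) (a - b * t)))%R%:E)%E.
  apply: eq_integral => t _.
  have A0 : 0 < al * Num.sqrt (1 + t ^+ 2).
    by rewrite mulr_gt0// sqrtr_gt0 ltr_pwDl ?sqr_ge0.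
  rewrite EFinM -(int_lap2 (a + b * t) (a - b * t) A0) -ge0_integralZl//.
  - apply: measurable_funTS; apply/measurable_EFinP.
    have -> : (fun r : R => r * expR (- (al * Num.sqrt (1 + t ^+ 2) * r)) *
         (1 + 2^-1 * cos ((a + b * t) * r) + 2^-1 * cos ((a - b * t) * r))) =
         (fun r => 4^-1 * G (r, t)) by apply/funext => r; rewrite /G/=; field.
    apply: measurable_funM; first exact: measurable_cst.
    by apply: (measurableT_comp mG); exact: measurable_pair2.
  - move=> x; rewrite /= in_itv/= andbT => x0; rewrite lee_fin.
    have -> : forall z w, x * z * w = 4^-1 * (4 * (x * z * w)) by move=> z w; field.
    rewrite mulr_ge0//; exact: (Gpos x t).
exact: int_quadratic.
Unshelve. all: by end_near. Qed.

Let meas_lin a b : meas (fun p : P2 => a * p.1 + b * p.2).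
Proof.
by apply: measD; apply: measM; [exact: meas_cst|exact: meas1|exact: meas_cst|exact: meas2].
Qed.

Let meas_cos1 a b : meas (fun p : P2 => wexp al p * (1 + cos (a * p.1 + b * p.2))).
Proof.
apply: measM; first exact: meas_wexp.
by apply: measD; [exact: meas_cst|exact: (meas_cos (meas_lin a b))].
Qed.

Let meas_sin1 a b : meas (fun p : P2 => wexp al p * (2 * (1 + sin (a * p.1 + b * p.2)))).
Proof.
apply: measM; first exact: meas_wexp.
apply: measM; first exact: meas_cst.
by apply: measD; [exact: meas_cst|exact: (meas_sin (meas_lin a b))].
Qed.

Let int_wexp_cos a b :
  (\int[@leb2 R]_p (wexp al p * (1 + cos (a * p.1 + b * p.2)))%:E = (total a b)%:E)%E.
Proof.
rewrite integral_quadrants.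
- rewrite -quadrant; apply: eq_integral => x _; apply: eq_integral => y _.
  rewrite -!EFinD /wexp/= !sqrrN !mulrN; congr (_%:E).
  have -> : - (a * x) + b * y = - (a * x - b * y) by ring.
  have -> : - (a * x) - b * y = - (a * x + b * y) by ring.
  by rewrite !cosN cosB cosD; ring.
- apply/measurable_EFinP; exact: meas_cos1.
- move=> p; rewrite lee_fin; apply: mulr_ge0; first exact/ltW/wexp_gt0.
  by rewrite -lerBlDl sub0r cos_geN1.
Qed.

(** Over the four quadrants the sines cancel and leave 8 W, which is the integrand of [quadrant] at
    a = b = 0; the factor 2 is there to match it. *)
Let int_wexp_sin a b :
  (\int[@leb2 R]_p (wexp al p * (2 * (1 + sin (a * p.1 + b * p.2))))%:E = (total 0 0)%:E)%E.
Proof.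
rewrite integral_quadrants.
- rewrite -quadrant; apply: eq_integral => x _; apply: eq_integral => y _.
  rewrite -!EFinD /wexp/= !sqrrN !mulrN !mul0r cos0; congr (_%:E).
  have -> : - (a * x) + b * y = - (a * x - b * y) by ring.
  have -> : - (a * x) - b * y = - (a * x + b * y) by ring.
  by rewrite !sinN; ring.
- apply/measurable_EFinP; exact: meas_sin1.
- move=> p; rewrite lee_fin; apply: mulr_ge0; first exact/ltW/wexp_gt0.
  by apply: mulr_ge0 => //; rewrite -lerBlDl sub0r sin_geN1.
Qed.

Lemma intg_wexp : intg (@leb2 R) (wexp al).
Proof.
have h0 p : 0 <= wexp al p * (1 + cos (0 * p.1 + 0 * p.2)).
  by apply: mulr_ge0; [exact/ltW/wexp_gt0|rewrite !mul0r addr0 cos0].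
have [i _] := intg_eqE (meas_cos1 0 0) h0 (int_wexp_cos 0 0).
have := intgZ 2^-1 i; congr (integrable _ _ _); apply/funext => p /=.
by congr (_%:E); rewrite !mul0r addr0 cos0; field.
Qed.

Lemma intg_wexpM (phi : P2 -> R) : meas phi -> (forall p, `|phi p| <= 1) ->
  intg (@leb2 R) (fun p => wexp al p * phi p).
Proof. by move=> mp p1; exact: (intgMb intg_wexp mp p1). Qed.

Lemma I_wexp_cos a b : I[@leb2 R] (fun p => wexp al p * cos (a * p.1 + b * p.2)) =
  2 * pi * al / Num.sqrt (al ^+ 2 + a ^+ 2 + b ^+ 2) ^+ 3.
Proof.
have ic c d : intg (@leb2 R) (fun p => wexp al p * cos (c * p.1 + d * p.2)).
  by apply: intg_wexpM => [|p]; [exact: (meas_cos (meas_lin c d))|exact: cos_max].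
have E c d : I[@leb2 R] (wexp al) + I[@leb2 R] (fun p => wexp al p * cos (c * p.1 + d * p.2)) = total c d.
  rewrite -I_D//; last exact: intg_wexp.
  rewrite (_ : (fun x => _) = fun p => wexp al p * (1 + cos (c * p.1 + d * p.2))); last first.
    by apply/funext => p; rewrite mulrDr mulr1.
  by rewrite /Rintegral int_wexp_cos.
(* At a = b = 0 the sum is twice the integral of W, which yields that integral; subtracting it
   isolates the cosine part. *)
have := E 0 0; rewrite (_ : (fun p => _) = wexp al); last first.
  by apply/funext => p; rewrite !mul0r addr0 cos0 mulr1.
rewrite /total expr0n/= !addr0 sqrtr_sqr gtr0_norm// => E0.
have al_n : al != 0 by rewrite gt_eqF.
have W : I[@leb2 R] (wexp al) = 2 * pi / al ^+ 2.
  have -> : I[@leb2 R] (wexp al) = 2^-1 * (I[@leb2 R] (wexp al) + I[@leb2 R] (wexp al)) by field.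
  by rewrite E0; field.
by have := E a b; rewrite /total W => /addrI.
Qed.

Lemma I_wexp_sin a b : I[@leb2 R] (fun p => wexp al p * sin (a * p.1 + b * p.2)) = 0.
Proof.
have isn c d : intg (@leb2 R) (fun p => wexp al p * sin (c * p.1 + d * p.2)).
  by apply: intg_wexpM => [|p]; [exact: (meas_sin (meas_lin c d))|exact: sin_max].
have E c d : 2 * (I[@leb2 R] (wexp al) + I[@leb2 R] (fun p => wexp al p * sin (c * p.1 + d * p.2))) = total 0 0.
  rewrite -I_D//; last exact: intg_wexp.
  rewrite -I_Z; last exact: (intgD intg_wexp).
  rewrite (_ : (fun x => _) = fun p => wexp al p * (2 * (1 + sin (c * p.1 + d * p.2)))); last first.
    by apply/funext => p; ring.
  by rewrite /Rintegral int_wexp_sin.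
have := E 0 0; rewrite -(E a b) (_ : (fun p => _ * sin (0 * _ + _)) = fun=> 0); last first.
  by apply/funext => p; rewrite !mul0r addr0 sin0 mulr0.
have n2 : (2 : R) != 0 by rewrite pnatr_eq0.
by rewrite I_0 => /(mulfI n2)/addrI <-.
Qed.

Lemma poissonE (y : R * R) :
  (2 * pi) ^+ 2 * poisson al y = 2 * pi * al / Num.sqrt (al ^+ 2 + y.1 ^+ 2 + y.2 ^+ 2) ^+ 3.
Proof.
rewrite /poisson; set q := al ^+ 2 + _ + _.
have q0 : 0 < q by rewrite ltr_pwDl ?sqr_ge0// ltr_pwDl ?sqr_ge0// exprn_gt0.
have -> : q `^ (- (3 / 2)) = (Num.sqrt q ^+ 3)^-1.
  rewrite powRN; congr (_^-1).
  by rewrite -powR12_sqrt ?ltW// -powR_mulrn ?powR_ge0// -powRrM mulrC.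
have p0 : (pi : R) != 0 by rewrite gt_eqF// pi_gt0.
have P0 : (2 * pi : R) != 0 by rewrite mulf_neq0 ?pnatr_eq0.
by rewrite expr2 [(2 * pi)^-1 * _ / _]mulrAC -mulrA mulrCA [_ * (_ / _ * _)]mulrA mulrA divff// mul1r mulrA mulrAC.
Qed.

Lemma wexp_fourier_cos (x : R * R) :
  I[@leb2 R] (fun p => wexp al p * cos (dot2 p x)) = (2 * pi) ^+ 2 * poisson al x.
Proof.
rewrite poissonE -I_wexp_cos; congr (I[_] _); apply/funext => p.
by rewrite /dot2 [p.1 * _]mulrC [p.2 * _]mulrC.
Qed.

Lemma wexp_fourier_sin (x : R * R) : I[@leb2 R] (fun p => wexp al p * sin (dot2 p x)) = 0.
Proof.
rewrite -[RHS](I_wexp_sin x.1 x.2); congr (I[_] _); apply/funext => p.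
by rewrite /dot2 [p.1 * _]mulrC [p.2 * _]mulrC.
Qed.

End poisson_fourier.

(** * Near-minimizers of quadratic forms, Riesz-Fischer *)

Section abstract_minimization.
Context {R : realType} {V : Type}.
Variables (comb : R -> V -> V -> V) (B : V -> V -> R) (l : V -> R) (v0 : V) (C : R).
Hypothesis Bsym : forall u v, B u v = B v u.
Hypothesis Blin : forall t u v w, B (comb t u v) w = B u w + t * B v w.
Hypothesis llin : forall t u v, l (comb t u v) = l u + t * l v.
Hypothesis Bpos : forall v, 0 <= B v v.

Lemma form_comb t u v : B (comb t u v) (comb t u v) = B u u + 2 * t * B u v + t ^+ 2 * B v v.
Proof. by rewrite Blin !(Bsym _ (comb _ _ _)) !Blin (Bsym v u); ring. Qed.

Lemma form_CS u v : B u v ^+ 2 <= B v v * B u u.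
Proof.
apply: psd_discr => // t; have := Bpos (comb t u v); rewrite form_comb; congr (_ <= _); ring.
Qed.

Hypothesis C0 : 0 <= C.
Hypothesis lbd : forall v, l v ^+ 2 <= C * B v v.

(* Lax-Milgram by minimizing B v v - 2 l v: near-minimizers nearly represent l and form a Cauchy sequence *)
Lemma near_minimizer (e : R) : 0 < e ->
  exists u, forall w, (B u w - l w) ^+ 2 <= e * B w w.
Proof.
move=> e0; pose J v := B v v - 2 * l v.
(* 2 l v <= 2 sqrt(C B v v) <= C + B v v, argued by contradiction to avoid the square root. *)
have Jlb v : - C <= J v.
  have := lbd v; have := Bpos v; rewrite /J; set b := B v v; set m := l v => b0 h.
  case: (leP (2 * m) (C + b)) => [|h2]; first by lra.
  have : (C + b) * (C + b) < (2 * m) * (2 * m) by apply: ltr_pM => //; apply: addr_ge0.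
  have : 0 <= (C - b) * (C - b) by rewrite -expr2 sqr_ge0.
  move: h; rewrite expr2; lra.
have hi : has_inf (range J).
  split; first by exists (J v0); exists v0.
  by exists (- C) => _ [v _ <-]; exact: Jlb.
have [_ [u _ <-] Ju] := inf_adherent e0 hi.
(* For every t, J (u + t w) >= inf J > J u - e, that is t^2 B w w + 2 t (B u w - l w) + e >= 0. The
   claim is the sign of its discriminant. *)
exists u => w; rewrite mulrC.
apply: psd_discr => // t.
have : inf (range J) <= J (comb t u w).
  by apply: ge_inf; [case: hi|exists (comb t u w)].
rewrite /J form_comb llin; move: Ju; rewrite /J; lra.
Qed.

(** For w = u - v, B w w is the difference of the two residuals at w, so its square is at most 2 (e1
    + e2) B w w. *)
Lemma near_minimizer_cauchy (e1 e2 : R) u v : 0 <= e1 -> 0 <= e2 ->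
  (forall w, (B u w - l w) ^+ 2 <= e1 * B w w) ->
  (forall w, (B v w - l w) ^+ 2 <= e2 * B w w) ->
  B (comb (-1) u v) (comb (-1) u v) <= 2 * (e1 + e2).
Proof.
move=> e10 e20; set w := comb _ u v => /(_ w) h1 /(_ w) h2.
have : B w w = (B u w - l w) - (B v w - l w) by rewrite {1}/w Blin; ring.
move: h1 h2; set b := B w w; set p := B u w - _; set q := B v w - _ => h1 h2 bE.
have b0 : 0 <= b := Bpos w.
have [->|bn] := eqVneq b 0; first by rewrite mulr_ge0// addr_ge0.
have b1 : 0 < b by rewrite lt_def bn.
rewrite -(ler_pM2r b1); have : 0 <= (p + q) * (p + q) by rewrite -expr2 sqr_ge0.
rewrite !expr2 in h1 h2; rewrite {1 2}bE; lra.
Qed.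

End abstract_minimization.

Section fatou_riesz_fischer.
Context {d} {T : measurableType d} {R : realType} (m : {measure set T -> \bar R}).

Lemma fatou_bound (h_ : nat -> T -> R) (h : T -> R) (C : R) :
  (forall k, intg m (h_ k)) -> (forall k x, 0 <= h_ k x) ->
  (forall x, h_ k x @[k --> \oo] --> h x) -> (forall k, I[m] (h_ k) <= C) ->
  intg m h /\ I[m] h <= C.
Proof.
move=> ih h0 ch hC.
have mh : meas h.
  by apply: (measurable_fun_cvg (h := h_)) => [k|x _]; [exact: intg_meas (ih k)|exact: ch].
have hx0 x : 0 <= h x.
  by rewrite -(cvg_lim (@Rhausdorff R) (ch x)); apply: limr_ge; [apply/cvg_ex; exists (h x)|near=> k].
apply: intg_leE => //.
have := @fatou _ _ _ m setT measurableT (fun k x => (h_ k x)%:E).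
have mk k : measurable_fun setT (fun x => (h_ k x)%:E).
  by apply/measurable_EFinP; exact: intg_meas (ih k).
move=> /(_ mk) /(_ _)/wrap[|]; first by move=> k x _; rewrite lee_fin.
rewrite (eq_integral (fun x => (h x)%:E)); last first.
  move=> x _; have cx : (h_ k x)%:E @[k --> \oo] --> (h x)%:E by apply/fine_cvgP; split; [near=> k|exact: ch].
  by have [-> _] := cvg_limn_einf_sup cx.
move/le_trans; apply; rewrite limn_einf_lim; apply: lime_le; first exact: is_cvg_einfs.
near=> n; apply: (@le_trans _ _ (\int[m]_x (h_ n x)%:E)%E).
  by apply: ereal_inf_lbound; exists n => /=.
by rewrite I_EFin// lee_fin.
Unshelve. all: by end_near. Qed.

Lemma sum_half n : \sum_(0 <= i < n) (2^-1 : R) ^+ i <= 2.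
Proof.
suff -> : \sum_(0 <= i < n) (2^-1 : R) ^+ i = 2 - 2 * 2^-1 ^+ n.
  by rewrite lerBlDr lerDl mulr_ge0// exprn_ge0.
elim: n => [|n IH]; first by rewrite big_geq// expr0 mulr1 subrr.
by rewrite big_nat_recr//= IH exprS; field.
Qed.

(** The geometric rate makes the sequence itself converge almost everywhere, so no subsequence is
    extracted; Fatou's lemma then passes the rate to the limit. *)
Lemma riesz_fischer (f : nat -> T -> R) :
  (forall n, meas (f n)) ->
  (forall n k, (n <= k)%N -> intg m (fun x => (f k x - f n x) ^+ 2) /\
     I[m] (fun x => (f k x - f n x) ^+ 2) <= 4^-1 ^+ n) ->
  exists g, meas g /\ forall n, intg m (fun x => (g x - f n x) ^+ 2) /\
     I[m] (fun x => (g x - f n x) ^+ 2) <= 4^-1 ^+ n.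
Proof.
move=> mf hf.
(* The weight 2^k leaves integrals of at most 2^-k, and |u| <= (2^-k + 2^k u^2) / 2 then makes the
   telescoping series absolutely convergent wherever the sum of the [dd k] is finite. *)
pose dd k x := 2 ^+ k * (f k.+1 x - f k x) ^+ 2.
have dd0 k x : 0 <= dd k x by apply: mulr_ge0; [exact: exprn_ge0|exact: sqr_ge0].
have idd k : intg m (dd k) by apply: intgZ; have [] := hf k k.+1 (leqnSn k).
have Idd k : I[m] (dd k) <= 2^-1 ^+ k.
  have [i1 i2] := hf k k.+1 (leqnSn k).
  rewrite I_Z// -(ler_pM2l (x := 2^-1 ^+ k)) ?exprn_gt0// mulrA -exprMn mulVf// expr1n mul1r.
  by rewrite -exprMn -invfM (_ : 2 * 2 = 4 :> R)// -natrM.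
pose S x := (\sum_(0 <= k <oo) (dd k x)%:E)%E.
have mdd k : measurable_fun setT (fun x => (dd k x)%:E).
  by apply/measurable_EFinP; exact: intg_meas (idd k).
have S0 x : (0 <= S x)%E by apply: nneseries_ge0 => k _ _; rewrite lee_fin.
have mS : measurable_fun setT S.
  apply: (@ge0_emeasurable_sum _ _ _ _ _ xpredT) => // k x _ _; by rewrite lee_fin.
have iS : m.-integrable setT S.
  apply/integrableP; split => //.
  under eq_integral => x _ do rewrite gee0_abs//.
  rewrite integral_nneseries//; last by move=> k x _; rewrite lee_fin.
  apply: (@le_lt_trans _ _ 2%:E); last exact: ltry.
  apply: lime_le.
    by apply: is_cvg_nneseries => k _ _; apply: integral_ge0 => x _; rewrite lee_fin.
  near=> n; under eq_bigr => k _ do rewrite I_EFin//.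
  rewrite sumEFin lee_fin; apply: le_trans (sum_half n).
  by apply: ler_sum => k _; exact: Idd.
pose A := S @^-1` (~` [set +oo%E]).
have mA : measurable A by rewrite -[A]setTI; apply: mS => //; apply: measurableC.
have AC : m (~` A) = 0%E.
  have := integrable_ae measurableT iS => -[N [mN N0 hN]].
  apply/eqP; rewrite eq_le measure_ge0 andbT -N0; apply: le_measure; rewrite ?inE//.
    exact: measurableC.
  by move=> x /= Ax; apply: hN => /(_ I) Sf; apply: Ax => Soo; rewrite Soo in Sf.
have cA x : A x -> cvgn (fun k => f k x).
  move=> Ax.
  have Sfin : S x \is a fin_num by rewrite ge0_fin_numE// lt_neqAle leey andbT; apply/eqP.
  have cd : cvgn (series (fun k => dd k x)).
    apply: nondecreasing_is_cvgn.
      by apply/nondecreasing_seqP => n; rewrite /series/= big_nat_recr//= lerDl.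
    exists (fine (S x)) => _ [n _ <-]; rewrite -lee_fin fineK// -sumEFin.
    by apply: nneseries_lim_ge => k _ _; rewrite lee_fin.
  have cs : cvgn (series (fun k => f k.+1 x - f k x)).
    apply: normed_cvg.
    apply: (@series_le_cvg _ _ (fun k => 2^-1 * (2^-1 ^+ k + dd k x))) => //.
    - by move=> n; rewrite /= normr_ge0.
    - by move=> n; rewrite mulr_ge0// addr_ge0// exprn_ge0.
    - move=> n /=; rewrite /dd; set u := f n.+1 x - f n x.
      have p0 : 0 < 2 ^+ n :> R by rewrite exprn_gt0.
      rewrite exprVn; set p := 2 ^+ n in p0 *.
      rewrite -(ler_pM2l p0) mulrCA mulrDr mulfV ?gt_eqF//.
      have := sqr_ge0 (p * `|u| - 1); have := real_normK (num_real u); nra.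
    - rewrite (_ : series _ = 2^-1 *: (series (geometric 1 2^-1) + series (fun k => dd k x))).
        apply: is_cvgZl_tmp; apply: is_cvgD => //; apply: is_cvg_geometric_series.
        by rewrite ger0_norm// invf_lt1// ltr1n.
      apply/funext => n; transitivity (2^-1 * (\sum_(0 <= k < n) geometric 1 2^-1 k +
          \sum_(0 <= k < n) dd k x)); last by [].
      rewrite -big_split/= mulr_sumr.
      by apply: eq_bigr => k _; rewrite mul1r.
  rewrite (_ : (fun k => f k x) = (fun=> f 0%N x) + series (fun k => f k.+1 x - f k x)).
    by apply: is_cvgD => //; exact: is_cvg_cst.
  apply/funext => n; transitivity (f 0%N x + \sum_(0 <= k < n) (f k.+1 x - f k x)); last by [].
  by rewrite telescope_sumr// addrC subrK.
(* Cutting by A makes the convergence hold everywhere, with value 0 on the null set outside A, so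
   that g is measurable. *)
pose g x := limn (fun k => f k x * \1_A x).
have cg x : f k x * \1_A x @[k --> \oo] --> g x.
  have : cvgn (fun k => f k x * \1_A x); last by [].
  rewrite indicE; case: (boolP (x \in A)) => [/set_mem Ax|_].
    by under eq_fun do rewrite mulr1; exact: cA.
  by under eq_fun do rewrite mulr0; exact: is_cvg_cst.
have mfA k : meas (fun x => f k x * \1_A x) by apply: measM => //; exact: meas_indic.
have mg : meas g.
  by apply: (measurable_fun_cvg (h := fun k x => f k x * \1_A x)).
exists g; split => // n.
have ik k : intg m (fun x => ((f (n + k)%N x - f n x) * \1_A x) ^+ 2).
  have [i _] := hf n (n + k)%N (leq_addr _ _).
  apply: (intg_le _ i).
    by apply/measX/measM; [exact: measB|exact: meas_indic].
  move=> x; rewrite ger0_norm ?sqr_ge0// exprMn indicE.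
  by case: (x \in A); rewrite ?expr1n ?mulr1// expr0n mulr0 sqr_ge0.
have [i1 i2] : intg m (fun x => ((g x - f n x) * \1_A x) ^+ 2) /\
   I[m] (fun x => ((g x - f n x) * \1_A x) ^+ 2) <= 4^-1 ^+ n.
  apply: (@fatou_bound (fun k x => ((f (n + k)%N x - f n x) * \1_A x) ^+ 2)).
  - exact: ik.
  - by move=> k x; exact: sqr_ge0.
  - move=> x; have -> : (g x - f n x) * \1_A x = g x - f n x * \1_A x.
      rewrite indicE; case: (boolP (x \in A)) => xA; rewrite ?mulr1// !mulr0 subr0.
      apply/esym; apply: (cvg_lim (@Rhausdorff R)).
      by rewrite indicE (negbTE xA); under eq_fun do rewrite mulr0; exact: cvg_cst.
    under eq_fun do rewrite mulrBl.
    have c1 : f (n + k)%N x * \1_A x @[k --> \oo] --> g x.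
      have := cg x; rewrite -(@cvg_shiftn n _ (fun k => f k x * \1_A x)).
      by under eq_fun do rewrite addnC.
    by rewrite expr2; under eq_fun do rewrite expr2; apply: cvgM; apply: cvgB => //; exact: cvg_cst.
  - move=> k; have [i le4] := hf n (n + k)%N (leq_addr _ _).
    apply: le_trans le4; apply: I_le => [||x]; [exact: ik|exact: i|].
    rewrite exprMn indicE; case: (x \in A); rewrite ?expr1n ?mulr1// expr0n mulr0; exact: sqr_ge0.
have mgf : meas (fun x => (g x - f n x) ^+ 2) by apply/measX/measB.
have E : (\int[m]_x ((g x - f n x) ^+ 2)%:E = \int[m]_x (((g x - f n x) * \1_A x) ^+ 2)%:E)%E.
  apply: ae_eq_integral => //.
  - exact/measurable_EFinP.
  - exact/measurable_EFinP/(intg_meas i1).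
  - exists (~` A); split => //; first exact: measurableC.
    move=> x /= H Ax; apply: H => _.
    by rewrite indicE mem_set// mulr1.
have i : intg m (fun x => (g x - f n x) ^+ 2).
  by apply: intg_ge0P => // [x|]; [exact: sqr_ge0|rewrite E I_EFin ?ltry].
by split => //; rewrite /Rintegral E.
Unshelve. all: by end_near. Qed.

End fatou_riesz_fischer.

(** * Bessel's inequality and a Plancherel lower bound *)

Section cauchy_kernel.
Context {R : realType}.
Local Notation leb := (@lebesgue_measure R).
Local Notation P1 := (measurableTypeR R).
Local Notation P2 := (plane R).

(* [ck e] is the Fourier transform of [w1 e] *)
Definition ck (e u : R) : R := 2 * e / (e ^+ 2 + u ^+ 2).
Definition w1 (e : R) (x : P1) : R := expR (- (e * `|x|)).
(** A product weight rather than a radial one: its transform [kern] factors into Cauchy kernels,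
    whose primitives are arctangents. *)
Definition wt (e : R) (p : P2) : R := w1 e p.1 * w1 e p.2.
Definition kern (e : R) (p : R * R) : R := ck e p.1 * ck e p.2.

Variable e : R.
Hypothesis e0 : 0 < e.

Lemma ck_gt0 u : 0 < ck e u.
Proof. by rewrite divr_gt0 ?mulr_gt0 ?sq_addr_gt0. Qed.

Lemma ck_le u : ck e u <= 2 / e.
Proof.
rewrite /ck ler_pdivrMr ?sq_addr_gt0// mulrAC ler_pdivlMr// -mulrA ler_pM2l//.
by rewrite -expr2 lerDl sqr_ge0.
Qed.

(** The squared increment of a Lipschitz function absorbs the singularity of the kernel; the O(e)
    error of [kform_ge] comes from here. *)
Lemma sqr_ck_le u : u ^+ 2 * ck e u <= 2 * e.
Proof.
rewrite /ck mulrA ler_pdivrMr ?sq_addr_gt0// mulrC ler_pM2l ?mulr_gt0//.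
by rewrite lerDr sqr_ge0.
Qed.

Lemma ckN u : ck e (- u) = ck e u. Proof. by rewrite /ck sqrrN. Qed.

Lemma measid : meas (fun x : P1 => x : R). Proof. exact: measurable_id. Qed.

Lemma meas_lin1 u : meas (fun x : P1 => u * x).
Proof. by apply: measM; [exact: meas_cst|exact: measid]. Qed.

Lemma meas_w1 : meas (w1 e).
Proof.
apply/meas_exp/measN; apply: measM; first exact: meas_cst.
by apply: (@meas_norm _ P1); exact: measid.
Qed.

Lemma w1_gt0 x : 0 < w1 e x. Proof. exact: expR_gt0. Qed.
Lemma w1_le1 x : w1 e x <= 1.
Proof. by rewrite -expR0 ler_expR oppr_le0 mulr_ge0// ltW. Qed.

Let meas_w1c u : meas (fun x : P1 => w1 e x * (1 + cos (u * x))).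
Proof.
apply: measM; first exact: meas_w1.
by apply: measD; [exact: meas_cst|exact: meas_cos (meas_lin1 u)].
Qed.

Let meas_w1s u : meas (fun x : P1 => w1 e x * (1 + sin (u * x))).
Proof.
apply: measM; first exact: meas_w1.
by apply: measD; [exact: meas_cst|exact: meas_sin (meas_lin1 u)].
Qed.

Let w1c_ge0 u x : 0 <= w1 e x * (1 + cos (u * x)).
Proof. by apply: mulr_ge0; [exact/ltW/w1_gt0|rewrite -lerBlDl sub0r cos_geN1]. Qed.

Let w1s_ge0 u x : 0 <= w1 e x * (1 + sin (u * x)).
Proof. by apply: mulr_ge0; [exact/ltW/w1_gt0|rewrite -lerBlDl sub0r sin_geN1]. Qed.

Let int_w1c u : (\int[leb]_x (w1 e x * (1 + cos (u * x)))%:E =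
  (2 * (e^-1 + e / (e ^+ 2 + u ^+ 2)))%R%:E)%E.
Proof.
rewrite int_split_sym; [|by apply/measurable_EFinP; exact: meas_w1c|by move=> x; rewrite lee_fin w1c_ge0].
rewrite -int_lap1//; apply: eq_integral => x; rewrite inE/= in_itv/= andbT => x0.
by rewrite -EFinD /w1 normrN (ger0_norm x0) mulrN cosN; congr (_%:E); ring.
Qed.

Lemma intg_w1 : intg leb (w1 e).
Proof.
have [i _] := intg_eqE (meas_w1c 0) (w1c_ge0 0) (int_w1c 0).
apply: (intg_le meas_w1 i) => x; rewrite gtr0_norm ?w1_gt0// mul0r cos0.
by rewrite mulrDr mulr1 lerDl ltW// w1_gt0.
Qed.

Lemma intg_w1cos u : intg leb (fun x => w1 e x * cos (u * x)).
Proof. by apply: (intgMb (C := 1) intg_w1) => [|x]; [exact: meas_cos (meas_lin1 u)|exact: cos_max]. Qed.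

Lemma intg_w1sin u : intg leb (fun x => w1 e x * sin (u * x)).
Proof. by apply: (intgMb (C := 1) intg_w1) => [|x]; [exact: meas_sin (meas_lin1 u)|exact: sin_max]. Qed.

Lemma I_w1cos u : I[leb] (fun x => w1 e x * cos (u * x)) = ck e u.
Proof.
have E v : I[leb] (w1 e) + I[leb] (fun x => w1 e x * cos (v * x)) = 2 * (e^-1 + e / (e ^+ 2 + v ^+ 2)).
  rewrite -I_D; [|exact: intg_w1|exact: intg_w1cos].
  have [_ <-] := intg_eqE (meas_w1c v) (w1c_ge0 v) (int_w1c v).
  by congr (I[_] _); apply/funext => x; rewrite mulrDr mulr1.
have E0 := E 0; rewrite (_ : (fun x => _) = w1 e) in E0; last first.
  by apply/funext => x; rewrite mul0r cos0 mulr1.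
have W : I[leb] (w1 e) = 2 / e.
  have -> : I[leb] (w1 e) = 2^-1 * (I[leb] (w1 e) + I[leb] (w1 e)) by field.
  by rewrite E0 expr0n/= addr0; field; rewrite gt_eqF.
have /(congr1 (fun z => z - 2 / e)) := E u.
rewrite W [X in X - _ = _]addrC addrK => ->; rewrite /ck; field.
by rewrite !lt0r_neq0 ?sq_addr_gt0.
Qed.

Lemma I_w1sin u : I[leb] (fun x => w1 e x * sin (u * x)) = 0.
Proof.
have E v : (\int[leb]_x (w1 e x * (1 + sin (v * x)))%:E =
    \int[leb]_(x in `[0%R, +oo[) (2 * expR (- (e * x)))%:E)%E.
  rewrite int_split_sym; [|by apply/measurable_EFinP; exact: meas_w1s|by move=> x; rewrite lee_fin w1s_ge0].
  apply: eq_integral => x; rewrite inE/= in_itv/= andbT => x0.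
  by rewrite -EFinD /w1 normrN (ger0_norm x0) mulrN sinN; congr (_%:E); ring.
have F v : I[leb] (w1 e) + I[leb] (fun x => w1 e x * sin (v * x)) = I[leb] (fun x => w1 e x * (1 + sin (v * x))).
  rewrite -I_D; [|exact: intg_w1|exact: intg_w1sin].
  by congr (I[_] _); apply/funext => x; rewrite mulrDr mulr1.
have : I[leb] (fun x => w1 e x * (1 + sin (u * x))) = I[leb] (fun x => w1 e x * (1 + sin (0 * x))).
  by rewrite /Rintegral !E.
rewrite -!F [in X in _ = X](_ : (fun x => _ * sin (0 * x)) = fun=> 0); last first.
  by apply/funext => x; rewrite mul0r sin0 mulr0.
by rewrite I_0 => /addrI.
Qed.

Lemma intg_ck s : intg leb (fun x => ck e (x - s)) /\ I[leb] (fun x => ck e (x - s)) = 2 * pi.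
Proof.
have mck : meas (fun x : P1 => ck e (x - s)).
  apply: (@meas_cont _ P1 _ (fun x => ck e (x - s)) idfun); last exact: measid.
  by move=> t; rewrite /ck; apply: hd_cont; hd_auto; rewrite gt_eqF// sq_addr_gt0.
apply: intg_eqE => //; first by move=> x; exact/ltW/ck_gt0.
rewrite int_split_sym; [|by apply/measurable_EFinP; exact: mck|by move=> x; rewrite lee_fin; exact/ltW/ck_gt0].
under eq_integral do rewrite -EFinD.
rewrite (@ftc_y _ _ (fun x => 2 * atan ((x - s) / e) + 2 * atan ((x + s) / e)) (2 * (pi / 2) + 2 * (pi / 2))).
- by congr (_%:E); rewrite sub0r add0r mulNr atanN mulrN addNr subr0; field.
- move=> x; apply: hd_eq; first by hd_auto.
  rewrite /ck (_ : - x - s = - (x + s)) ?sqrrN; last by ring.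
  have n1 := lt0r_neq0 (sq_addr_gt0 (x - s) e0); have n2 := lt0r_neq0 (sq_addr_gt0 (x + s) e0).
  have en : e != 0 by rewrite gt_eqF.
  have -> z : 1 + (z / e) ^+ 2 = (e ^+ 2 + z ^+ 2) / e ^+ 2 by field.
  have -> z : 1 + (z / e) ^+ 2 = (e ^+ 2 + z ^+ 2) / e ^+ 2 by field.
  by cbn beta; field; rewrite n1 n2 en.
- by move=> x _; rewrite addr_ge0// ltW// ck_gt0.
- by move=> x; rewrite /ck; apply: hd_cont; hd_auto; rewrite gt_eqF// sq_addr_gt0.
- have L c : atan ((x + c) / e) @[x --> +oo] --> pi / 2.
    apply: (cvg_comp _ _ _ (@cvgy_atan R)); apply/cvgryPge => M; near=> t.
    by rewrite ler_pdivlMr// -lerBlDr.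
  by apply: cvgD; apply: cvgMl_tmp; exact: L.
Unshelve. all: end_near. Qed.

End cauchy_kernel.

(** * Fubini for two integrable factors and a bounded kernel *)

Section swap_kernel.
Context {R : realType}.
Local Notation P2 := (plane R).
Local Notation m2 := (@leb2 R).
Variables (a b : P2 -> R) (k : P2 * P2 -> R) (C : R).
Hypotheses (ia : intg m2 a) (ib : intg m2 b) (mk : meas k) (kC : forall x y, `|k (x, y)| <= C).

Let phi (p : P2 * P2) : R := a p.1 * (b p.2 * k p).

Let mphi : meas phi.
Proof.
apply: measM; first exact: (meas_comp (phi := fst) measurable_fst (intg_meas ia)).
by apply: measM => //; exact: (meas_comp (phi := snd) measurable_snd (intg_meas ib)).
Qed.

Let mk1 x : meas (fun y => k (x, y)).
Proof. exact: (meas_comp (phi := pair x) (measurable_pair1 x) mk). Qed.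
Let mk2 y : meas (fun x => k (x, y)).
Proof. exact: (meas_comp (phi := fun x => (x, y)) (measurable_pair2 y) mk). Qed.
Let phi_dom x y : `|phi (x, y)| <= C * `|a x| * `|b y|.
Proof.
rewrite /phi/= !normrM mulrCA mulrA [C * _]mulrC -!mulrA.
rewrite [leLHS]mulrCA; rewrite ler_wpM2l// [leRHS]mulrC ler_wpM2l//.
Qed.

Let ca : intg m2 (fun x => C * `|a x|). Proof. exact/intgZ/intg_abs. Qed.
Let cb : intg m2 (fun x => `|b x|). Proof. exact: intg_abs. Qed.

Lemma swap_intgb x : intg m2 (fun y => b y * k (x, y)).
Proof. by apply: (intgMb ib) => //; exact: kC. Qed.
Lemma swap_intga y : intg m2 (fun x => a x * k (x, y)).
Proof. by apply: (intgMb ia) => // x; exact: kC. Qed.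

Let E1 x : I[m2] (fun y => phi (x, y)) = a x * I[m2] (fun y => b y * k (x, y)).
Proof. by rewrite -I_Z//; exact: swap_intgb. Qed.
Let E2 y : I[m2] (fun x => phi (x, y)) = b y * I[m2] (fun x => a x * k (x, y)).
Proof.
rewrite -I_Z; last exact: swap_intga.
by congr (I[_] _); apply/funext => x; rewrite /phi/= mulrCA.
Qed.

Lemma swap_intg1 : intg m2 (fun x => a x * I[m2] (fun y => b y * k (x, y))).
Proof. by have := dom_intgI1 mphi ca cb phi_dom; under [X in EFin \o X]funext do rewrite E1. Qed.
Lemma swap_intg2 : intg m2 (fun y => b y * I[m2] (fun x => a x * k (x, y))).
Proof. by have := dom_intgI2 mphi ca cb phi_dom; under [X in EFin \o X]funext do rewrite E2. Qed.
Lemma swapK : I[m2] (fun x => a x * I[m2] (fun y => b y * k (x, y))) =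
  I[m2] (fun y => b y * I[m2] (fun x => a x * k (x, y))).
Proof.
transitivity (I[m2] (fun x => I[m2] (fun y => phi (x, y)))).
  by congr (I[_] _); apply/funext => x; rewrite E1.
apply: etrans; first exact: (dom_swap mphi ca cb phi_dom).
by congr (I[_] _); apply/funext => y; rewrite -E2.
Qed.
Lemma swap_prod : intg (m2 \x m2)%E phi /\
  I[(m2 \x m2)%E] phi = I[m2] (fun x => a x * I[m2] (fun y => b y * k (x, y))).
Proof.
split; first exact: dom_intg mphi ca cb phi_dom.
apply: etrans; first exact: (dom_prod mphi ca cb phi_dom).
by congr (I[_] _); apply/funext => x; exact: E1.
Qed.

End swap_kernel.

Section weight2.
Context {R : realType}.
Local Notation leb := (@lebesgue_measure R).
Local Notation P2 := (plane R).
Local Notation m2 := (@leb2 R).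
Variable e : R.
Hypothesis e0 : 0 < e.

Lemma prod_intg (a b : measurableTypeR R -> R) : intg leb a -> intg leb b ->
  intg m2 (fun p => a p.1 * b p.2) /\ I[m2] (fun p => a p.1 * b p.2) = I[leb] a * I[leb] b.
Proof.
move=> ia ib.
have mab : meas (fun p : P2 => a p.1 * b p.2).
  apply: measM.
    exact: (meas_comp (phi := fst) measurable_fst (intg_meas ia)).
  exact: (meas_comp (phi := snd) measurable_snd (intg_meas ib)).
have dm x y : `|a x * b y| <= `|a x| * `|b y| by rewrite normrM.
split; first exact: (dom_intg mab (intg_abs ia) (intg_abs ib) dm).
apply: etrans; first exact: (dom_prod mab (intg_abs ia) (intg_abs ib) dm).
transitivity (I[leb] (fun x => (I[leb] b) * a x)); last by rewrite I_Z// mulrC.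
by congr (Rintegral _ _ _); apply/funext => x; exact: etrans (I_Z (a x) ib) (mulrC _ _).
Qed.

Lemma wt_gt0 p : 0 < wt e p. Proof. by rewrite mulr_gt0 ?w1_gt0. Qed.
Lemma wt_le1 p : wt e p <= 1.
Proof. by rewrite mulr_ile1 ?w1_le1// ltW// w1_gt0. Qed.

Lemma intg_wt : intg m2 (wt e).
Proof. by have [] := prod_intg (intg_w1 e0) (intg_w1 e0). Qed.

Lemma wt_fourier (z : R * R) :
  I[m2] (fun p => wt e p * cos (dot2 z p)) = kern e z /\
  I[m2] (fun p => wt e p * sin (dot2 z p)) = 0.
Proof.
have ic := intg_w1cos e0; have isn := intg_w1sin e0.
have [i1 E1] := prod_intg (ic z.1) (ic z.2).
have [i2 E2] := prod_intg (isn z.1) (isn z.2).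
have [i3 E3] := prod_intg (isn z.1) (ic z.2).
have [i4 E4] := prod_intg (ic z.1) (isn z.2).
split.
  rewrite (_ : (fun p => _) = fun p => w1 e p.1 * cos (z.1 * p.1) * (w1 e p.2 * cos (z.2 * p.2))
      - w1 e p.1 * sin (z.1 * p.1) * (w1 e p.2 * sin (z.2 * p.2))); last first.
    by apply/funext => p; rewrite /wt /dot2 cosD; ring.
  by rewrite I_B// E1 E2 !I_w1cos// !I_w1sin// mul0r subr0.
rewrite (_ : (fun p => _) = fun p => w1 e p.1 * sin (z.1 * p.1) * (w1 e p.2 * cos (z.2 * p.2))
      + w1 e p.1 * cos (z.1 * p.1) * (w1 e p.2 * sin (z.2 * p.2))); last first.
  by apply/funext => p; rewrite /wt /dot2 sinD; ring.
by rewrite I_D// E3 E4 !I_w1sin// mul0r mulr0 addr0.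
Qed.

Lemma kern_gt0 z : 0 < kern e z. Proof. by rewrite mulr_gt0 ?ck_gt0. Qed.
Lemma kern_le z : kern e z <= (2 / e) ^+ 2.
Proof. by rewrite expr2 ler_pM ?ck_le// ltW// ck_gt0. Qed.

Lemma intg_kern (z : R * R) : intg m2 (fun p => kern e (p - z)) /\
  I[m2] (fun p => kern e (p - z)) = (2 * pi) ^+ 2.
Proof.
have [i1 E1] := intg_ck e0 z.1; have [i2 E2] := intg_ck e0 z.2.
by have [i E] := prod_intg i1 i2; split => //; rewrite [LHS]E E1 E2 expr2.
Qed.

Lemma kernB z w : kern e (z - w) = kern e (w - z).
Proof.
by rewrite /kern /= -(ckN _ (z.1 - w.1)) -(ckN _ (z.2 - w.2)) !opprB.
Qed.

End weight2.

Section fourier_bessel.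
Context {R : realType}.
Local Notation P2 := (plane R).
Local Notation m2 := (@leb2 R).

(* real and imaginary parts of int (u + i v) e^(i <xi, x>), without normalizing factor *)
Definition fre (u v : P2 -> R) (x : R * R) : R :=
  I[m2] (fun xi => u xi * cos (dot2 xi x) - v xi * sin (dot2 xi x)).
Definition fim (u v : P2 -> R) (x : R * R) : R :=
  I[m2] (fun xi => u xi * sin (dot2 xi x) + v xi * cos (dot2 xi x)).

Let ker (phi : R -> R) (z : R * R) (p : P2 * P2) : R := phi (dot2 (p.2 - z) p.1).

Let meas_ker phi z : continuous phi -> meas (ker phi z).
Proof.
move=> cphi; apply: (meas_cont cphi).
have m1 := @meas1 R; have m2 := @meas2 R.
apply: measD; apply: measM.
- apply: measB; last exact: meas_cst.
  exact: (meas_comp (phi := snd) measurable_snd m1).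
- exact: (meas_comp (phi := fst) measurable_fst m1).
- apply: measB; last exact: meas_cst.
  exact: (meas_comp (phi := snd) measurable_snd m2).
- exact: (meas_comp (phi := fst) measurable_fst m2).
Qed.

Let mcos z : meas (ker cos z). Proof. by apply: meas_ker; exact: continuous_cos. Qed.
Let msin z : meas (ker sin z). Proof. by apply: meas_ker; exact: continuous_sin. Qed.
Let bcos z x y : `|ker cos z (x, y)| <= 1. Proof. exact: cos_max. Qed.
Let bsin z x y : `|ker sin z (x, y)| <= 1. Proof. exact: sin_max. Qed.

Let kc (p : P2 * P2) : R := cos (dot2 p.2 p.1).
Let ks (p : P2 * P2) : R := sin (dot2 p.2 p.1).
Let mkc : meas kc.
Proof. by have := mcos 0; congr meas; apply/funext => p; rewrite /ker subr0. Qed.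
Let mks : meas ks.
Proof. by have := msin 0; congr meas; apply/funext => p; rewrite /ker subr0. Qed.
Let bkc x y : `|kc (x, y)| <= 1. Proof. exact: cos_max. Qed.
Let bks x y : `|ks (x, y)| <= 1. Proof. exact: sin_max. Qed.

Lemma intg_Mcos u x : intg m2 u -> intg m2 (fun xi => u xi * cos (dot2 xi x)).
Proof. by move=> iu; apply: (intgMb (C := 1) iu) => [|p]; [exact: (meas_cos (meas_dot x))|exact: cos_max]. Qed.
Lemma intg_Msin u x : intg m2 u -> intg m2 (fun xi => u xi * sin (dot2 xi x)).
Proof. by move=> iu; apply: (intgMb (C := 1) iu) => [|p]; [exact: (meas_sin (meas_dot x))|exact: sin_max]. Qed.

Lemma freE u v x : intg m2 u -> intg m2 v ->
  fre u v x = I[m2] (fun xi => u xi * cos (dot2 xi x)) - I[m2] (fun xi => v xi * sin (dot2 xi x)).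
Proof. by move=> iu iv; rewrite -I_B//; [exact: intg_Mcos|exact: intg_Msin]. Qed.

Lemma fimE u v x : fim u v x = fre v (fun xi => - u xi) x.
Proof. by congr (I[_] _); apply/funext => xi; rewrite mulNr opprK addrC. Qed.

Lemma fim_swap u v x : intg m2 u -> intg m2 v -> fim v (fun xi => - u xi) x = - fre u v x.
Proof.
move=> iu iv; rewrite -I_N; last by apply: intgB; [exact: intg_Mcos|exact: intg_Msin].
by congr (I[_] _); apply/funext => xi; ring.
Qed.

Variable e : R.
Hypothesis e0 : 0 < e.

(** By [weighted_norm] (with v = 0) this is the [wt]-weighted energy of the Fourier transform of u.
    As e tends to 0, the kernel behaves like (2 pi)^2 times a Dirac mass. *)
Definition kform (u : P2 -> R) : R :=
  I[m2] (fun xi => u xi * I[m2] (fun eta => u eta * kern e (eta - xi))).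

Section pair.
Variables (u v : P2 -> R).
Hypotheses (iu : intg m2 u) (iv : intg m2 v).

Lemma intg_wfre : intg m2 (fun x => wt e x * fre u v x).
Proof.
have i1 := swap_intg1 (intg_wt e0) iu mkc bkc.
have i2 := swap_intg1 (intg_wt e0) iv mks bks.
have := intgB i1 i2; congr (integrable _ _ _); apply/funext => x /=; congr (_%:E).
by rewrite freE// mulrBr.
Qed.

End pair.

Lemma intg_wfim u v : intg m2 u -> intg m2 v -> intg m2 (fun x => wt e x * fim u v x).
Proof.
move=> iu iv; have := intg_wfre iv (intgN iu); congr (integrable _ _ _).
by apply/funext => x /=; rewrite -fimE.
Qed.

(** The left side is the real part of the inverse transform of [wt] times the transform of u + i v,
    hence of a convolution with the transform of [wt]. That transform is real because [wt] is even,
    so v drops out. *)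
Let inner u v xi : intg m2 u -> intg m2 v ->
  I[m2] (fun x => wt e x * fre u v x * cos (dot2 x xi)) +
  I[m2] (fun x => wt e x * fim u v x * sin (dot2 x xi)) =
  I[m2] (fun eta => u eta * kern e (eta - xi)).
Proof.
move=> iu iv; have iw := intg_wt e0.
have k1 := swapK iw iu (mcos xi) (bcos xi).
have k2 := swapK iw iv (msin xi) (bsin xi).
have i1 := swap_intg1 iw iu (mcos xi) (bcos xi).
have i2 := swap_intg1 iw iv (msin xi) (bsin xi).
rewrite -I_D; [|exact: intg_Mcos (intg_wfre iu iv)|exact: intg_Msin (intg_wfim iu iv)].
transitivity (I[m2] (fun x => wt e x * I[m2] (fun eta => u eta * ker cos xi (x, eta)) -
    wt e x * I[m2] (fun eta => v eta * ker sin xi (x, eta)))).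
  congr (I[_] _); apply/funext => x.
  rewrite -mulrBr -I_B; [|exact: swap_intgb (mcos xi) (bcos xi) _|exact: swap_intgb (msin xi) (bsin xi) _].
  rewrite -(mulrA (wt e x) (fre u v x)) -(mulrA (wt e x) (fim u v x)) -mulrDr; congr (_ * _).
  have iC := intg_Mcos x iu; have iS := intg_Msin x iv.
  have iC' := intg_Mcos x iv; have iS' := intg_Msin x iu.
  rewrite [fre _ _ _ * _]mulrC [fim _ _ _ * _]mulrC /fre /fim.
  rewrite -I_Z; last exact: intgB.
  rewrite -I_Z; last exact: intgD.
  rewrite -I_D; [|exact: intgZ (intgB iC iS)|exact: intgZ (intgD iS' iC')].
  congr (I[_] _); apply/funext => eta; rewrite /ker/=.
  have -> : dot2 (eta - xi) x = dot2 eta x - dot2 x xi by rewrite /dot2/=; ring.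
  by rewrite cosB sinB; ring.
apply: etrans; first exact: I_B i1 i2.
apply: etrans; first exact: (congr2 (fun s t => s - t) k1 k2).
have -> : I[m2] (fun y => v y * I[m2] (fun x => wt e x * ker sin xi (x, y))) = 0.
  rewrite -[RHS](@I_0 _ P2 R m2); congr (Rintegral _ _ _); apply/funext => eta.
  have [_ h] := wt_fourier e0 (eta - xi).
  by apply: etrans (mulr0 (v eta)); exact: (congr1 (fun z => v eta * z) h).
rewrite subr0; congr (Rintegral _ _ _); apply/funext => eta.
by have [h _] := wt_fourier e0 (eta - xi); exact: (congr1 (fun z => u eta * z) h).
Qed.

Lemma weighted_norm u v : intg m2 u -> intg m2 v ->
  intg m2 (fun x => wt e x * (fre u v x ^+ 2 + fim u v x ^+ 2)) /\
  I[m2] (fun x => wt e x * (fre u v x ^+ 2 + fim u v x ^+ 2)) = kform u + kform v.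
Proof.
move=> iu iv.
have iw1 := intg_wfre iu iv; have iw2 := intg_wfim iu iv.
pose C (w : P2 -> R) x := I[m2] (fun xi => w xi * cos (dot2 xi x)).
pose S (w : P2 -> R) x := I[m2] (fun xi => w xi * sin (dot2 xi x)).
have Csym w x : I[m2] (fun y => w y * kc (y, x)) = C w x.
  by congr (I[_] _); apply/funext => y; rewrite /kc /dot2/= [x.1 * _]mulrC [x.2 * _]mulrC.
have Ssym w x : I[m2] (fun y => w y * ks (y, x)) = S w x.
  by congr (I[_] _); apply/funext => y; rewrite /ks /dot2/= [x.1 * _]mulrC [x.2 * _]mulrC.
have EC (w a : P2 -> R) : intg m2 w -> intg m2 a -> [/\ intg m2 (fun x => w x * C a x),
    intg m2 (fun xi => a xi * C w xi) & I[m2] (fun x => w x * C a x) = I[m2] (fun xi => a xi * C w xi)].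
  move=> iw ia; split; first exact: swap_intg1 iw ia mkc bkc.
    have := swap_intg2 iw ia mkc bkc.
    by congr (integrable _ _ _); apply/funext => x /=; rewrite Csym.
  apply: etrans; first exact: swapK iw ia mkc bkc.
  by congr (I[_] _); apply/funext => x; rewrite Csym.
have ES (w a : P2 -> R) : intg m2 w -> intg m2 a -> [/\ intg m2 (fun x => w x * S a x),
    intg m2 (fun xi => a xi * S w xi) & I[m2] (fun x => w x * S a x) = I[m2] (fun xi => a xi * S w xi)].
  move=> iw ia; split; first exact: swap_intg1 iw ia mks bks.
    have := swap_intg2 iw ia mks bks.
    by congr (integrable _ _ _); apply/funext => x /=; rewrite Ssym.
  apply: etrans; first exact: swapK iw ia mks bks.
  by congr (I[_] _); apply/funext => x; rewrite Ssym.
set w1 := (fun x => wt e x * fre u v x) in iw1; set w2 := (fun x => wt e x * fim u v x) in iw2.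
have [a1 a2 a3] := EC _ _ iw1 iu; have [b1 b2 b3] := ES _ _ iw1 iv.
have [c1 c2 c3] := ES _ _ iw2 iu; have [d1 d2 d3] := EC _ _ iw2 iv.
have H : (fun x => wt e x * (fre u v x ^+ 2 + fim u v x ^+ 2)) =
  (fun x => (w1 x * C u x - w1 x * S v x) + (w2 x * S u x + w2 x * C v x)).
  apply/funext => x; rewrite -mulrBr -mulrDr -freE// -[S u x + C v x]I_D; last exact: intg_Mcos.
    by rewrite -/(fim u v x) /w1 /w2; ring.
  exact: intg_Msin.
rewrite H; split; first exact: intgD (intgB a1 b1) (intgD c1 d1).
have key (X A B p q r s p' q' r' s' t1 t2 : R) : X = A + B -> A = p - q -> B = r + s ->
    p = p' -> q = q' -> r = r' -> s = s' -> t1 = p' + r' -> t2 = s' - q' -> X = t1 + t2.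
  by move=> -> -> -> -> -> -> -> -> ->; ring.
have := key _ _ _ _ _ _ _ _ _ _ _ _ _ (I_D (intgB a1 b1) (intgD c1 d1)) (I_B a1 b1) (I_D c1 d1)
   a3 b3 c3 d3 (I_D a2 c2) (I_B d2 b2).
move=> h; apply: (etrans h); rewrite /kform; congr (_ + _); congr (Rintegral _ _ _); apply/funext => xi.
- rewrite -mulrDr; exact: (congr1 (fun z => u xi * z) (inner xi iu iv)).
(* The imaginary part is [inner] applied to - i (u + i v) = v - i u. *)
- have h1 : C w2 xi = I[m2] (fun x => wt e x * fre v (fun y => - u y) x * cos (dot2 x xi)).
    by congr (Rintegral _ _ _); apply/funext => x; rewrite -fimE.
  have h2 : - S w1 xi = I[m2] (fun x => wt e x * fim v (fun y => - u y) x * sin (dot2 x xi)).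
    rewrite -I_N; last exact: intg_Msin.
    by congr (Rintegral _ _ _); apply/funext => x; rewrite fim_swap// /w1 mulrN mulNr.
  rewrite -mulrBr h1 h2.
  exact: (congr1 (fun z => v xi * z) (inner xi iv (intgN iu))).
Qed.

End fourier_bessel.

Section bessel.
Context {R : realType}.
Local Notation P2 := (plane R).
Local Notation m2 := (@leb2 R).

Lemma meas_ck e : 0 < e -> meas (ck e : measurableTypeR R -> R).
Proof.
move=> e0; apply: (@meas_cont _ (measurableTypeR R) _ (ck e) idfun); last exact: measid.
by move=> t; rewrite /ck; apply: hd_cont; hd_auto; rewrite gt_eqF// sq_addr_gt0.
Qed.

Lemma meas_kernB e : 0 < e -> meas (fun p : P2 * P2 => kern e (p.2 - p.1)).
Proof.
move=> e0; have m1 := @meas1 R; have m2 := @meas2 R; have mc := meas_ck e0.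
have f1 := meas_comp (phi := snd) measurable_snd m1 : meas (fun p : P2 * P2 => p.2.1).
have f2 := meas_comp (phi := snd) measurable_snd m2 : meas (fun p : P2 * P2 => p.2.2).
have g1 := meas_comp (phi := fst) measurable_fst m1 : meas (fun p : P2 * P2 => p.1.1).
have g2 := meas_comp (phi := fst) measurable_fst m2 : meas (fun p : P2 * P2 => p.1.2).
apply: measM.
- exact: (measurableT_comp mc (measB f1 g1)).
- exact: (measurableT_comp mc (measB f2 g2)).
Qed.

Section fixed_width.
Variable e : R.
Hypothesis e0 : 0 < e.
Let kp (p : P2 * P2) : R := kern e (p.2 - p.1).
Let mkp : meas kp. Proof. exact: meas_kernB. Qed.
Let kp0 p : 0 <= kp p. Proof. exact/ltW/kern_gt0. Qed.
Let kpC x y : `|kp (x, y)| <= (2 / e) ^+ 2.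
Proof. by rewrite ger0_norm ?kp0//; exact: kern_le. Qed.

Lemma kern_mass1 (s : P2 -> R) : intg m2 s -> (forall x, 0 <= s x) ->
  intg (m2 \x m2)%E (fun p => s p.1 * kp p) /\
  I[(m2 \x m2)%E] (fun p => s p.1 * kp p) = (2 * pi) ^+ 2 * I[m2] s.
Proof.
move=> is0 s0; have ms := intg_meas is0.
have mf : meas (fun p : P2 * P2 => s p.1 * kp p).
  by apply: measM => //; exact: (meas_comp (phi := fst) measurable_fst ms).
apply: intg_eqE => //; first by move=> p; exact: mulr_ge0.
rewrite (@fubini_tonelli1 _ _ P2 P2 R m2 m2 (fun p => (s p.1 * kp p)%:E)); last 2 first.
- exact/measurable_EFinP.
- by move=> p; rewrite lee_fin mulr_ge0.
rewrite -I_Z// -I_EFin; last exact: intgZ.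
apply: eq_integral => x _; rewrite /fubini_F /=.
have [ik Ek] := intg_kern e0 x.
have := I_EFin (intgZ (s x) ik) => /= ->; congr (_%:E).
by rewrite I_Z// Ek mulrC.
Qed.

Lemma kern_mass2 (s : P2 -> R) : intg m2 s -> (forall x, 0 <= s x) ->
  intg (m2 \x m2)%E (fun p => s p.2 * kp p) /\
  I[(m2 \x m2)%E] (fun p => s p.2 * kp p) = (2 * pi) ^+ 2 * I[m2] s.
Proof.
move=> is0 s0; have ms := intg_meas is0.
have mf : meas (fun p : P2 * P2 => s p.2 * kp p).
  by apply: measM => //; exact: (meas_comp (phi := snd) measurable_snd ms).
apply: intg_eqE => //; first by move=> p; exact: mulr_ge0.
have mE : measurable_fun setT (fun p : P2 * P2 => (s p.2 * kp p)%:E) by exact/measurable_EFinP.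
have E0 (p : P2 * P2) : (0 <= (s p.2 * kp p)%:E)%E by rewrite lee_fin mulr_ge0.
rewrite (@fubini_tonelli1 _ _ P2 P2 R m2 m2 _ mE E0).
apply: etrans; first exact: (@fubini_tonelli _ _ P2 P2 R m2 m2 _ mE E0).
rewrite -I_Z// -I_EFin; last exact: intgZ.
apply: eq_integral => y _ /=.
have [ik Ek] := intg_kern e0 y.
have := I_EFin (intgZ (s y) ik) => /=; rewrite I_Z// Ek mulrC => <-.
by apply: eq_integral => x _; rewrite /kp/= kernB.
Qed.

(** Schur's test: u(x) u(y) <= (u(x)^2 + u(y)^2) / 2, and the kernel has mass (2 pi)^2 in each
    variable. *)
Lemma kform_le (u : P2 -> R) : intg m2 u -> intg m2 (fun x => u x ^+ 2) ->
  kform e u <= (2 * pi) ^+ 2 * I[m2] (fun x => u x ^+ 2).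
Proof.
move=> iu iu2; have u2 x : 0 <= u x ^+ 2 := sqr_ge0 _.
have [iN EN] := kern_mass1 iu2 u2; have [iM EM] := kern_mass2 iu2 u2.
have [ip Ep] := swap_prod iu iu mkp kpC.
rewrite /kform -Ep.
have -> : (2 * pi) ^+ 2 * I[m2] (fun x => u x ^+ 2) =
   2^-1 * ((2 * pi) ^+ 2 * I[m2] (fun x => u x ^+ 2)) + 2^-1 * ((2 * pi) ^+ 2 * I[m2] (fun x => u x ^+ 2)) by field.
rewrite -{1}EN -EM.
have key (A B C D : R) : A <= C -> C = 2^-1 * B + 2^-1 * D -> A <= 2^-1 * B + 2^-1 * D by move=> h <-.
apply: (key _ _ (I[(m2 \x m2)%E] (fun p => 2^-1 * (u p.1 ^+ 2 * kp p) + 2^-1 * (u p.2 ^+ 2 * kp p)))).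
  apply: I_le => //; first exact: intgD (intgZ _ iN) (intgZ _ iM).
  move=> p; have := kp0 p; set k := kp p; set a := u p.1; set b := u p.2 => k0.
  have := mulr_ge0 k0 (sqr_ge0 (a - b)); rewrite sqrrB; lra.
apply: etrans; first exact: I_D (intgZ _ iN) (intgZ _ iM).
by rewrite !I_Z.
Qed.

End fixed_width.

Lemma inv_succ_gt0 k : 0 < k.+1%:R^-1 :> R. Proof. by rewrite invr_gt0 ltr0n. Qed.

Lemma wt_cvg1 (x : P2) : wt (k.+1%:R^-1 : R) x @[k --> \oo] --> (1 : R).
Proof.
have c (a : R) : expR (- (k.+1%:R^-1 * a)) @[k --> \oo] --> (1 : R).
  have h : - (k.+1%:R^-1 * a) @[k --> \oo] --> - (0 * a).
    by apply: cvgN; apply: cvgMr_tmp; exact: cvg_harmonic.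
  have e1 : expR (- (0 * a)) = 1 by rewrite mul0r oppr0 expR0.
  by have := cvg_comp _ _ h (@continuous_expR R _); rewrite e1.
have := cvgM (c `|x.1|) (c `|x.2|); rewrite mulr1; exact.
Qed.

(** The bound of [kform_le] does not depend on the width e, and the weights tend to 1 as e = 1 / (k
    + 1) tends to 0; Fatou's lemma gives integrability and the bound together. *)
Lemma bessel (u v : P2 -> R) : intg m2 u -> intg m2 v ->
  intg m2 (fun x => u x ^+ 2) -> intg m2 (fun x => v x ^+ 2) ->
  intg m2 (fun x => fre u v x ^+ 2 + fim u v x ^+ 2) /\
  I[m2] (fun x => fre u v x ^+ 2 + fim u v x ^+ 2) <=
    (2 * pi) ^+ 2 * (I[m2] (fun x => u x ^+ 2) + I[m2] (fun x => v x ^+ 2)).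
Proof.
move=> iu iv iu2 iv2.
apply: (@fatou_bound _ _ _ _ (fun k x => wt k.+1%:R^-1 x * (fre u v x ^+ 2 + fim u v x ^+ 2))).
- by move=> k; have [] := weighted_norm (inv_succ_gt0 k) iu iv.
- by move=> k x; rewrite mulr_ge0 ?addr_ge0 ?sqr_ge0// ltW// wt_gt0.
- by move=> x; rewrite -[X in _ --> X]mul1r; apply: cvgMr_tmp; exact: wt_cvg1.
- move=> k; have [_ ->] := weighted_norm (inv_succ_gt0 k) iu iv.
  by rewrite mulrDr lerD// kform_le// inv_succ_gt0.
Qed.

End bessel.

Lemma half_bound (R : realType) (P A C c : R) : P = A + A - 2^-1 * C -> C <= 2 * c -> 2 * A <= P + c.
Proof. by move=> ->; lra. Qed.

Section square_mass.
Context {R : realType}.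
Local Notation leb := (@lebesgue_measure R).
Local Notation P1 := (measurableTypeR R).
Local Notation P2 := (plane R).
Local Notation m2 := (@leb2 R).
Variable de : R.
Hypothesis de0 : 0 < de.

Definition segi (x : P1) : R := \1_([set` `[- de, de]] : set R) x.
Definition sqi (p : P2) : R := segi p.1 * segi p.2.

Lemma segiE x : segi x = ((- de <= x <= de)%R : bool)%:R.
Proof. by rewrite /segi indicE mem_setE in_itv. Qed.

Lemma sqiE p : sqi p = \1_(Sq de : set P2) p.
Proof.
rewrite /sqi !segiE indicE -natrM mulnb; congr (nat_of_bool _)%:R.
by apply/andP/idP => [[a b]|/set_mem [a b]]; [exact/mem_set|].
Qed.

Lemma intg_segi : intg leb segi. Proof. exact: integrable_indic_itv. Qed.
Lemma segi01 x : 0 <= segi x <= 1. Proof. by rewrite segiE ler0n lern1 leq_b1. Qed.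
Lemma segi_ge0 x : 0 <= segi x. Proof. by case/andP: (segi01 x). Qed.
Lemma sqi_ge0 p : 0 <= sqi p. Proof. by rewrite mulr_ge0// segi_ge0. Qed.
Lemma sqi_le1 p : sqi p <= 1.
Proof. by case/andP: (segi01 p.1) => a b; case/andP: (segi01 p.2) => c d; rewrite mulr_ile1. Qed.
Lemma sqi_sqr p : sqi p * sqi p = sqi p.
Proof. by rewrite sqiE indicE -natrM mulnb andbb. Qed.
Lemma intg_sqi : intg m2 sqi. Proof. by have [] := prod_intg intg_segi intg_segi. Qed.

(** The part of the kernel centred at s that falls into the segment. It tends to the full mass 2 pi
    at interior points, which makes [kform_ge] a lower Plancherel bound in the limit. *)
Definition mass (e s : R) : R := I[leb] (fun x => segi x * ck e (x - s)).

Section width.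
Variable e : R.
Hypothesis e0 : 0 < e.

Let meas_ckB s : meas (fun x : P1 => ck e (x - s)).
Proof. have [i _] := intg_ck e0 s; exact: intg_meas i. Qed.
Lemma intg_mass s : intg leb (fun x => segi x * ck e (x - s)).
Proof.
apply: (intgMb (C := 2 / e) intg_segi) => // x.
by rewrite gtr0_norm ?ck_gt0//; exact: ck_le.
Qed.

Lemma mass_ge0 s : 0 <= mass e s.
Proof. by apply: I_ge0 => x; rewrite mulr_ge0 ?segi_ge0// ltW// ck_gt0. Qed.

Lemma massE s : mass e s = 2 * atan ((de - s) / e) + 2 * atan ((de + s) / e).
Proof.
rewrite /mass /Rintegral.
rewrite (_ : (\int[leb]_x _)%E = (\int[leb]_(x in `[(- de)%R, de%R]) (ck e (x - s))%:E)%E); last first.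
  rewrite [RHS]integral_mkcond; apply: eq_integral => x _.
  by rewrite patchE /segi indicE; case: ifP => _; rewrite ?mul1r ?mul0r.
have D x : hd (fun x => 2 * atan ((x - s) / e)) x (ck e (x - s)).
  apply: hd_eq; first by hd_auto.
  have en : e != 0 by rewrite gt_eqF.
  have n1 := lt0r_neq0 (sq_addr_gt0 (x - s) e0).
  have -> : 1 + ((x - s) / e) ^+ 2 = (e ^+ 2 + (x - s) ^+ 2) / e ^+ 2 by field.
  by rewrite /ck; field; rewrite n1 en.
rewrite (@continuous_FTC2 _ _ (fun x => 2 * atan ((x - s) / e))).
- by rewrite /= -[- de - s]opprD mulNr atanN mulrN opprK.
- by rewrite (lt_trans _ de0)// oppr_lt0.
- apply: continuous_subspaceT => x; rewrite /ck.
  by apply: hd_cont; hd_auto; rewrite gt_eqF// sq_addr_gt0.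
- split; first by move=> x _; have [] := D x.
  + exact/cvg_at_right_filter/(hd_cont (D _)).
  + exact/cvg_at_left_filter/(hd_cont (D _)).
- by move=> x _; rewrite derive1E; have [_ ->] := D x.
Qed.

Lemma sqi_kern (xi : P2) : I[m2] (fun eta => sqi eta * kern e (eta - xi)) = mass e xi.1 * mass e xi.2.
Proof.
have [_ <-] := prod_intg (intg_mass xi.1) (intg_mass xi.2).
by congr (Rintegral _ _ _); apply/funext => p; rewrite /sqi /kern/=; ring.
Qed.

Section lipschitz.
Variables (U : P2 -> R) (M L : R).
Hypotheses (mU : meas U) (UM : forall p, `|U p| <= M) (L0 : 0 <= L).
Hypothesis UL : forall p q : P2, (U p - U q) ^+ 2 <= L * ((q.1 - p.1) ^+ 2 + (q.2 - p.2) ^+ 2).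

Let u p := U p * sqi p.
Let c2 := 4 * pi * L * I[leb] segi * I[m2] sqi.

Let kp (p : P2 * P2) : R := kern e (p.2 - p.1).
Let mkp : meas kp. Proof. exact: meas_kernB. Qed.
Let kp0 p : 0 <= kp p. Proof. exact/ltW/kern_gt0. Qed.
Let kpC x y : `|kp (x, y)| <= (2 / e) ^+ 2.
Proof. by rewrite ger0_norm ?kp0//; exact: kern_le. Qed.

Let ks (p : P2 * P2) : R := (U p.1 - U p.2) ^+ 2 * kp p.
Let mks : meas ks.
Proof.
apply: measM => //; apply: measX; apply: measB.
  exact: (meas_comp (phi := fst) measurable_fst mU).
exact: (meas_comp (phi := snd) measurable_snd mU).
Qed.
Let ksC x y : `|ks (x, y)| <= (M + M) ^+ 2 * (2 / e) ^+ 2.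
Proof.
rewrite /ks normrM normrX ler_pM ?exprn_ge0//.
by rewrite ler_sqr ?nnegrE ?addr_ge0 ?(le_trans _ (UM x))// (le_trans (ler_normB _ _))// lerD.
Qed.

Lemma intg_u : intg m2 u.
Proof. by have := intgMb intg_sqi mU UM; congr (integrable _ _ _); apply/funext => p; rewrite /u/= mulrC. Qed.
Lemma intg_u2 : intg m2 (fun p => u p ^+ 2).
Proof.
have := intgMb intg_u (intg_meas intg_u) (C := M); rewrite /= => /(_ _)/wrap[p|].
  rewrite /u normrM (ger0_norm (sqi_ge0 p)) (le_trans _ (UM p))// ler_piMr//; exact: sqi_le1.
by congr (integrable _ _ _); apply/funext => p /=; rewrite expr2.
Qed.

(** The Lipschitz bound has one squared increment per coordinate: it turns the kernel of its own
    coordinate into 2 e, and the kernel of the other integrates to 2 pi. The two coordinates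
    together give 4 pi. *)
Lemma rem_le xi : I[m2] (fun eta => sqi eta * ks (xi, eta)) <= 2 * e * L * (4 * pi * I[leb] segi).
Proof.
have [i1 E1] := intg_ck e0 xi.1; have [i2 E2] := intg_ck e0 xi.2.
have [j1 F1] := prod_intg intg_segi i2; have [j2 F2] := prod_intg i1 intg_segi.
have -> : 2 * e * L * (4 * pi * I[leb] segi) =
   I[m2] (fun p => 2 * e * L * (segi p.1 * ck e (p.2 - xi.2) + ck e (p.1 - xi.1) * segi p.2)).
  by rewrite I_Z ?I_D// ?F1 ?F2 ?E1 ?E2; [ring|exact: intgD].
apply: I_le; [|exact/intgZ/intgD|].
  have := swap_intgb intg_sqi mks ksC xi; exact.
move=> p; have a1 := UL xi p; have s1 := segi01 p.1; have s2 := segi01 p.2.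
have k1 := sqr_ck_le e0 (p.1 - xi.1); have k2 := sqr_ck_le e0 (p.2 - xi.2).
have c1 := ck_gt0 e0 (p.1 - xi.1); have d1 := ck_gt0 e0 (p.2 - xi.2).
rewrite /ks/=; set V := (U xi - U p) ^+ 2 in a1 *.
apply: (@le_trans _ _ (sqi p * (L * ((p.1 - xi.1) ^+ 2 + (p.2 - xi.2) ^+ 2) * kp (xi, p)))).
  by rewrite ler_wpM2l ?sqi_ge0// ler_wpM2r.
rewrite /kp /kern/=; set s := ck e _ in k1 c1 *; set t := ck e _ in k2 d1 *.
rewrite /sqi; set a := segi p.1 in s1 *; set b := segi p.2 in s2 *.
set X := (p.1 - xi.1) ^+ 2 in k1 *; set Y := (p.2 - xi.2) ^+ 2 in k2 *.
rewrite (_ : _ * _ * _ = L * (a * b * (X * s) * t + a * b * (Y * t) * s)); last by ring.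
rewrite (_ : 2 * e * L * _ = L * (a * (2 * e) * t + b * (2 * e) * s)); last by ring.
case/andP: s1 => a0 a1'; case/andP: s2 => b0 b1.
have X0 : 0 <= X by exact: sqr_ge0. have Y0 : 0 <= Y by exact: sqr_ge0.
apply: ler_wpM2l => //; apply: lerD; (apply: ler_wpM2r; first exact: ltW).
- rewrite -mulrA; apply: ler_wpM2l => //; apply: le_trans k1; apply: ler_piMl => //.
  by apply: mulr_ge0 => //; exact: ltW.
- rewrite (mulrC a) -mulrA; apply: ler_wpM2l => //; apply: le_trans k2; apply: ler_piMl => //.
  by apply: mulr_ge0 => //; exact: ltW.
Qed.

(** On S x S, u(x) u(y) = u(x)^2 / 2 + u(y)^2 / 2 - (U(x) - U(y))^2 / 2. The first two terms are
    equal by symmetry of the kernel and give the left side, the third is O(e) by [rem_le]. *)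
Lemma kform_ge : I[m2] (fun p => u p ^+ 2 * (mass e p.1 * mass e p.2)) <= kform e u + c2 * e.
Proof.
have iu := intg_u; have iu2 := intg_u2.
have ih : intg m2 (fun p => 2^-1 * u p ^+ 2) := intgZ _ iu2.
have [ip Ep] := swap_prod iu iu mkp kpC.
have [iA EA] := swap_prod ih intg_sqi mkp kpC.
have [iB EB] := swap_prod intg_sqi ih mkp kpC.
have [iC EC] := swap_prod intg_sqi intg_sqi mks ksC.
have EA' : I[m2] (fun p => u p ^+ 2 * (mass e p.1 * mass e p.2)) = 2 * I[m2] (fun x => 2^-1 * u x ^+ 2 * I[m2] (fun y => sqi y * kp (x, y))).
  rewrite -I_Z; last exact: swap_intg1 ih intg_sqi mkp kpC.
  congr (Rintegral _ _ _); apply/funext => x; rewrite -sqi_kern mulrA mulrA mulfV ?mul1r//.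
have EB' : I[m2] (fun x => sqi x * I[m2] (fun y => 2^-1 * u y ^+ 2 * kp (x, y))) =
    I[m2] (fun x => 2^-1 * u x ^+ 2 * I[m2] (fun y => sqi y * kp (x, y))).
  apply: etrans; first exact: swapK intg_sqi ih mkp kpC.
  congr (Rintegral _ _ _); apply/funext => x; congr (_ * Rintegral _ _ _); apply/funext => y.
  by rewrite /kp/= kernB.
have EC' : I[m2] (fun x => sqi x * I[m2] (fun y => sqi y * ks (x, y))) <= 2 * (c2 * e).
  rewrite (_ : 2 * (c2 * e) = I[m2] (fun x => 2 * e * L * (4 * pi * I[leb] segi) * sqi x)); last first.
    by apply: esym; apply: etrans; [exact: I_Z intg_sqi|rewrite /c2; ring].
  apply: I_le; [exact: swap_intg1 intg_sqi intg_sqi mks ksC|exact/intgZ/intg_sqi|].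
  by move=> x; rewrite mulrC; apply: ler_wpM2r; [exact: sqi_ge0|exact: rem_le].
have split3 : (fun p : P2 * P2 => u p.1 * (u p.2 * kp p)) = (fun p => 2^-1 * u p.1 ^+ 2 * (sqi p.2 * kp p) +
    sqi p.1 * (2^-1 * u p.2 ^+ 2 * kp p) - 2^-1 * (sqi p.1 * (sqi p.2 * ks p))).
  apply/funext => p; rewrite /u /ks.
  have sa := sqi_sqr p.1; have sb := sqi_sqr p.2.
  set a := sqi p.1 in sa *; set b := sqi p.2 in sb *.
  have -> : (U p.1 * a) ^+ 2 = U p.1 ^+ 2 * a by rewrite -{2}sa; ring.
  have -> : (U p.2 * b) ^+ 2 = U p.2 ^+ 2 * b by rewrite -{2}sb; ring.
  by field.
have H : I[(m2 \x m2)%E] (fun p => u p.1 * (u p.2 * kp p)) =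
   I[(m2 \x m2)%E] (fun p => 2^-1 * u p.1 ^+ 2 * (sqi p.2 * kp p)) +
   I[(m2 \x m2)%E] (fun p => sqi p.1 * (2^-1 * u p.2 ^+ 2 * kp p)) -
   2^-1 * I[(m2 \x m2)%E] (fun p => sqi p.1 * (sqi p.2 * ks p)).
  rewrite split3; apply: etrans; first exact: I_B (intgD iA iB) (intgZ _ iC).
  by congr (_ - _); [exact: I_D iA iB|exact: I_Z iC].
move: H; rewrite Ep EA EB EC EB' EA' -/(kform e u).
by move=> H; exact: half_bound H EC'.
Qed.

End lipschitz.
End width.
End square_mass.

Lemma combine_bounds (R : realType) (a b ku kv ce cn t FF : R) : a <= ku + ce -> b <= kv + ce ->
  ku + kv <= FF -> ce <= cn -> 2 * cn <= t -> a + b <= FF + t.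
Proof. by lra. Qed.

Section plancherel_lower.
Context {R : realType}.
Local Notation leb := (@lebesgue_measure R).
Local Notation P1 := (measurableTypeR R).
Local Notation P2 := (plane R).
Local Notation m2 := (@leb2 R).

Lemma null_vline (a : R) : m2 ([set a] `*` setT) = 0%E.
Proof.
apply: etrans; first exact: (@product_measure1E _ _ P1 P1 R leb leb [set a] setT (measurable_set1 a) measurableT).
by rewrite [X in (X * _)%E](lebesgue_measure_set1 a) mul0e.
Qed.

Lemma null_hline (a : R) : m2 (setT `*` [set a]) = 0%E.
Proof.
apply: etrans; first exact: (@product_measure1E _ _ P1 P1 R leb leb setT [set a] measurableT (measurable_set1 a)).
by rewrite [X in (_ * X)%E](lebesgue_measure_set1 a) mule0.
Qed.

Variable de : R.
Hypothesis de0 : 0 < de.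

(** The open square is needed because at the end points of the segment [mass] tends to pi, not to 2
    pi. *)
Definition osq (p : P2) : R := ((- de < p.1 < de)%R && (- de < p.2 < de)%R)%:R.

Lemma ae_osq : {ae m2, forall p, osq p = sqi de p}.
Proof.
have mV (a : R) : measurable ([set a] `*` setT : set P2) := measurableX (measurable_set1 a) measurableT.
have mH (a : R) : measurable (setT `*` [set a] : set P2) := measurableX measurableT (measurable_set1 a).
pose N : set P2 := ([set de] `*` setT) `|` ([set - de] `*` setT) `|` (setT `*` [set de]) `|` (setT `*` [set - de]).
have nV (a : R) : m2.-negligible ([set a] `*` setT : set P2) by exists ([set a] `*` setT); split => //; exact: null_vline.
have nH (a : R) : m2.-negligible (setT `*` [set a] : set P2) by exists (setT `*` [set a]); split => //; exact: null_hline.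
have nN : m2.-negligible N by rewrite /N; do 3! (apply: negligibleU; last by []).
apply: negligibleS nN.
move=> p /= h; apply: contrapT => nN; apply: h.
have [n1 n2] : p.1 != de /\ p.1 != - de.
    by split; apply/eqP => h; apply: nN; left; left; [left|right].
have [n3 n4] : p.2 != de /\ p.2 != - de.
    by split; apply/eqP => h; apply: nN; [left; right|right].
rewrite /osq /sqi !segiE -natrM mulnb; congr (nat_of_bool _)%:R.
by rewrite !lt_neqAle n1 n3 (eq_sym _ p.1) (eq_sym _ p.2) n2 n4.
Qed.

Lemma meas_osq : meas osq.
Proof.
have -> : osq = \1_((`]- de, de[ : set P1) `*` (`]- de, de[ : set P1)).
  apply/funext => p; rewrite /osq indicE; congr (nat_of_bool _)%:R.
  apply/andP/idP => [[a b]|/set_mem/= [a b]]; first by apply/mem_set; split; rewrite /= in_itv.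
  by move: a b; rewrite /= !in_itv.
by apply: meas_indic; apply: measurableX.
Qed.

Lemma mass_cvg (eta s : R) : 0 < eta -> - de < s < de ->
  mass de (eta / k.+1%:R) s @[k --> \oo] --> 2 * pi.
Proof.
move=> eta0 /andP[s1 s2].
have L c : 0 < c -> atan (c / (eta / k.+1%:R)) @[k --> \oo] --> pi / 2.
  move=> c0; apply: (cvg_comp _ _ _ (@cvgy_atan R)).
  apply/cvgryPge => M; near=> k.
  rewrite invfM invrK mulrA -ler_pdivrMl ?divr_gt0//.
  rewrite (@le_trans _ _ k%:R)// ?ler_nat//.
  by near: k; exact: nbhs_infty_ger.
have -> : (fun k => mass de (eta / k.+1%:R) s) =
  (fun k => 2 * atan ((de - s) / (eta / k.+1%:R)) + 2 * atan ((de + s) / (eta / k.+1%:R))).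
  by apply/funext => k; rewrite massE// divr_gt0.
have -> : 2 * pi = 2 * (pi / 2) + 2 * (pi / 2) :> R by field.
apply: cvgD; apply: cvgMl_tmp; apply: L; first by rewrite subr_gt0.
by rewrite -ltrBlDl sub0r.
Unshelve. all: end_near. Qed.

(** Fatou's lemma for the integrands of [kform_ge], whose limit on the open square is (2 pi)^2 (u^2
    + v^2); the weighted energies are at most the full one because [wt] <= 1. *)
Lemma plancherel_lipschitz (U V : P2 -> R) (M L : R) : meas U -> meas V ->
  (forall p, `|U p| <= M) -> (forall p, `|V p| <= M) -> 0 <= L ->
  (forall p q : P2, (U p - U q) ^+ 2 <= L * ((q.1 - p.1) ^+ 2 + (q.2 - p.2) ^+ 2)) ->
  (forall p q : P2, (V p - V q) ^+ 2 <= L * ((q.1 - p.1) ^+ 2 + (q.2 - p.2) ^+ 2)) ->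
  (2 * pi) ^+ 2 * (I[m2] (fun p => (U p * sqi de p) ^+ 2) + I[m2] (fun p => (V p * sqi de p) ^+ 2)) <=
  I[m2] (fun x => fre (fun p => U p * sqi de p) (fun p => V p * sqi de p) x ^+ 2 +
     fim (fun p => U p * sqi de p) (fun p => V p * sqi de p) x ^+ 2).
Proof.
move=> mU mV UM VM L0 UL VL; pose u p := U p * sqi de p; pose v p := V p * sqi de p.
rewrite -/u -/v.
have iu : intg m2 u := intg_u de mU UM. have iu2 : intg m2 (fun p => u p ^+ 2) := intg_u2 de mU UM.
have iv : intg m2 v := intg_u de mV VM. have iv2 : intg m2 (fun p => v p ^+ 2) := intg_u2 de mV VM.
have [iF _] := bessel iu iv iu2 iv2.
set F := I[m2] (fun x => fre u v x ^+ 2 + fim u v x ^+ 2).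
pose c := 4 * pi * L * I[leb] (segi de) * I[m2] (sqi de).
have c0 : 0 <= c.
  have j1 : 0 <= I[leb] (segi de) by apply: I_ge0 => x; exact: segi_ge0.
  have j2 : 0 <= I[m2] (sqi de) by apply: I_ge0 => x; exact: sqi_ge0.
  by rewrite !mulr_ge0 ?pi_ge0.
apply/ler_addgt0Pr => eps eps0.
(* With widths eta / (k + 1), the errors for U and V together stay below 2 c eta <= eps for every k,
   as a uniform bound in Fatou's lemma demands. *)
pose eta := eps / (2 * c + 1).
have d0 : 0 < 2 * c + 1 by rewrite ltr_wpDl// mulr_ge0.
have eta0 : 0 < eta by rewrite divr_gt0.
have etaE : 2 * c * eta <= eps.
  by rewrite /eta mulrA ler_pdivrMr// mulrC ler_pM2l// lerDl.
pose X p := u p ^+ 2 + v p ^+ 2.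
have iX : intg m2 X by exact: intgD.
have X0 p : 0 <= X p by rewrite addr_ge0 ?sqr_ge0.
pose mm k (p : P2) := mass de (eta / k.+1%:R) p.1 * mass de (eta / k.+1%:R) p.2.
have ek k : 0 < eta / k.+1%:R by rewrite divr_gt0.
have mm0 k p : 0 <= mm k p by rewrite mulr_ge0 ?mass_ge0.
have osq01 p : 0 <= osq p <= 1 by rewrite /osq ler0n lern1 leq_b1.
have iXm k : intg m2 (fun p => X p * mm k p).
  have kC (x y : P2) : `|kern (eta / k.+1%:R) (y - x)| <= (2 / (eta / k.+1%:R)) ^+ 2.
    by rewrite gtr0_norm ?kern_gt0//; exact: kern_le.
  have := swap_intg1 iX (intg_sqi de) (meas_kernB (ek k)) kC.
  by congr (integrable _ _ _); apply/funext => p /=; rewrite sqi_kern.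
have H0 k p : 0 <= osq p * X p * mm k p.
  by case/andP: (osq01 p) => o0 _; rewrite mulr_ge0// mulr_ge0.
have H1 k p : osq p * X p * mm k p <= X p * mm k p.
  by case/andP: (osq01 p) => o0 o1; rewrite -mulrA ler_piMl// mulr_ge0.
have key : intg m2 (fun p => osq p * X p * (2 * pi) ^+ 2) /\
    I[m2] (fun p => osq p * X p * (2 * pi) ^+ 2) <= F + eps.
  apply: (@fatou_bound _ _ _ _ (fun k p => osq p * X p * mm k p)).
  - move=> k; apply: (intg_le _ (iXm k)).
      have mXm := intg_meas (iXm k).
      by have := measM meas_osq mXm; congr meas; apply/funext => p; rewrite mulrA.
    by move=> p; rewrite ger0_norm.
  - by [].
  - move=> p; rewrite /osq; case: andP => [[h1 h2]|_]; last first.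
      rewrite !mul0r (_ : (fun k => _) = fun=> 0); first exact: cvg_cst.
      by apply/funext => k; rewrite !mul0r.
    by apply: cvgMl_tmp; rewrite expr2; apply: cvgM; exact: mass_cvg.
  - move=> k.
    apply: (@le_trans _ _ (I[m2] (fun p => X p * mm k p))).
      apply: I_le; [|exact: iXm|].
        apply: (intg_le _ (iXm k)).
          have mXm := intg_meas (iXm k).
          by have := measM meas_osq mXm; congr meas; apply/funext => p; rewrite mulrA.
        by move=> p; rewrite ger0_norm.
      by [].
    have [iw Ew] := weighted_norm (ek k) iu iv.
    have wF : kform (eta / k.+1%:R) u + kform (eta / k.+1%:R) v <= F.
      rewrite -Ew; apply: I_le => // p; rewrite ler_piMl ?addr_ge0 ?sqr_ge0//.
      exact: wt_le1.
    have gu : I[m2] (fun p => u p ^+ 2 * mm k p) <= kform (eta / k.+1%:R) u + c * (eta / k.+1%:R) := kform_ge de (ek k) mU UM L0 UL.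
    have gv : I[m2] (fun p => v p ^+ 2 * mm k p) <= kform (eta / k.+1%:R) v + c * (eta / k.+1%:R) := kform_ge de (ek k) mV VM L0 VL.
    have iA (w : P2 -> R) : intg m2 (fun p => w p ^+ 2) -> intg m2 (fun p => w p ^+ 2 * mm k p).
      move=> iw2; have kC (x y : P2) : `|kern (eta / k.+1%:R) (y - x)| <= (2 / (eta / k.+1%:R)) ^+ 2.
        by rewrite gtr0_norm ?kern_gt0//; exact: kern_le.
      have := swap_intg1 iw2 (intg_sqi de) (meas_kernB (ek k)) kC.
      by congr (integrable _ _ _); apply/funext => p /=; rewrite sqi_kern.
    have -> : I[m2] (fun p => X p * mm k p) = I[m2] (fun p => u p ^+ 2 * mm k p) + I[m2] (fun p => v p ^+ 2 * mm k p).
      rewrite -I_D; [|exact: iA|exact: iA].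
      by congr (Rintegral _ _ _); apply/funext => p; rewrite mulrDl.
    have ee : c * (eta / k.+1%:R) <= c * eta.
      by apply: ler_wpM2l => //; rewrite ler_pdivrMr//; apply: ler_peMr; [exact: ltW|rewrite ler1n].
    by apply: (combine_bounds gu gv wF ee); rewrite mulrA.
have [ik leF] := key; apply: le_trans leF.
have <- : I[m2] (fun p => osq p * X p * (2 * pi) ^+ 2) = (2 * pi) ^+ 2 * (I[m2] (fun p => u p ^+ 2) + I[m2] (fun p => v p ^+ 2)).
  have iX2 := intgZ ((2 * pi) ^+ 2) iX.
  apply/eqP; rewrite -I_D// -/X -I_Z// -subr_eq0 -I_B//; apply/eqP; apply: I_ae0.
    by apply: measB; [exact: intg_meas ik|exact: intg_meas iX2].
  have := ae_osq; apply: filterS => p ->; rewrite /X /u /v.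
  have s2 := sqi_sqr de p; set s := sqi de p in s2 *.
  rewrite (_ : (U p * s) ^+ 2 + (V p * s) ^+ 2 = s * (U p ^+ 2 + V p ^+ 2)); first by rewrite mulrA s2; ring.
  by rewrite -[in RHS]s2; ring.
by [].
Qed.

End plancherel_lower.

(** * Translation invariance of the plane integral *)

Section translation.
Context {R : realType}.
Local Notation leb := (@lebesgue_measure R).
Local Notation P1 := (measurableTypeR R).
Local Notation P2 := (plane R).
Local Notation m2 := (@leb2 R).

Let shift (a : R) (x : P1) : P1 := (x : R) + a.

Let mshift a : measurable_fun setT (shift a).
Proof. by apply: measD; [exact: measid|exact: meas_cst]. Qed.

Lemma lebesgue_measure_shift (a : R) (A : set P1) : measurable A ->
  pushforward leb (shift a) A = leb A.
Proof.
move=> mA; pose nu : {measure set P1 -> \bar R} := pushforward leb (shift a).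
apply/esym; apply: (@lebesgue_measure_unique R (nu (mshift a))) => // _ [[b c]] _ <-.
rewrite /nu /= /pushforward.
have -> : shift a @^-1` `]b, c] = `](b - a), (c - a)]%classic.
  by apply/seteqP; split => x; rewrite /= !in_itv/= /shift ltrBlDr lerBrDr.
rewrite !lebesgue_measure_itv/= !lte_fin ltrBlDr subrK.
by case: ifP => // _; rewrite -!EFinB; congr (_%:E); ring.
Qed.

Lemma ge0_integral_shift (a : R) (f : P1 -> \bar R) : measurable_fun setT f ->
  (forall x, 0 <= f x)%E -> (\int[leb]_x f ((x : R) + a)%R = \int[leb]_x f x)%E.
Proof.
move=> mf f0; pose nu : {measure set P1 -> \bar R} := pushforward leb (shift a).
transitivity (\int[nu (mshift a)]_x f x)%E.
  by rewrite /nu ge0_integral_pushforward//=; exact: mshift.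
by apply: eq_measure_integral => A mA _; exact: lebesgue_measure_shift.
Qed.

Lemma I_shift (v : R * R) (f : P2 -> R) : intg m2 f -> (forall p, 0 <= f p) ->
  intg m2 (fun p => f ((p.1 : R) + v.1, (p.2 : R) + v.2)) /\
  I[m2] (fun p => f ((p.1 : R) + v.1, (p.2 : R) + v.2)) = I[m2] f.
Proof.
move=> i_f f0; have mf := intg_meas i_f.
have mfE : measurable_fun setT (fun p : P2 => (f p)%:E) by exact/measurable_EFinP.
have f0E (p : P2) : (0 <= (f p)%:E)%E by rewrite lee_fin.
have ms : measurable_fun setT (fun p : P2 => (((p.1 : R) + v.1, (p.2 : R) + v.2) : P2)).
  by apply: measurable_fun_pair; [exact: measD meas1 (meas_cst _)|exact: measD meas2 (meas_cst _)].
have mfs : meas (fun p : P2 => f ((p.1 : R) + v.1, (p.2 : R) + v.2)) := meas_comp ms mf.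
apply: intg_eqE => //; rewrite -I_EFin//.
have mfsE : measurable_fun setT (fun p : P2 => (f ((p.1 : R) + v.1, (p.2 : R) + v.2))%:E) by exact/measurable_EFinP.
rewrite /leb2 !fubini_tonelli1//.
pose G (x : P1) := (\int[leb]_y (f (x, y))%:E)%E.
have mG : measurable_fun setT G := measurable_fun_fubini_tonelli_F _ mfE f0E.
have G0 x : (0 <= G x)%E by apply: integral_ge0.
transitivity (\int[leb]_x G ((x : R) + v.1)%R)%E; last exact: ge0_integral_shift.
apply: eq_integral => x _; rewrite /fubini_F /G /=.
apply: (@ge0_integral_shift v.2 (fun y => (f ((x : R) + v.1, y))%:E)) => //.
exact: (measurableT_comp mfE (measurable_pair1 _)).
Qed.

End translation.

(** * Exponential sums under the Riesz bounds *)

Section bounded_lipschitz.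
Context {R : realType}.
Local Notation P2 := (plane R).
Local Notation m2 := (@leb2 R).

Lemma lipschitz_of_deriv (f df : R -> R) : (forall x, hd f x (df x)) -> (forall x, `|df x| <= 1) ->
  forall a b, `|f a - f b| <= `|a - b|.
Proof.
move=> hf h1 a b; wlog ab : a b / a < b.
  move=> H; case: (ltgtP a b) => [|ba|->]; [exact: H| |by rewrite !subrr].
  by rewrite distrC (distrC a); exact: H.
have [|c _ E] := @MVT R f df a b ab (fun x _ => hf x).
  by apply: continuous_subspaceT => x; exact: hd_cont (hf x).
rewrite distrC E (distrC a) normrM ler_piMl//.
Qed.

Lemma cos_lip (a b : R) : `|cos a - cos b| <= `|a - b|.
Proof.
apply: (@lipschitz_of_deriv _ (fun x => - sin x)) => [x|x]; first exact: is_derive_cos.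
by rewrite normrN sin_max.
Qed.
Lemma sin_lip (a b : R) : `|sin a - sin b| <= `|a - b|.
Proof.
apply: (@lipschitz_of_deriv _ cos) => [x|x]; [exact: is_derive_sin|exact: cos_max].
Qed.

(** A single constant bounds both the values and the increments in the l^1 distance, which keeps
    sums of such functions easy to handle. *)
Definition lipbd (U : P2 -> R) := meas U /\ exists2 M : R, 0 <= M &
  (forall p, `|U p| <= M) /\ (forall p q : P2, `|U p - U q| <= M * (`|(q.1 : R) - p.1| + `|(q.2 : R) - p.2|)).

Lemma lipbd0 : lipbd (fun=> 0).
Proof.
split; first exact: meas_cst.
by exists 0 => //; split => [p|p q]; rewrite ?subrr normr0 ?mul0r.
Qed.

Lemma lipbdD U V : lipbd U -> lipbd V -> lipbd (fun p => U p + V p).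
Proof.
move=> [mU [M M0 [bU lU]]] [mV [N N0 [bV lV]]]; split; first exact: measD.
exists (M + N); first exact: addr_ge0.
split => [p|p q]; first by rewrite (le_trans (ler_normD _ _))// lerD.
rewrite (_ : _ - _ = (U p - U q) + (V p - V q)); last by ring.
by rewrite (le_trans (ler_normD _ _))// mulrDl lerD.
Qed.

Lemma lipbd_sum (J : Type) (s : seq J) (h : J -> P2 -> R) :
  (forall i, lipbd (h i)) -> lipbd (fun p => \sum_(i <- s) h i p).
Proof.
move=> hh; elim: s => [|a s IH].
  by have := lipbd0; congr lipbd; apply/funext => p; rewrite big_nil.
by have := lipbdD (hh a) IH; congr lipbd; apply/funext => p; rewrite big_cons.
Qed.

Lemma dot2_lip (p q : P2) (x : R * R) :
  `|dot2 p x - dot2 q x| <= (`|x.1| + `|x.2|) * (`|(q.1 : R) - p.1| + `|(q.2 : R) - p.2|).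
Proof.
have -> : dot2 p x - dot2 q x = (p.1 - q.1) * x.1 + (p.2 - q.2) * x.2 by rewrite /dot2; ring.
rewrite (le_trans (ler_normD _ _))// !normrM (distrC p.1) (distrC p.2).
set a := `|q.1 - p.1|; set b := `|q.2 - p.2|.
have h1 : 0 <= `|x.1| * b by rewrite mulr_ge0 ?normr_ge0.
have h2 : 0 <= `|x.2| * a by rewrite mulr_ge0 ?normr_ge0.
lra.
Qed.

Lemma lipbd_trig (a b : R) (x : R * R) :
  lipbd (fun p => a * cos (dot2 p x) + b * sin (dot2 p x)).
Proof.
split.
  apply: measD; apply: measM; [exact: meas_cst|exact: (meas_cos (meas_dot x))|exact: meas_cst|exact: (meas_sin (meas_dot x))].
(* The 1 makes the Lipschitz constant large enough to bound the values as well. *)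
pose K := 1 + (`|x.1| + `|x.2|).
have K1 : 1 <= K by rewrite lerDl addr_ge0.
exists ((`|a| + `|b|) * K); first by rewrite mulr_ge0 ?addr_ge0.
have h0 : 0 <= `|a| + `|b| by rewrite addr_ge0.
split => [p|p q].
  apply: (@le_trans _ _ (`|a| + `|b|)); last by rewrite ler_peMr.
  rewrite (le_trans (ler_normD _ _))// !normrM lerD// ler_piMr//; [exact: cos_max|exact: sin_max].
have D0 : 0 <= `|(q.1 : R) - p.1| + `|(q.2 : R) - p.2| by rewrite addr_ge0.
have DK : `|dot2 p x - dot2 q x| <= K * (`|(q.1 : R) - p.1| + `|(q.2 : R) - p.2|).
  by apply: (le_trans (dot2_lip p q x)); rewrite ler_wpM2r// lerDr.
rewrite (_ : _ - _ = a * (cos (dot2 p x) - cos (dot2 q x)) + b * (sin (dot2 p x) - sin (dot2 q x))); last by ring.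
rewrite (le_trans (ler_normD _ _))// !normrM -mulrA mulrDl lerD// ler_wpM2l//.
- exact: le_trans (cos_lip _ _) DK.
- exact: le_trans (sin_lip _ _) DK.
Qed.

Lemma lipbd_sqr U : lipbd U -> exists M L, [/\ (forall p, `|U p| <= M), 0 <= L &
  forall p q : P2, (U p - U q) ^+ 2 <= L * (((q.1 : R) - p.1) ^+ 2 + ((q.2 : R) - p.2) ^+ 2)].
Proof.
move=> [_ [M M0 [b l]]]; exists M, (2 * M ^+ 2); split => //; first by rewrite mulr_ge0 ?exprn_ge0.
move=> p q; have := l p q; rewrite -(real_normK (num_real (U p - U q))).
rewrite -(real_normK (num_real (q.1 - p.1))) -(real_normK (num_real (q.2 - p.2))).
set s := `|q.1 - p.1|; set t := `|q.2 - p.2| => h.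
apply: (@le_trans _ _ ((M * (s + t)) ^+ 2)); first by apply: lerXn2r => //; rewrite nnegrE mulr_ge0 ?addr_ge0 ?normr_ge0.
have -> : 2 * M ^+ 2 * (s ^+ 2 + t ^+ 2) = M ^+ 2 * (2 * (s ^+ 2 + t ^+ 2)) by ring.
rewrite exprMn; apply: ler_wpM2l; first exact: exprn_ge0.
by have := sqr_ge0 (s - t); rewrite sqrrB sqrrD; lra.
Qed.

End bounded_lipschitz.

Section trig_sums.
Context {R : realType}.
Local Notation P2 := (plane R).
Local Notation m2 := (@leb2 R).
Variable x : nat -> R * R.
Implicit Types c : nat -> R * R.

(* real and imaginary parts of sum_(j < n) c_j e^(-i <p, x_j>); the sign is opposite to that of [expsum] *)
Definition tre c n (p : P2) : R :=
  \sum_(j < n) ((c j).1 * cos (dot2 p (x j)) + (c j).2 * sin (dot2 p (x j))).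
Definition tim c n (p : P2) : R :=
  \sum_(j < n) ((c j).2 * cos (dot2 p (x j)) - (c j).1 * sin (dot2 p (x j))).
Definition tsq c n (p : P2) : R := tre c n p ^+ 2 + tim c n p ^+ 2.
Definition nrm c n : R := \sum_(j < n) csq (c j).

Lemma lipbd_tre c n : lipbd (tre c n).
Proof. by apply: (@lipbd_sum R _ (index_enum 'I_n)) => j; exact: lipbd_trig. Qed.
Lemma lipbd_tim c n : lipbd (tim c n).
Proof.
apply: (@lipbd_sum R _ (index_enum 'I_n)) => j.
have := lipbd_trig (c j).2 (- (c j).1) (x j); congr lipbd; apply/funext => p.
by rewrite mulNr.
Qed.

Lemma meas_tre c n : meas (tre c n). Proof. by case: (lipbd_tre c n). Qed.
Lemma meas_tim c n : meas (tim c n). Proof. by case: (lipbd_tim c n). Qed.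
Lemma meas_tsq c n : meas (tsq c n).
Proof. by apply: measD; apply: measX; [exact: meas_tre|exact: meas_tim]. Qed.
Lemma tsq_ge0 c n p : 0 <= tsq c n p. Proof. by rewrite addr_ge0 ?sqr_ge0. Qed.

Lemma tsq_bounded c n : exists C, forall p, `|tsq c n p| <= C.
Proof.
have [_ [M M0 [bM _]]] := lipbd_tre c n; have [_ [N N0 [bN _]]] := lipbd_tim c n.
exists (M ^+ 2 + N ^+ 2) => p; rewrite ger0_norm ?tsq_ge0// /tsq.
rewrite -(real_normK (num_real (tre c n p))) -(real_normK (num_real (tim c n p))).
by rewrite lerD// ler_sqr.
Qed.

Definition conj (u : R * R) : R * R := (u.1, - u.2).

(** The sum is the complex conjugate of the [expsum] with conjugate coefficients; in this way
    [riesz_bounds] reaches the opposite sign convention. *)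
Lemma tsqE c n p : tsq c n p = csq (expsum x (fun j => conj (c j)) n p).
Proof.
rewrite /tsq /csq /expsum /=; congr (_ ^+ 2 + _).
  by apply: eq_bigr => j _; rewrite mulNr opprK.
rewrite -sqrrN /tim -sumrN; congr (_ ^+ 2); apply: eq_bigr => j _; ring.
Qed.

(** Multiplication by e^(-it). *)
Definition rot (t : R) (u : R * R) : R * R :=
  (u.1 * cos t + u.2 * sin t, u.2 * cos t - u.1 * sin t).

Lemma csq_rot t u : csq (rot t u) = csq u.
Proof.
rewrite /csq /rot/=; have := cos2Dsin2 t; set C := cos t; set S := sin t => h.
rewrite (_ : _ + _ = (u.1 ^+ 2 + u.2 ^+ 2) * (C ^+ 2 + S ^+ 2)); last by ring.
by rewrite h mulr1.
Qed.

Lemma tsq_shift c n (v : R * R) (p : P2) :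
  tsq c n ((p.1 : R) + v.1, (p.2 : R) + v.2) = tsq (fun j => rot (dot2 v (x j)) (c j)) n p.
Proof.
rewrite /tsq /tre /tim; congr (_ ^+ 2 + _ ^+ 2); apply: eq_bigr => j _ /=.
- have -> : dot2 (p.1 + v.1, p.2 + v.2) (x j) = dot2 p (x j) + dot2 v (x j) by rewrite /dot2/=; ring.
  by rewrite cosD sinD; ring.
- have -> : dot2 (p.1 + v.1, p.2 + v.2) (x j) = dot2 p (x j) + dot2 v (x j) by rewrite /dot2/=; ring.
  by rewrite cosD sinD; ring.
Qed.

Variables (de B : R).
Hypotheses (de0 : 0 < de) (B1 : 1 <= B) (riesz : riesz_bounds (Sq de) x B).

Lemma intg_sqi_tsq c n : intg m2 (fun p => sqi de p * tsq c n p).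
Proof.
have [C hC] := tsq_bounded c n; exact: intgMb (intg_sqi de) (meas_tsq c n) hC.
Qed.

Definition snorm c n := I[m2] (fun p => sqi de p * tsq c n p).

Lemma L2normE c n : L2norm (Sq de) (expsum x (fun j => conj (c j)) n) = Num.sqrt (snorm c n).
Proof.
rewrite /L2norm; congr Num.sqrt; rewrite /snorm /Rintegral; congr fine.
rewrite [LHS]integral_mkcond; apply: eq_integral => p _.
by rewrite patchE sqiE indicE -tsqE; case: ifP => _; rewrite ?mul1r ?mul0r.
Qed.

Lemma nrm_conj c n : \sum_(j < n) csq (conj (c j)) = nrm c n.
Proof. by apply: eq_bigr => j _; rewrite /csq /= sqrrN. Qed.

Lemma nrm_ge0 c n : 0 <= nrm c n.
Proof. by apply: sumr_ge0 => j _; rewrite addr_ge0 ?sqr_ge0. Qed.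

Lemma snorm_ge0 c n : 0 <= snorm c n.
Proof. by apply: I_ge0 => p; rewrite mulr_ge0 ?sqi_ge0 ?tsq_ge0. Qed.

Lemma riesz_le c n : snorm c n <= B ^+ 2 * nrm c n.
Proof.
have [_] := riesz n (fun j => conj (c j)); rewrite L2normE nrm_conj => h.
have B0 : 0 <= B by rewrite (le_trans _ B1).
have : Num.sqrt (snorm c n) ^+ 2 <= (B * Num.sqrt (nrm c n)) ^+ 2.
  by rewrite ler_sqr ?nnegrE ?mulr_ge0 ?sqrtr_ge0.
by rewrite exprMn !sqr_sqrtr ?snorm_ge0 ?nrm_ge0.
Qed.

Lemma riesz_ge c n : nrm c n <= B ^+ 2 * snorm c n.
Proof.
have [h _] := riesz n (fun j => conj (c j)); move: h; rewrite L2normE nrm_conj => h.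
have B0 : 0 < B by rewrite (lt_le_trans _ B1).
have : (B^-1 * Num.sqrt (nrm c n)) ^+ 2 <= Num.sqrt (snorm c n) ^+ 2.
  by rewrite ler_sqr ?nnegrE ?mulr_ge0 ?sqrtr_ge0// invr_ge0 ltW.
rewrite exprMn !sqr_sqrtr ?snorm_ge0 ?nrm_ge0// exprVn mulrC ler_pdivrMr ?exprn_gt0//.
by rewrite mulrC.
Qed.

(** Moving the translate back to S multiplies each coefficient by a unimodular factor, which leaves
    [nrm] unchanged, so the upper Riesz bound on S holds on every translate. *)
Lemma translate_le c n (v : R * R) :
  intg m2 (fun p => sqi de ((p.1 : R) - v.1, (p.2 : R) - v.2) * tsq c n p) /\
  I[m2] (fun p => sqi de ((p.1 : R) - v.1, (p.2 : R) - v.2) * tsq c n p) <= B ^+ 2 * nrm c n.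
Proof.
pose c' j := rot (dot2 v (x j)) (c j).
have g0 p : 0 <= sqi de p * tsq c' n p by rewrite mulr_ge0 ?sqi_ge0 ?tsq_ge0.
have [i E] := I_shift (- v.1, - v.2) (intg_sqi_tsq c' n) g0.
have H : (fun p : P2 => sqi de ((p.1 : R) - v.1, (p.2 : R) - v.2) * tsq c n p) =
   (fun p : P2 => sqi de ((p.1 : R) + - v.1, (p.2 : R) + - v.2) * tsq c' n ((p.1 : R) + - v.1, (p.2 : R) + - v.2)).
  by apply/funext => p; congr (_ * _); rewrite -tsq_shift /= !subrK; case: p.
rewrite H; split => //; rewrite [X in X <= _]E.
rewrite (le_trans (riesz_le c' n))// /nrm.
by under eq_bigr do rewrite csq_rot.
Qed.

End trig_sums.

(** * Exponential sums outside the square, by tiling with translates *)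

Section tiling.
Context {R : realType}.
Local Notation P2 := (plane R).
Local Notation m2 := (@leb2 R).
Variables (x : nat -> R * R) (de B : R).
Hypotheses (de0 : 0 < de) (B1 : 1 <= B) (riesz : riesz_bounds (Sq de) x B).

(** Half the side of the square made of (2 r + 1)^2 translates of S. *)
Definition side r : R := (2 * r%:R + 1) * de.

Let oddR r : (2 * r).+1%:R = 2 * r%:R + 1 :> R.
Proof. by rewrite -addn1 natrD natrM. Qed.
Let succR r : r.+1%:R = r%:R + 1 :> R. Proof. by rewrite natr1. Qed.

Lemma seg_cover n (s z : R) : s <= z -> z <= s + 2 * de * n.+1%:R ->
  exists2 a : 'I_n.+1, s + 2 * de * a%:R <= z & z <= s + 2 * de * a.+1%:R.
Proof.
elim: n => [|n IH] sz zs; first by exists ord0; rewrite //= mulr0 addr0.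
have [zn|nz] := leP z (s + 2 * de * n.+1%:R).
  have [a a1 a2] := IH sz zn.
  by exists (widen_ord (leqnSn _) a).
by exists ord_max; rewrite //= ltW.
Qed.

(** Centre of the a-th of the 2 r + 1 segments that make up [- side r, side r]. *)
Definition off r (a : nat) : R := (2 * a%:R - 2 * r%:R) * de.

Lemma segi_cover r (z : R) : segi (side r) z <= \sum_(a < (2 * r).+1) segi de (z - off r a).
Proof.
rewrite segiE; case: (boolP ((- side r <= z) && (z <= side r))%R) => [/andP[h1 h2]|_]; last first.
  by apply: sumr_ge0 => a _; exact: segi_ge0.
have [|a a1 a2] := @seg_cover (2 * r)%N (- side r) z h1.
  by rewrite (le_trans h2)// /side oddR; lra.
rewrite (bigD1 a)//= -[leLHS]addr0 lerD//; last by apply: sumr_ge0 => b _; exact: segi_ge0.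
rewrite segiE (_ : (_ <= _ <= _)%R = true)//; apply/andP.
rewrite /off; rewrite /side in a1 a2; rewrite succR in a2.
by split; lra.
Qed.

Lemma sqi_cover r (p : P2) : sqi (side r) p <=
  \sum_(a < (2 * r).+1) \sum_(b < (2 * r).+1) sqi de ((p.1 : R) - off r a, (p.2 : R) - off r b).
Proof.
rewrite /sqi /=; apply: (@le_trans _ _ ((\sum_(a < (2 * r).+1) segi de ((p.1 : R) - off r a)) *
   (\sum_(b < (2 * r).+1) segi de ((p.2 : R) - off r b)))).
  by rewrite ler_pM ?segi_ge0//; exact: segi_cover.
rewrite mulr_suml ler_sum// => a _; rewrite mulr_sumr ler_sum// => b _.
Qed.

Lemma intg_side_tsq c n r : intg m2 (fun p => sqi (side r) p * tsq x c n p).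
Proof.
have [C hC] := tsq_bounded x c n; exact: intgMb (intg_sqi (side r)) (meas_tsq x c n) hC.
Qed.

Lemma square_le c n r : I[m2] (fun p => sqi (side r) p * tsq x c n p) <=
  (2 * r%:R + 1) ^+ 2 * (B ^+ 2 * nrm c n).
Proof.
pose T (a b : nat) (p : P2) := sqi de ((p.1 : R) - off r a, (p.2 : R) - off r b) * tsq x c n p.
have iT a b : intg m2 (T a b) by have [] := translate_le B1 riesz c n (off r a, off r b).
have IT a b : I[m2] (T a b) <= B ^+ 2 * nrm c n by have [] := translate_le B1 riesz c n (off r a, off r b).
have iTT (a : 'I_(2 * r).+1) : intg m2 (fun p => \sum_(b < (2 * r).+1) T a b p).
  by apply: (@intg_sum _ _ _ _ _ (index_enum 'I_(2 * r).+1)) => b; exact: iT.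
apply: (@le_trans _ _ (I[m2] (fun p => \sum_(a < (2 * r).+1) \sum_(b < (2 * r).+1) T a b p))).
  apply: I_le; [exact: intg_side_tsq| |].
    by apply: (@intg_sum _ _ _ _ _ (index_enum 'I_(2 * r).+1)) => a; exact: iTT.
  move=> p; apply: (le_trans (ler_wpM2r (tsq_ge0 x c n p) (sqi_cover r p))).
  by rewrite mulr_suml ler_sum// => a _; rewrite mulr_suml.
rewrite (@I_sum _ _ _ _ _ (index_enum 'I_(2 * r).+1)) => [|a]; last exact: iTT.
apply: (@le_trans _ _ (\sum_(a < (2 * r).+1) \sum_(b < (2 * r).+1) (B ^+ 2 * nrm c n))).
  apply: ler_sum => a _.
  rewrite (@I_sum _ _ _ _ _ (index_enum 'I_(2 * r).+1)) => [|b]; last exact: iT.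
  by apply: ler_sum => b _; exact: IT.
set K := B ^+ 2 * nrm c n; rewrite !sumr_const card_ord -[X in X <= _]mulr_natr -(mulr_natr K) oddR.
by rewrite -mulrA -expr2 mulrC.
Qed.

Variable al : R.
Hypothesis al0 : 0 < al.
Let q := expR (- (al * de)).

Lemma wexp_out r (p : P2) : sqi (side r) p = 0 -> wexp al p <= q ^+ (2 * r).+1.
Proof.
move=> h; rewrite /wexp /q -expRM_natl ler_expR mulrN lerN2.
rewrite mulrCA ler_pM2l//.
have E : (2 * r).+1%:R * de = side r by rewrite oddR.
have r1 (z w : R) : side r < `|z| -> side r <= Num.sqrt (z ^+ 2 + w ^+ 2).
  by move=> hz; rewrite (le_trans (ltW hz))// -sqrtr_sqr ler_wsqrtr// lerDl sqr_ge0.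
have out (z : R) : segi (side r) z = 0 -> side r < `|z|.
  rewrite segiE -ler_norml; case: leP => //= _ /eqP; by rewrite oner_eq0.
rewrite E; move/eqP: h; rewrite mulf_eq0 => /orP[/eqP|/eqP] /out h; first exact: r1.
by rewrite addrC; exact: r1.
Qed.

Lemma sqi01 (d : R) (p : P2) : sqi d p = 0 \/ sqi d p = 1.
Proof. by rewrite sqiE indicE; case: (p \in _); [right|left]. Qed.

Lemma sqi_mono (d d' : R) (p : P2) : d <= d' -> sqi d p <= sqi d' p.
Proof.
move=> dd; have S (z : R) : segi d z <= segi d' z.
  rewrite !segiE; case: (boolP ((- d <= z) && (z <= d))%R) => [/andP[h1 h2]|_]; last by rewrite ler0n.
  rewrite (_ : (- d' <= z <= d')%R = true)//; apply/andP; split; last exact: le_trans dd.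
  by apply: le_trans h1; rewrite lerN2.
by apply: ler_pM; rewrite ?segi_ge0.
Qed.

Lemma side_mono r s : (r <= s)%N -> side r <= side s.
Proof. by move=> rs; apply: ler_wpM2r; [exact: ltW|rewrite lerD2r ler_wpM2l// ler_nat]. Qed.

(* z + sum_(r >= 0) 8 (r + 1) z^(2 r + 1), where 8 (r + 1) = (2 r + 3)^2 - (2 r + 1)^2 is the number of
   translates of the square in the shell number r, on which the weight is at most z^(2 r + 1); since only
   the unions of the first shells are tiled, Abel summation is used, and it costs the extra z *)
Definition tailK (z : R) : R := z + 8 * z / (1 - z ^+ 2) ^+ 2.

Let q0 : 0 < q. Proof. exact: expR_gt0. Qed.
Let q1 : q < 1. Proof. by rewrite -expR0 ltr_expR oppr_lt0 mulr_gt0. Qed.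

Let tN N := q + \sum_(r < N) 8 * (r%:R + 1) * q ^+ (2 * r).+1.

(** The arithmetic-geometric sum has a closed form whose remainder, proportional to (q^2)^N (1 + N
    (1 - q^2)), has a constant sign. *)
Let tN_le N : tN N <= tailK q.
Proof.
have z1 : 0 < 1 - q ^+ 2 by rewrite subr_gt0 exprn_ilt1// ltW.
suff H : \sum_(r < N) 8 * (r%:R + 1) * q ^+ (2 * r).+1 =
   8 * q / (1 - q ^+ 2) ^+ 2 * (1 - (q ^+ 2) ^+ N * (1 + N%:R * (1 - q ^+ 2))).
  rewrite /tN /tailK lerD2l H ler_piMr//.
    by rewrite divr_ge0 ?exprn_ge0 ?(ltW z1)// mulr_ge0// ltW.
  rewrite lerBlDr lerDl; apply: mulr_ge0; first by apply: exprn_ge0; exact: sqr_ge0.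
  by apply: addr_ge0 => //; apply: mulr_ge0 => //; exact: ltW.
have zn := lt0r_neq0 z1.
elim: N => [|N IH]; first by rewrite big_ord0 expr0 mul0r addr0 mulr1 subrr mulr0.
have e1 : q ^+ (2 * N).+1 = q * (q ^+ 2) ^+ N by rewrite exprS exprM.
have e2 : (q ^+ 2) ^+ N.+1 = q ^+ 2 * (q ^+ 2) ^+ N by rewrite exprS.
rewrite big_ord_recr/= IH e1 e2 succR.
by set Q := (q ^+ 2) ^+ N; field.
Qed.

Lemma tail_square c n N :
  I[m2] (fun p => wexp al p * ((sqi (side N) p - sqi (side 0) p) * tsq x c n p)) <=
  tailK q * (B ^+ 2 * nrm c n).
Proof.
set K := B ^+ 2 * nrm c n.
pose F r := I[m2] (fun p => sqi (side r) p * tsq x c n p).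
pose G r := I[m2] (fun p => wexp al p * ((sqi (side r) p - sqi (side 0) p) * tsq x c n p)).
have wn p : `|wexp al p| <= 1 by rewrite gtr0_norm ?wexp_gt0//; exact: wexp_le1.
have iD r s : intg m2 (fun p => (sqi (side r) p - sqi (side s) p) * tsq x c n p).
  have := intgB (intg_side_tsq c n r) (intg_side_tsq c n s); congr (integrable _ _ _).
  by apply/funext => p /=; rewrite mulrBl.
have iWD r s : intg m2 (fun p => wexp al p * ((sqi (side r) p - sqi (side s) p) * tsq x c n p)).
  have := intgMb (iD r s) (meas_wexp al) wn; congr (integrable _ _ _).
  by apply/funext => p /=; rewrite mulrC.
(* On the shell between two consecutive squares W is at most q^(2 r + 1); elsewhere both integrands
   vanish. *)
have step r : G r.+1 - G r <= q ^+ (2 * r).+1 * (F r.+1 - F r).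
  rewrite /G /F -!I_B//; [|exact: intg_side_tsq|exact: intg_side_tsq].
  rewrite -I_Z; last exact: intgB (intg_side_tsq _ _ _) (intg_side_tsq _ _ _).
  apply: I_le; [exact: intgB|exact/intgZ/intgB/intg_side_tsq/intg_side_tsq|].
  move=> p; rewrite -mulrBr -!mulrBl.
  rewrite (_ : sqi (side r.+1) p - sqi (side 0) p - (sqi (side r) p - sqi (side 0) p) =
     sqi (side r.+1) p - sqi (side r) p); last by ring.
  have mn := sqi_mono p (side_mono (leqnSn r)).
  case: (sqi01 (side r) p) => h.
    by rewrite ler_wpM2r ?wexp_out// mulr_ge0 ?subr_ge0 ?tsq_ge0.
  case: (sqi01 (side r.+1) p) => h'; first by move: mn; rewrite h h' ler10.
  by rewrite h h' subrr mul0r !mulr0.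
have FK r : F r <= (2 * r%:R + 1) ^+ 2 * K by exact: square_le.
(* Abel summation as an invariant. Only F r <= (2 r + 1)^2 K is known, so F enters with the
   decreasing factor q^(2 r + 1), and (2 r + 3)^2 - (2 r + 1)^2 = 8 (r + 1) gives the new term of
   [tN]. The summand q of [tN] makes the right side 0 at r = 0. *)
have inv r : G r - q ^+ (2 * r).+1 * F r <= K * (tN r - q ^+ (2 * r).+1 * (2 * r%:R + 1) ^+ 2).
  elim: r => [|r IH].
    rewrite /G (_ : (fun p => _) = fun=> 0); last by apply/funext => p; rewrite subrr mul0r mulr0.
    have F0 : 0 <= F 0%N by apply: I_ge0 => p; rewrite mulr_ge0 ?sqi_ge0 ?tsq_ge0.
    have -> : tN 0 - q ^+ (2 * 0).+1 * (2 * 0%:R + 1) ^+ 2 = 0.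
      by rewrite /tN big_ord0 muln0 expr1 mulr0 add0r expr1n mulr1 addr0 subrr.
    by rewrite I_0 mulr0 sub0r oppr_le0 mulr_ge0// exprn_ge0// ltW.
  have qr : 0 <= q ^+ (2 * r).+1 - q ^+ (2 * r.+1).+1.
    by rewrite subr_ge0; apply: ler_wiXn2l; rewrite ?(ltW q0) ?(ltW q1)// ltnS leq_mul2l leqnSn orbT.
  have := step r; have := ler_wpM2l qr (FK r.+1).
  rewrite /tN big_ord_recr/= -/(tN r); rewrite /tN in IH *.
  set S := \sum_(i < r) _ in IH *; move: IH; rewrite succR.
  set a := q ^+ (2 * r).+1; set b := q ^+ (2 * r.+1).+1; lra.
have := inv N; have := ler_wpM2l (ltW (exprn_gt0 (2 * N).+1 q0)) (FK N).
have K0 : 0 <= K by rewrite mulr_ge0 ?sqr_ge0 ?nrm_ge0.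
have := ler_wpM2l K0 (tN_le N); rewrite -/(G N) [tailK q * K]mulrC; lra.
Qed.

Lemma tail_le c n :
  intg m2 (fun p => wexp al p * ((1 - sqi de p) * tsq x c n p)) /\
  I[m2] (fun p => wexp al p * ((1 - sqi de p) * tsq x c n p)) <= tailK q * (B ^+ 2 * nrm c n).
Proof.
have side0 : side 0 = de by rewrite /side mulr0 add0r mul1r.
apply: (@fatou_bound _ _ _ _ (fun N p => wexp al p * ((sqi (side N) p - sqi (side 0) p) * tsq x c n p))).
- move=> N.
  have wn p : `|wexp al p| <= 1 by rewrite gtr0_norm ?wexp_gt0//; exact: wexp_le1.
  have iD := intgB (intg_side_tsq c n N) (intg_side_tsq c n 0).
  have := intgMb iD (meas_wexp al) wn; congr (integrable _ _ _).
  by apply/funext => p /=; rewrite mulrC mulrBl.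
- move=> N p; rewrite !mulr_ge0 ?tsq_ge0 ?(ltW (wexp_gt0 _ _))// subr_ge0.
  exact/sqi_mono/side_mono.
- move=> p; rewrite side0; apply: cvg_near_cst; near=> N.
  suff -> : sqi (side N) p = 1 by [].
  have H : `|p.1| + `|p.2| <= side N.
    have : (`|p.1| + `|p.2|) / de <= N%:R by near: N; exact: nbhs_infty_ger.
    rewrite ler_pdivrMr// => h; rewrite (le_trans h)// /side ler_pM2r//.
    by have := ler0n R N; lra.
  rewrite /sqi !segiE -!ler_norml.
  by rewrite (le_trans _ H) ?lerDl// (le_trans _ H) ?lerDr// mulr1.
- by move=> N; exact: tail_square.
Unshelve. all: end_near. Qed.

End tiling.

(** * Square-integrable functions and finite coefficient sequences *)

Section l2_functions.
Context {d} {T : measurableType d} {R : realType} (m : {measure set T -> \bar R}).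
Implicit Types f g : T -> R.

Lemma intg_mul f g : meas f -> meas g -> intg m (fun x => f x ^+ 2) -> intg m (fun x => g x ^+ 2) ->
  intg m (fun x => f x * g x).
Proof.
move=> mf mg i_f ig; apply: (intg_le (measM mf mg) (intgD i_f ig)) => x.
rewrite normrM -(real_normK (num_real (f x))) -(real_normK (num_real (g x))).
have := sqr_ge0 (`|f x| - `|g x|); have := normr_ge0 (f x); have := normr_ge0 (g x); nra.
Qed.

Lemma intg_sqrD f g : meas f -> meas g -> intg m (fun x => f x ^+ 2) -> intg m (fun x => g x ^+ 2) ->
  intg m (fun x => (f x + g x) ^+ 2).
Proof.
move=> mf mg i_f ig.
have := intgD (intgD i_f (intgZ 2 (intg_mul mf mg i_f ig))) ig; congr (integrable _ _ _).
by apply/funext => x /=; congr (_%:E); ring.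
Qed.

End l2_functions.

Section restriction.
Context {R : realType}.
Local Notation P2 := (plane R).
Local Notation m2 := (@leb2 R).
Variable de : R.

Lemma measurable_Sq : measurable (Sq de : set P2).
Proof.
have -> : (Sq de : set P2) = ([set` `[- de, de]] : set (measurableTypeR R)) `*` ([set` `[- de, de]] : set (measurableTypeR R)).
  by apply/seteqP; split => p; rewrite /Sq /= !in_itv.
exact: measurableX.
Qed.

Lemma integral_Sq (f : P2 -> R) :
  (\int[m2]_(p in Sq de) (f p)%:E = \int[m2]_p (sqi de p * f p)%:E)%E.
Proof.
rewrite [LHS]integral_mkcond; apply: eq_integral => p _.
by rewrite patchE sqiE indicE; case: ifP => _; rewrite ?mul1r ?mul0r.
Qed.

Lemma Rintegral_Sq (f : P2 -> R) : Rintegral m2 (Sq de) f = I[m2] (fun p => sqi de p * f p).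
Proof. by rewrite /Rintegral integral_Sq. Qed.

Lemma sqi_sqrM p (y : R) : (sqi de p * y) ^+ 2 = sqi de p * y ^+ 2.
Proof. by rewrite exprMn; congr (_ * _); rewrite [LHS]expr2; exact: sqi_sqr. Qed.

Lemma meas_sqi : meas (sqi de). Proof. exact: intg_meas (intg_sqi de). Qed.

Lemma L2onP (G : R * R -> R * R) : L2on (Sq de) G ->
  [/\ meas (fun p : P2 => sqi de p * (G p).1), meas (fun p : P2 => sqi de p * (G p).2),
   intg m2 (fun p => (sqi de p * (G p).1) ^+ 2) & intg m2 (fun p => (sqi de p * (G p).2) ^+ 2)].
Proof.
move=> [m1 [m2' fin]].
have M (f : P2 -> R) : measurable_fun (Sq de : set P2) f -> meas (fun p : P2 => sqi de p * f p).
  move=> mf; have := (measurable_restrictT f measurable_Sq).1 mf; rewrite /meas; congr measurable_fun.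
  by apply/funext => p; rewrite patchE sqiE indicE; case: ifP => _; rewrite ?mul1r ?mul0r.
have mm1 := M (fun p => (G p).1) m1; have mm2 := M (fun p => (G p).2) m2'.
have ic : intg m2 (fun p => sqi de p * csq (G p)).
  apply: intg_ge0P.
  - have := measD (measX 2 mm1) (measX 2 mm2); congr meas; apply/funext => p.
    by rewrite !sqi_sqrM -mulrDr.
  - by move=> p; rewrite mulr_ge0 ?sqi_ge0// addr_ge0 ?sqr_ge0.
  - by rewrite -integral_Sq.
split => //; (apply: (intg_le _ ic); first exact: measX) => p; rewrite ger0_norm ?sqr_ge0// sqi_sqrM.
- by rewrite ler_wpM2l ?sqi_ge0// lerDl sqr_ge0.
- by rewrite ler_wpM2l ?sqi_ge0// lerDr sqr_ge0.
Qed.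

Lemma L2on_intro (d1 d2 : P2 -> R) : meas d1 -> meas d2 ->
  intg m2 (fun p => sqi de p * (d1 p ^+ 2 + d2 p ^+ 2)) -> L2on (Sq de) (fun p => (d1 p, d2 p)).
Proof.
move=> md1 md2 i; split; [exact: (measurable_funTS md1)|split; first exact: (measurable_funTS md2)].
by rewrite integral_Sq I_EFin ?ltry.
Qed.

End restriction.

Section coefficient_space.
Context {R : realType}.
Local Notation P2 := (plane R).
Local Notation m2 := (@leb2 R).
Variable x : nat -> R * R.

(* a finitely supported sequence: only the first [u.1] entries of [u.2] count *)
Definition coefs := (nat * (nat -> R * R))%type.
Definition trunc n (c : nat -> R * R) : nat -> R * R := fun j => if (j < n)%N then c j else (0, 0).
(** u + t v, the only linear operation that the abstract minimization uses. *)
Definition comb (t : R) (u v : coefs) : coefs :=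
  (maxn u.1 v.1, fun j => ((trunc u.1 u.2 j).1 + t * (trunc v.1 v.2 j).1,
                           (trunc u.1 u.2 j).2 + t * (trunc v.1 v.2 j).2)).
Definition Tre (u : coefs) := tre x u.2 u.1.
Definition Tim (u : coefs) := tim x u.2 u.1.

Lemma big_trunc (f : nat -> R * R -> R) n N c : (n <= N)%N -> (forall j, f j (0, 0) = 0) ->
  \sum_(j < N) f j (trunc n c j) = \sum_(j < n) f j (c j).
Proof.
move=> nN f0; rewrite (big_ord_widen N (fun j => f j (c j)) nN) [RHS]big_mkcond/=.
by apply: eq_bigr => j _; rewrite /trunc; case: ifP.
Qed.

Lemma Tre_comb t u v p : Tre (comb t u v) p = Tre u p + t * Tre v p.
Proof.
pose f j (c : R * R) := c.1 * cos (dot2 p (x j)) + c.2 * sin (dot2 p (x j)).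
have f0 j : f j (0, 0) = 0 by rewrite /f !mul0r addr0.
rewrite /Tre /tre -(big_trunc (f := f) u.2 (leq_maxl u.1 v.1))// -(big_trunc (f := f) v.2 (leq_maxr u.1 v.1))//.
by rewrite mulr_sumr -big_split/=; apply: eq_bigr => j _; rewrite /f /=; ring.
Qed.

Lemma Tim_comb t u v p : Tim (comb t u v) p = Tim u p + t * Tim v p.
Proof.
pose f j (c : R * R) := c.2 * cos (dot2 p (x j)) - c.1 * sin (dot2 p (x j)).
have f0 j : f j (0, 0) = 0 by rewrite /f !mul0r subr0.
rewrite /Tim /tim -(big_trunc (f := f) u.2 (leq_maxl u.1 v.1))// -(big_trunc (f := f) v.2 (leq_maxr u.1 v.1))//.
by rewrite mulr_sumr -big_split/=; apply: eq_bigr => j _; rewrite /f /=; ring.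
Qed.

Section weighted_form.
Variable w : P2 -> R.
Hypotheses (iw : intg m2 w) (w0 : forall p, 0 <= w p).

(** The real part of the Hermitian form: complex sequences are treated as a real vector space
    throughout. *)
Definition wform (u v : coefs) : R := I[m2] (fun p => w p * (Tre u p * Tre v p + Tim u p * Tim v p)).

Lemma lipbd_bound U : lipbd U -> exists2 M : R, 0 <= M & forall p, `|U p| <= M.
Proof. by move=> [_ [M M0 [h _]]]; exists M. Qed.

Lemma intg_wform u v : intg m2 (fun p => w p * (Tre u p * Tre v p + Tim u p * Tim v p)).
Proof.
have [M1 M10 h1] := lipbd_bound (lipbd_tre x u.2 u.1); have [M2 M20 h2] := lipbd_bound (lipbd_tre x v.2 v.1).
have [M3 M30 h3] := lipbd_bound (lipbd_tim x u.2 u.1); have [M4 M40 h4] := lipbd_bound (lipbd_tim x v.2 v.1).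
apply: (intgMb (C := M1 * M2 + M3 * M4) iw).
  by apply: measD; apply: measM; [exact: meas_tre|exact: meas_tre|exact: meas_tim|exact: meas_tim].
move=> p; apply: le_trans (ler_normD _ _) _; rewrite !normrM; apply: lerD; apply: ler_pM; rewrite ?normr_ge0//.
- exact: h1.
- exact: h2.
- exact: h3.
- exact: h4.
Qed.

Lemma wform_sym u v : wform u v = wform v u.
Proof. by congr (I[_] _); apply/funext => p; ring. Qed.

Lemma wform_lin t u v z : wform (comb t u v) z = wform u z + t * wform v z.
Proof.
rewrite /wform -I_Z; last exact: intg_wform.
rewrite -I_D; [|exact: intg_wform|exact/intgZ/intg_wform].
by congr (I[_] _); apply/funext => p; rewrite Tre_comb Tim_comb; ring.
Qed.

Lemma wform_ge0 u : 0 <= wform u u.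
Proof. by apply: I_ge0 => p; rewrite mulr_ge0// -!expr2 addr_ge0 ?sqr_ge0. Qed.

Lemma wformE u : wform u u = I[m2] (fun p => w p * tsq x u.2 u.1 p).
Proof. by congr (I[_] _); apply/funext => p; rewrite -!expr2. Qed.

Lemma wform_CS u v : wform u v ^+ 2 <= wform v v * wform u u.
Proof. exact: (form_CS wform_sym wform_lin wform_ge0). Qed.

End weighted_form.
End coefficient_space.

(** * Density and duality on the square *)

Section vector_functions.
Context {d} {T : measurableType d} {R : realType} (m : {measure set T -> \bar R}).
Implicit Types F G H : T -> R * R.

Definition L2v F := [/\ meas (fun p => (F p).1), meas (fun p => (F p).2),
  intg m (fun p => (F p).1 ^+ 2) & intg m (fun p => (F p).2 ^+ 2)].
Definition vdot F G (p : T) : R := (F p).1 * (G p).1 + (F p).2 * (G p).2.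
Definition ip F G : R := I[m] (vdot F G).
Definition vadd (t : R) F G : T -> R * R := fun p => ((F p).1 + t * (G p).1, (F p).2 + t * (G p).2).

Lemma L2v_vadd t F G : L2v F -> L2v G -> L2v (vadd t F G).
Proof.
move=> [f1 f2 i1 i2] [g1 g2 j1 j2].
have Z (g : T -> R) : intg m (fun p => g p ^+ 2) -> intg m (fun p => (t * g p) ^+ 2).
  move=> i; have := intgZ (t ^+ 2) i; congr (integrable _ _ _).
  by apply/funext => p /=; rewrite exprMn.
split; rewrite /vadd /=.
- exact: measD f1 (measM (meas_cst t) g1).
- exact: measD f2 (measM (meas_cst t) g2).
- exact: intg_sqrD f1 (measM (meas_cst t) g1) i1 (Z _ j1).
- exact: intg_sqrD f2 (measM (meas_cst t) g2) i2 (Z _ j2).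
Qed.

Lemma intg_vdot F G : L2v F -> L2v G -> intg m (vdot F G).
Proof.
move=> [f1 f2 i1 i2] [g1 g2 j1 j2].
exact: intgD (intg_mul f1 g1 i1 j1) (intg_mul f2 g2 i2 j2).
Qed.

Lemma ip_sym F G : ip F G = ip G F.
Proof. by congr (I[_] _); apply/funext => p; rewrite /vdot; ring. Qed.

Lemma ip_lin t F G H : L2v F -> L2v G -> L2v H -> ip (vadd t F G) H = ip F H + t * ip G H.
Proof.
move=> lF lG lH; have i1 := intg_vdot lF lH; have i2 := intg_vdot lG lH.
rewrite /ip -I_Z// -I_D//; last exact: intgZ.
by congr (I[_] _); apply/funext => p; rewrite /vdot /vadd /=; ring.
Qed.

Lemma ip_ge0 F : 0 <= ip F F.
Proof. by apply: I_ge0 => p; rewrite /vdot -!expr2 addr_ge0 ?sqr_ge0. Qed.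

Lemma ipE F : ip F F = I[m] (fun p => csq (F p)).
Proof. by congr (I[_] _); apply/funext => p; rewrite /vdot -!expr2. Qed.

(** The abstract lemmas on forms ask for linearity on a whole type, hence the subtype. *)
Let L2vT := {F | L2v F}.
Let vcomb t (F G : L2vT) : L2vT := exist _ _ (L2v_vadd t (proj2_sig F) (proj2_sig G)).

Lemma ip_CS F G : L2v F -> L2v G -> ip F G ^+ 2 <= ip G G * ip F F.
Proof.
move=> lF lG; pose B (u v : L2vT) := ip (proj1_sig u) (proj1_sig v).
apply: (form_CS (V := L2vT) (comb := vcomb) (B := B) _ _ _ (exist _ F lF) (exist _ G lG)).
- by move=> u v; exact: ip_sym.
- by move=> t u v w; apply: ip_lin; exact: proj2_sig.
- by move=> u; exact: ip_ge0.
Qed.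

Lemma ip_vadd t F G : L2v F -> L2v G ->
  ip (vadd t F G) (vadd t F G) = ip F F + 2 * t * ip F G + t ^+ 2 * ip G G.
Proof.
move=> lF lG; pose B (u v : L2vT) := ip (proj1_sig u) (proj1_sig v).
apply: (form_comb (V := L2vT) (comb := vcomb) (B := B) _ _ t (exist _ F lF) (exist _ G lG)).
- by move=> u v; exact: ip_sym.
- by move=> s u v w; apply: ip_lin; exact: proj2_sig.
Qed.

Lemma L2v_ext F G : F =1 G -> L2v F -> L2v G.
Proof. by move=> /funext ->. Qed.

Lemma ip_sum F : L2v F -> ip F F = I[m] (fun p => (F p).1 ^+ 2) + I[m] (fun p => (F p).2 ^+ 2).
Proof. by move=> [_ _ i1 i2]; rewrite ipE I_D. Qed.

End vector_functions.

Section restricted_sums.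
Context {R : realType}.
Local Notation P2 := (plane R).
Local Notation m2 := (@leb2 R).
Variables (x : nat -> R * R) (de : R).

Definition sE (u : coefs) (p : P2) : R * R := (sqi de p * Tre x u p, sqi de p * Tim x u p).
Definition resS (F : R * R -> R * R) (p : P2) : R * R := (sqi de p * (F p).1, sqi de p * (F p).2).

Lemma L2v_sE u : L2v m2 (sE u).
Proof.
have key (h : P2 -> R) : lipbd h -> meas (fun p => sqi de p * h p) /\ intg m2 (fun p => (sqi de p * h p) ^+ 2).
  move=> lh; have [M M0 hM] := lipbd_bound lh; have mh := lh.1; split; first exact: measM (meas_sqi de) mh.
  have := intgMb (C := M ^+ 2) (intg_sqi de) (measX 2 mh); rewrite /=.
  under [X in _ -> integrable _ _ (EFin \o X)]funext do rewrite sqi_sqrM.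
  apply=> p; rewrite normrX; apply: lerXn2r; rewrite ?nnegrE//; exact: hM.
have [k1 k2] := key _ (lipbd_tre x u.2 u.1); have [k3 k4] := key _ (lipbd_tim x u.2 u.1).
by split.
Qed.

Lemma L2v_resS F : L2on (Sq de) F -> L2v m2 (resS F).
Proof. by move=> /L2onP[]. Qed.

Lemma sE_comb t u v : sE (comb t u v) = vadd t (sE u) (sE v).
Proof. by apply/funext => p; rewrite /sE /vadd Tre_comb Tim_comb /=; congr (_, _); ring. Qed.

Lemma ip_sE u v : ip m2 (sE u) (sE v) = wform x (sqi de) u v.
Proof.
congr (I[_] _); apply/funext => p; rewrite /vdot /sE /= mulrDr; congr (_ + _);
  by rewrite mulrACA sqi_sqr.
Qed.

Lemma ip_sE_snorm u : ip m2 (sE u) (sE u) = snorm x de u.2 u.1.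
Proof. by rewrite ip_sE wformE. Qed.

End restricted_sums.

Section density.
Context {R : realType}.
Local Notation P2 := (plane R).
Local Notation m2 := (@leb2 R).
Variables (x : nat -> R * R) (de : R).
Hypothesis complete : exp_complete (Sq de) x.

(** The j-th unit sequence; [unit2] is i times it. Real parts of pairings with both recover a
    complex number. *)
Definition unit1 (j : nat) : coefs := (j.+1, fun i => if i == j then (1 : R, 0 : R) else (0, 0)).
Definition unit2 (j : nat) : coefs := (j.+1, fun i => if i == j then (0 : R, 1 : R) else (0, 0)).

Lemma sum_unit (j : nat) (f : nat -> R) : (forall i, i != j -> f i = 0) -> \sum_(i < j.+1) f i = f j.
Proof.
move=> f0; rewrite big_ord_recr/= big1 ?add0r// => i _.
by apply: f0; rewrite neq_ltn ltn_ord.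
Qed.

Lemma T_unit1 j p : Tre x (unit1 j) p = cos (dot2 p (x j)) /\ Tim x (unit1 j) p = - sin (dot2 p (x j)).
Proof.
split; rewrite /Tre /Tim /tre /tim /=.
- rewrite (sum_unit (f := fun i => (if i == j then (1 : R, 0 : R) else (0, 0)).1 * cos (dot2 p (x i)) +
    (if i == j then (1 : R, 0 : R) else (0, 0)).2 * sin (dot2 p (x i)))) ?eqxx/= ?mul1r ?mul0r ?addr0//.
  by move=> i /negbTE -> /=; rewrite !mul0r addr0.
- rewrite (sum_unit (f := fun i => (if i == j then (1 : R, 0 : R) else (0, 0)).2 * cos (dot2 p (x i)) -
    (if i == j then (1 : R, 0 : R) else (0, 0)).1 * sin (dot2 p (x i)))) ?eqxx/= ?mul1r ?mul0r ?sub0r//.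
  by move=> i /negbTE -> /=; rewrite !mul0r subr0.
Qed.

Lemma T_unit2 j p : Tre x (unit2 j) p = sin (dot2 p (x j)) /\ Tim x (unit2 j) p = cos (dot2 p (x j)).
Proof.
split; rewrite /Tre /Tim /tre /tim /=.
- rewrite (sum_unit (f := fun i => (if i == j then (0 : R, 1 : R) else (0, 0)).1 * cos (dot2 p (x i)) +
    (if i == j then (0 : R, 1 : R) else (0, 0)).2 * sin (dot2 p (x i)))) ?eqxx/= ?mul1r ?mul0r ?add0r//.
  by move=> i /negbTE -> /=; rewrite !mul0r addr0.
- rewrite (sum_unit (f := fun i => (if i == j then (0 : R, 1 : R) else (0, 0)).2 * cos (dot2 p (x i)) -
    (if i == j then (0 : R, 1 : R) else (0, 0)).1 * sin (dot2 p (x i)))) ?eqxx/= ?mul1r ?mul0r ?subr0//.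
  by move=> i /negbTE -> /=; rewrite !mul0r subr0.
Qed.

Lemma sqr_vanish (a M : R) : (forall n, a ^+ 2 <= 4^-1 ^+ n * M) -> a = 0.
Proof.
move=> h; apply/eqP; rewrite -sqrf_eq0 eq_le sqr_ge0 andbT.
have c : (fun n : nat => 4^-1 ^+ n * M) @ \oo --> 0 * M.
  by apply: cvgMl; apply: cvg_expr; rewrite ger0_norm ?invr_ge0// invf_lt1// ltr1n.
rewrite mul0r in c; rewrite -(cvg_lim (@Rhausdorff R) c); apply: limr_ge; first exact: (cvgP _ c).
by near=> n; exact: h.
Unshelve. all: by end_near.
Qed.

Lemma geometric_small (eps : R) : 0 < eps -> exists n, 4 * 4^-1 ^+ n <= eps.
Proof.
move=> e0; have c : (fun n : nat => 4 * 4^-1 ^+ n : R) @ \oo --> 4 * (0 : R).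
  by apply: cvgMr; apply: cvg_expr; rewrite ger0_norm ?invr_ge0// invf_lt1// ltr1n.
rewrite mulr0 in c; have [N _ h] := cvgr_lt _ c _ e0.
by exists N; apply: ltW; exact: (h N (leqnn N)).
Qed.

(** 2 (z / 4) q + 2 (2 z) q = (9 / 2) z q, rounded up to 5 z q. *)
Lemma split_sqr_le (a b c y q z : R) : 0 <= q -> 0 <= z -> (b - c) ^+ 2 <= z / 4 * q ->
  (a - b) ^+ 2 <= q * y -> y <= 2 * z -> (c - a) ^+ 2 <= z * (5 * q).
Proof.
move=> q0 z0 h1 h2 h3; have := sqr_ge0 (b - c - (a - b)).
have : q * y <= q * (2 * z) by rewrite ler_wpM2l.
have := mulr_ge0 q0 z0; nra.
Qed.

Lemma cut_sqr_le (s h t g : R) : s * s = s -> 0 <= s -> s <= 1 ->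
  (s * h - s * t) ^+ 2 <= 2 * (s * (s * h - g)) ^+ 2 + 2 * (g - s * t) ^+ 2.
Proof.
move=> ss s0 s1.
have -> : s * h - s * t = s * (s * h - g) + s * (g - s * t).
  by have e y : s * (s * y) = s * y; [rewrite mulrA ss|rewrite !mulrBr !e; ring].
have : (s * (g - s * t)) ^+ 2 <= (g - s * t) ^+ 2.
  by rewrite exprMn expr2 ss ler_piMl ?sqr_ge0.
by have := sqr_ge0 (s * (s * h - g) - s * (g - s * t)); lra.
Qed.

Lemma resS_L2v (D : P2 -> R * R) : L2v m2 D -> L2v m2 (resS de D).
Proof.
have key (f : P2 -> R) : meas f -> intg m2 (fun p => f p ^+ 2) -> intg m2 (fun p => (sqi de p * f p) ^+ 2).
  move=> mf i; apply: (intg_le _ i); first exact: measX 2 (measM (meas_sqi de) mf).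
  move=> p; rewrite ger0_norm ?sqr_ge0// sqi_sqrM ler_piMl ?sqr_ge0//; exact: sqi_le1.
move=> [d1 d2 i1 i2]; split; [exact: measM (meas_sqi de) d1|exact: measM (meas_sqi de) d2|exact: key|exact: key].
Qed.

Lemma ortho_sE0 (D : P2 -> R * R) : L2v m2 D -> (forall w, ip m2 D (sE x de w) = 0) ->
  {ae m2, forall p, sqi de p * (D p).1 = 0 /\ sqi de p * (D p).2 = 0}.
Proof.
move=> [d1 d2 i1 i2] h.
have id12 : intg m2 (fun p => sqi de p * ((D p).1 ^+ 2 + (D p).2 ^+ 2)).
  apply: (intg_le _ (intgD i1 i2)); first exact: measM (meas_sqi de) (measD (measX 2 d1) (measX 2 d2)).
  move=> p; have := sqi_ge0 de p; have := sqi_le1 de p.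
  have := sqr_ge0 (D p).1; have := sqr_ge0 (D p).2; move=> a b c e.
  by rewrite ger0_norm ?mulr_ge0 ?addr_ge0// ler_piMl ?addr_ge0.
(* [exp_complete] pairs with e^(i <p, x_j>), whereas [sE] is built from e^(-i <p, x_j>); conjugating
   D passes from one to the other. *)
have mg : L2on (Sq de) (fun p => ((D p).1, - (D p).2)).
  apply: L2on_intro; [exact: d1|exact: measN|].
  by under [X in EFin \o X]funext do rewrite sqrrN.
have orth j : Rintegral m2 (Sq de) (fun p => (D p).1 * cos (dot2 p (x j)) + - (D p).2 * sin (dot2 p (x j))) = 0 /\
   Rintegral m2 (Sq de) (fun p => - (D p).2 * cos (dot2 p (x j)) - (D p).1 * sin (dot2 p (x j))) = 0.
  rewrite !Rintegral_Sq; split.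
  - rewrite -[RHS](h (unit1 j)); congr (I[_] _); apply/funext => p; have [e1 e2] := T_unit1 j p.
    by rewrite /vdot /sE /= e1 e2; ring.
  - rewrite -[RHS]oppr0 -(h (unit2 j)) -I_N; last exact: intg_vdot (L2v_sE _ _ _).
    congr (I[_] _); apply/funext => p; have [e1 e2] := T_unit2 j p.
    by rewrite /vdot /sE /= e1 e2; ring.
have := complete mg orth; apply: filterS; first exact: (ae_filter_ringOfSetsType m2).
move=> p hp.
rewrite sqiE indicE; case: (pselect (Sq de p)) => [Sp|nSp].
  have := hp Sp; rewrite pair_equal_spec => -[-> /eqP]; rewrite oppr_eq0 => /eqP ->.
  by rewrite !mulr0.
by rewrite memNset// !mul0r.
Qed.

(** Near-minimizers of |E_u|^2 - 2 <H, E_u> on S approximate the projection of H onto the span. They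
    converge to some g, and H - g is orthogonal to all exponentials, hence 0 almost everywhere on S
    by completeness. *)
Lemma span_dense (H : P2 -> R * R) (eps : R) : L2v m2 H -> (forall p, H p = resS de H p) -> 0 < eps ->
  exists u, ip m2 (vadd (-1) H (sE x de u)) (vadd (-1) H (sE x de u)) <= eps.
Proof.
move=> lH Hs eps0.
have lE u : L2v m2 (sE x de u) by exact: L2v_sE.
pose B := wform x (sqi de); pose l v := ip m2 H (sE x de v).
have isq := intg_sqi de; have sq0 : forall p, 0 <= sqi de p := sqi_ge0 de.
have Bsym : forall u v, B u v = B v u by exact: wform_sym.
have Blin : forall t u v w, B (comb t u v) w = B u w + t * B v w := wform_lin x isq.
have Bpos : forall v, 0 <= B v v := wform_ge0 x sq0.
have llin t u v : l (comb t u v) = l u + t * l v.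
  by rewrite /l ip_sym sE_comb ip_lin// ip_sym; congr (_ + _ * _); exact: ip_sym.
have lbd v : l v ^+ 2 <= ip m2 H H * B v v.
  by rewrite mulrC /B -ip_sE; exact: ip_CS.
(* Then 2 (e k + e n) <= 4^-n for k >= n, the rate required by [riesz_fischer]. *)
pose e n : R := 4^-1 ^+ n / 4.
have e0 n : 0 < e n by rewrite divr_gt0// exprn_gt0// invr_gt0.
have /choice[u hu] : forall n, exists u, forall w, (B u w - l w) ^+ 2 <= e n * B w w.
  by move=> n; exact: (near_minimizer (0%N, fun=> (0, 0)) Bsym Blin llin Bpos (ip_ge0 m2 H) lbd (e0 n)).
have cau n k : (n <= k)%N -> ip m2 (vadd (-1) (sE x de (u k)) (sE x de (u n))) (vadd (-1) (sE x de (u k)) (sE x de (u n))) <= 4^-1 ^+ n.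
  move=> nk; rewrite -sE_comb ip_sE.
  apply: (le_trans (near_minimizer_cauchy Blin Bpos (ltW (e0 k)) (ltW (e0 n)) (hu k) (hu n))).
  have : e k <= e n.
    rewrite /e ler_pM2r ?invr_gt0// ler_wiXn2l ?invr_ge0// invf_le1// ler1n//.
  rewrite /e; lra.
pose f n := sE x de (u n).
have lD n k : L2v m2 (vadd (-1) (f k) (f n)) := L2v_vadd (-1) (lE (u k)) (lE (u n)).
have addN1 (a b : P2 -> R) : (fun p => (a p + -1 * b p) ^+ 2) = (fun p => (a p - b p) ^+ 2).
  by apply/funext => p; rewrite mulN1r.
have [g1 [mg1 hg1]] : exists g, meas g /\ forall n, intg m2 (fun p => (g p - (f n p).1) ^+ 2) /\
    I[m2] (fun p => (g p - (f n p).1) ^+ 2) <= 4^-1 ^+ n.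
  apply: (riesz_fischer (f := fun n p => (f n p).1)) => [n|n k nk]; first by case: (lE (u n)).
  have [_ _ j1 j2] := lD n k; have := cau n k nk; rewrite (ip_sum (lD n k)) => cau1.
  rewrite /vadd /= !addN1 in j1 cau1; split => //; apply: le_trans cau1.
  by rewrite lerDl; apply: I_ge0 => p; exact: sqr_ge0.
have [g2 [mg2 hg2]] : exists g, meas g /\ forall n, intg m2 (fun p => (g p - (f n p).2) ^+ 2) /\
    I[m2] (fun p => (g p - (f n p).2) ^+ 2) <= 4^-1 ^+ n.
  apply: (riesz_fischer (f := fun n p => (f n p).2)) => [n|n k nk]; first by case: (lE (u n)).
  have [_ _ j1 j2] := lD n k; have := cau n k nk; rewrite (ip_sum (lD n k)) => cau1.
  rewrite /vadd /= !addN1 in j2 cau1; split => //; apply: le_trans cau1.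
  by rewrite lerDr; apply: I_ge0 => p; exact: sqr_ge0.
pose g p := (g1 p, g2 p).
have lgf n : L2v m2 (vadd (-1) g (f n)).
  have [a1 a2 _ _] := lE (u n); rewrite /vadd /g; split; rewrite /= ?addN1.
  - exact: measD mg1 (measM (meas_cst (-1)) a1).
  - exact: measD mg2 (measM (meas_cst (-1)) a2).
  - exact: (hg1 n).1.
  - exact: (hg2 n).1.
have igf n : ip m2 (vadd (-1) g (f n)) (vadd (-1) g (f n)) <= 2 * 4^-1 ^+ n.
  rewrite ip_sum// /vadd /g /= !addN1 mulr_natl mulr2n; apply: lerD; [exact: (hg1 n).2|exact: (hg2 n).2].
have lg : L2v m2 g.
  apply: (L2v_ext _ (L2v_vadd 1 (lgf 0%N) (lE (u 0%N)))) => p.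
  by rewrite /vadd /f /= !mul1r !mulN1r !subrK.
have lHg : L2v m2 (vadd (-1) H g) by exact: L2v_vadd.
have ort w : ip m2 (vadd (-1) H g) (sE x de w) = 0.
  apply: (@sqr_vanish _ (5 * B w w)) => n.
  have a1 := hu n w; have a2 := ip_CS (lgf n) (lE w).
  rewrite ip_sE -/(B w w) in a2.
  have a3 : ip m2 (vadd (-1) g (f n)) (sE x de w) = ip m2 g (sE x de w) - B (u n) w.
    by rewrite (ip_lin (-1) lg (lE (u n)) (lE w)) mulN1r ip_sE.
  have a4 := igf n; rewrite a3 in a2; rewrite (ip_lin (-1) lH lg (lE w)) mulN1r -/(l w).
  move: a1 a2 a4; rewrite /e; set z := 4^-1 ^+ n; have : 0 <= z by rewrite exprn_ge0// invr_ge0.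
  move=> z0 h1 h2 h3; exact: split_sqr_le (Bpos w) z0 h1 h2 h3.
have [n hn] : exists n, 4 * 4^-1 ^+ n <= eps by exact: geometric_small.
exists (u n); apply: le_trans hn.
(* The limit g is not known to vanish off S, so only the restriction of H - g is claimed to be null;
   [cut_sqr_le] accounts for the difference. *)
have vanish : I[m2] (fun p => csq (resS de (vadd (-1) H g) p)) = 0.
  apply: I_ae0.
    by have [a1 a2 _ _] := resS_L2v lHg; exact: measD (measX 2 a1) (measX 2 a2).
  have := ortho_sE0 lHg ort; apply: filterS.
  by move=> p [e1 e2]; rewrite /csq /resS /= e1 e2 expr0n addr0.
have i1 : intg m2 (fun p => csq (resS de (vadd (-1) H g) p)).
  by have [_ _ a1 a2] := resS_L2v lHg; exact: intgD a1 a2.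
have i2 : intg m2 (fun p => csq (vadd (-1) g (f n) p)).
  by have [_ _ a1 a2] := lgf n; exact: intgD a1 a2.
have i3 : intg m2 (fun p => csq (vadd (-1) H (f n) p)).
  by have [_ _ a1 a2] := L2v_vadd (-1) lH (lE (u n)); exact: intgD a1 a2.
have := igf n; rewrite !ipE => b2.
have : I[m2] (fun p => csq (vadd (-1) H (f n) p)) <=
  I[m2] (fun p => 2 * csq (resS de (vadd (-1) H g) p) + 2 * csq (vadd (-1) g (f n) p)).
  apply: I_le => //; first exact: intgD (intgZ 2 i1) (intgZ 2 i2).
  move=> p; rewrite /csq /vadd /resS /= Hs /f /sE /resS /=.
  have s1 := sqi_sqr de p; have s2 := sqi_ge0 de p; have s3 := sqi_le1 de p.
  rewrite !mulN1r.
  have h1 := cut_sqr_le (H p).1 (Tre x (u n) p) (g1 p) s1 s2 s3.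
  have h2 := cut_sqr_le (H p).2 (Tim x (u n) p) (g2 p) s1 s2 s3.
  by apply: le_trans (lerD h1 h2) _; rewrite !mulrDr addrACA.
rewrite (I_D (intgZ 2 i1) (intgZ 2 i2)) !I_Z// vanish.
move: b2; lra.
Qed.

End density.

(** * The lower Plancherel bound for functions supported on S *)

Section fourier_plancherel.
Context {R : realType}.
Local Notation P2 := (plane R).
Local Notation m2 := (@leb2 R).

Lemma le_of_small (a b s : R) : (forall t, 0 < t <= 1 -> a <= b + t * s) -> a <= b.
Proof.
move=> h; apply/ler_addgt0Pr => e e0; pose t := Num.min 1 (e / (`|s| + 1)).
have s0 : 0 < `|s| + 1 by rewrite ltr_wpDl.
have t0 : 0 < t by rewrite lt_min ltr01 divr_gt0.
have t1 : t <= 1 by rewrite ge_min lexx.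
apply: (le_trans (h t _)); first by rewrite t0.
rewrite lerD2l; apply: (@le_trans _ _ (t * (`|s| + 1))).
  by apply: ler_wpM2l; [exact: ltW|rewrite (le_trans (ler_norm s))// lerDl].
by rewrite -ler_pdivlMr// ge_min lexx orbT.
Qed.

Lemma abs_le_sqrt (c a t : R) : 0 <= a -> 0 <= t -> c ^+ 2 <= a * t ^+ 2 -> `|c| <= t * Num.sqrt a.
Proof.
move=> a0 t0 h; rewrite -(@ler_pXn2r _ 2) ?nnegrE ?mulr_ge0 ?sqrtr_ge0//.
by rewrite real_normK ?num_real// exprMn sqr_sqrtr// mulrC.
Qed.

Definition FT (K : P2 -> R * R) (y : P2) : R * R :=
  (fre (fun p => (K p).1) (fun p => (K p).2) y, fim (fun p => (K p).1) (fun p => (K p).2) y).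

(** Fubini gives measurability after multiplication by an integrable weight; the weights tend to
    1. *)
Lemma meas_fre (u v : P2 -> R) : intg m2 u -> intg m2 v -> meas (fre u v : P2 -> R).
Proof.
move=> iu iv; apply: (measurable_fun_cvg (h := fun k (y : P2) => wt k.+1%:R^-1 y * fre u v y)) => [k|y _].
  by apply: intg_meas (intg_wfre (inv_succ_gt0 k) iu iv).
by rewrite -[X in _ --> X]mul1r; apply: cvgMr_tmp; exact: wt_cvg1.
Qed.

Lemma meas_fim (u v : P2 -> R) : intg m2 u -> intg m2 v -> meas (fim u v : P2 -> R).
Proof.
by move=> iu iv; rewrite (_ : fim u v = fre v (fun p => - u p)); [exact: meas_fre iv (intgN iu)|apply/funext => y; exact: fimE].
Qed.

Definition L1v (K : P2 -> R * R) := intg m2 (fun p => (K p).1) /\ intg m2 (fun p => (K p).2).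

Lemma FT_vadd t K L : L1v K -> L1v L -> FT (vadd t K L) = vadd t (FT K) (FT L).
Proof.
move=> [k1 k2] [l1 l2]; apply/funext => y; rewrite /FT /vadd /=; congr (_, _).
- rewrite /fre -I_Z; last exact: intgB (intg_Mcos y l1) (intg_Msin y l2).
  rewrite -I_D; [|exact: intgB (intg_Mcos y k1) (intg_Msin y k2)|exact: intgZ (intgB (intg_Mcos y l1) (intg_Msin y l2))].
  by congr (I[_] _); apply/funext => p; ring.
- rewrite /fim -I_Z; last exact: intgD (intg_Msin y l1) (intg_Mcos y l2).
  rewrite -I_D; [|exact: intgD (intg_Msin y k1) (intg_Mcos y k2)|exact: intgZ (intgD (intg_Msin y l1) (intg_Mcos y l2))].
  by congr (I[_] _); apply/funext => p; ring.
Qed.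

Lemma L2v_FT K : L1v K -> L2v m2 K -> L2v m2 (FT K) /\ ip m2 (FT K) (FT K) <= (2 * pi) ^+ 2 * ip m2 K K.
Proof.
move=> [k1 k2] lK; have [_ _ i1 i2] := lK; have [b1 b2] := bessel k1 k2 i1 i2.
have mf := meas_fre k1 k2; have mg := meas_fim k1 k2.
split; last by rewrite ipE ip_sum.
split => //; (apply: (intg_le _ b1); first exact: measX) => p; rewrite ger0_norm ?sqr_ge0//.
- by rewrite lerDl sqr_ge0.
- by rewrite lerDr sqr_ge0.
Qed.

Variables (x : nat -> R * R) (de : R).
Hypotheses (de0 : 0 < de) (complete : exp_complete (Sq de) x).

Lemma cut_le (s a : R) : 0 <= s -> s <= 1 -> s * a <= s + a ^+ 2.
Proof. by move=> s0 s1; have := sqr_ge0 (a - s / 2); nra. Qed.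

Lemma L1v_supp K : L2v m2 K -> (forall p, K p = resS de K p) -> L1v K.
Proof.
move=> [m1 m2' i1 i2] Ks.
have key (u : P2 -> R) : meas u -> intg m2 (fun p => u p ^+ 2) -> (forall p, u p = sqi de p * u p) -> intg m2 u.
  move=> mu iu us; apply: (intg_le mu (intgD (intg_sqi de) iu)) => p.
  rewrite -(real_normK (num_real (u p))) [in X in X <= _]us normrM (ger0_norm (sqi_ge0 de p)).
  exact: cut_le (sqi_ge0 de p) (sqi_le1 de p).
by split; apply: key => // p; rewrite {1}Ks.
Qed.

(** For E_u within e of K in squared norm, |K|^2 <= 2 <K, E_u> - |E_u|^2 + e, and 2 <K, E_u> <= 2
    sqrt(C |E_u|^2) <= C + |E_u|^2. *)
Lemma dense_bound K (C : R) : L2v m2 K -> (forall p, K p = resS de K p) -> 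
  (forall u, ip m2 K (sE x de u) ^+ 2 <= C * ip m2 (sE x de u) (sE x de u)) -> 0 <= C -> ip m2 K K <= C.
Proof.
move=> lK Ks h C0; apply/ler_addgt0Pr => e e0; have [u hu] := span_dense complete lK Ks e0.
move: hu; rewrite (ip_vadd (-1) lK (L2v_sE x de u)).
have := h u; have := ip_ge0 m2 (sE x de u).
move: (ip m2 (sE x de u) (sE x de u)) (ip m2 K (sE x de u)) (ip m2 K K) => E c k E0 hc hu.
suff : 2 * c <= C + E by lra.
rewrite leNgt; apply/negP => hl; suff : (C + E) ^+ 2 < (2 * c) ^+ 2.
  by have := sqr_ge0 (C - E); nra.
by rewrite ltr_pXn2r// nnegrE; [exact: addr_ge0|apply: ltW; apply: le_lt_trans hl; exact: addr_ge0].
Qed.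

Lemma plancherel_sE u : (2 * pi) ^+ 2 * ip m2 (sE x de u) (sE x de u) <= ip m2 (FT (sE x de u)) (FT (sE x de u)).
Proof.
have [M1 [L1 [hM1 L10 hL1]]] := lipbd_sqr (lipbd_tre x u.2 u.1).
have [M2 [L2 [hM2 L20 hL2]]] := lipbd_sqr (lipbd_tim x u.2 u.1).
have swap (f : P2 -> R) : (fun p => f p * sqi de p) = (fun p => sqi de p * f p).
  by apply/funext => p; rewrite mulrC.
have swap2 (f : P2 -> R) : (fun p => (f p * sqi de p) ^+ 2) = (fun p => (sqi de p * f p) ^+ 2).
  by apply/funext => p; rewrite mulrC.
have d0 (p q : P2) : 0 <= (q.1 - p.1) ^+ 2 + (q.2 - p.2) ^+ 2 by rewrite addr_ge0 ?sqr_ge0.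
have := @plancherel_lipschitz _ de de0 (Tre x u) (Tim x u) (Num.max M1 M2) (Num.max L1 L2)
  (meas_tre _ _ _) (meas_tim _ _ _) _ _ _ _ _.
rewrite !swap !swap2 (ip_sum (L2v_sE x de u)) (ipE m2 (FT _)); apply.
- by move=> p; rewrite le_max hM1.
- by move=> p; rewrite le_max hM2 orbT.
- by rewrite le_max L10.
- by move=> p q; apply: (le_trans (hL1 p q)); rewrite ler_wpM2r// le_max lexx.
- by move=> p q; apply: (le_trans (hL2 p q)); rewrite ler_wpM2r// le_max lexx orbT.
Qed.

(** For E = K - D with |D| <= t: k, a, d are |K|^2, <K, D>, |D|^2, while N, b, f are the same
    quantities for the transforms, and c = (2 pi)^2. The inequality for E is expanded, and every
    term containing D is O(t). *)
Lemma perturb_bound (N c t k a d b f : R) : 0 <= c -> 0 < t -> t <= 1 ->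
  f <= c * d -> d <= t ^+ 2 -> 0 <= d -> 0 <= k -> 0 <= N -> b ^+ 2 <= f * N -> a ^+ 2 <= d * k ->
  c * (k + 2 * -1 * a + (-1) ^+ 2 * d) <= N + 2 * -1 * b + (-1) ^+ 2 * f ->
  c * k <= N + t * (2 * c * Num.sqrt k + 2 * Num.sqrt (N * c) + c).
Proof.
move=> c0 t0 t1 fd dt d0 k0 N0 hb ha; rewrite sqrrN expr1n !mul1r => h.
have a1 : `|a| <= t * Num.sqrt k.
  by apply: (abs_le_sqrt k0 (ltW t0)); rewrite mulrC in ha; apply: (le_trans ha); rewrite ler_wpM2l.
have cdt : c * d <= c * t ^+ 2 by rewrite ler_wpM2l.
have b1 : `|b| <= t * Num.sqrt (N * c).
  apply: (abs_le_sqrt (mulr_ge0 N0 c0) (ltW t0)).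
  apply: (le_trans hb); rewrite -mulrA [f * N]mulrC; apply: (ler_wpM2l N0); exact: le_trans fd cdt.
have tt : t ^+ 2 <= t by rewrite expr2 ler_piMl// ltW.
have ctt : c * t ^+ 2 <= c * t by rewrite ler_wpM2l.
have ca : c * a <= c * (t * Num.sqrt k) by rewrite ler_wpM2l// (le_trans (ler_norm a)).
have nb : - b <= t * Num.sqrt (N * c) by rewrite (le_trans _ b1)// -normrN ler_norm.
have := mulr_ge0 c0 d0; lra.
Qed.

(** Exponential sums cut to S satisfy the bound and are dense on S; Bessel's inequality controls the
    transform of the approximation error. *)
Lemma plancherel_supp K : L2v m2 K -> (forall p, K p = resS de K p) ->
  (2 * pi) ^+ 2 * ip m2 K K <= ip m2 (FT K) (FT K).
Proof.
move=> lK Ks; have l1K := L1v_supp lK Ks.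
have [lF bF] := L2v_FT l1K lK; set N := ip m2 (FT K) (FT K); set c := (2 * pi) ^+ 2 : R.
have c0 : 0 <= c by exact: sqr_ge0.
apply: (@le_of_small _ _ (2 * c * Num.sqrt (ip m2 K K) + 2 * Num.sqrt (N * c) + c)) => t /andP[t0 t1].
have [u] := span_dense complete lK Ks (exprn_gt0 2 t0).
set D := vadd (-1) K _ => hD; have lE := L2v_sE x de u; have lD : L2v m2 D := L2v_vadd (-1) lK lE.
have DE : sE x de u = vadd (-1) K D.
  by apply/funext => p; rewrite /D /vadd /sE /=; congr (_, _); ring.
have Ds p : D p = resS de D p.
  rewrite /D /vadd /resS /= [in LHS]Ks /resS /sE /= !mulrDr; congr (_ + _, _ + _);
    rewrite mulrCA [sqi de p * (sqi de p * _)]mulrA sqi_sqr//.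
have l1D := L1v_supp lD Ds; have [lFD bD] := L2v_FT l1D lD.
have := plancherel_sE u; rewrite DE (FT_vadd (-1) l1K l1D) (ip_vadd (-1) lK lD) (ip_vadd (-1) lF lFD) -/N -/c.
have := ip_CS lK lD; have := ip_CS lF lFD; rewrite -/N.
move: bD hD (ip_ge0 m2 D) (ip_ge0 m2 K) (ip_ge0 m2 (FT K)); rewrite -/N -/c.
move: (ip m2 K K) (ip m2 K D) (ip m2 D D) (ip m2 (FT K) (FT D)) (ip m2 (FT D) (FT D)).
by move=> k a d b f; exact: perturb_bound.
Qed.

End fourier_plancherel.

(** * The interpolation form *)

Section point_evaluation.
Context {R : realType}.
Local Notation P2 := (plane R).
Local Notation m2 := (@leb2 R).
Variable x : nat -> R * R.

(** Conjugating E_v turns the pairing into values of the transform of K at the nodes. Point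
    conditions and inner products are exchanged in this way, for the interpolant and for the data
    alike. *)
Lemma I_pair_points (K : P2 -> R * R) (v : coefs) : L1v K ->
  I[m2] (fun p => (K p).1 * Tre x v p + (K p).2 * Tim x v p) =
  \sum_(k < v.1) ((v.2 k).1 * (FT K (x k)).1 + (v.2 k).2 * (FT K (x k)).2).
Proof.
move=> [k1 k2].
have ic y : intg m2 (fun p => (K p).1 * cos (dot2 p y) - (K p).2 * sin (dot2 p y)).
  exact: intgB (intg_Mcos y k1) (intg_Msin y k2).
have is_ y : intg m2 (fun p => (K p).1 * sin (dot2 p y) + (K p).2 * cos (dot2 p y)).
  exact: intgD (intg_Msin y k1) (intg_Mcos y k2).
pose h (k : 'I_v.1) (p : P2) := (v.2 k).1 * ((K p).1 * cos (dot2 p (x k)) - (K p).2 * sin (dot2 p (x k))) +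
  (v.2 k).2 * ((K p).1 * sin (dot2 p (x k)) + (K p).2 * cos (dot2 p (x k))).
have ih k : intg m2 (h k) by exact: intgD (intgZ _ (ic _)) (intgZ _ (is_ _)).
rewrite (_ : (fun p => _) = fun p => \sum_(k < v.1) h k p).
  rewrite I_sum//; apply: eq_bigr => k _.
  by rewrite /h (I_D (intgZ _ (ic _)) (intgZ _ (is_ _))) !I_Z.
apply/funext => p; rewrite /Tre /Tim /tre /tim !mulr_sumr -big_split/=; apply: eq_bigr => k _.
by rewrite /h; ring.
Qed.

Variable al : R.
Hypothesis al0 : 0 < al.

Definition WT (u : coefs) (p : P2) : R * R := (wexp al p * Tre x u p, wexp al p * Tim x u p).

Lemma L1v_WT u : L1v (WT u).
Proof.
have key (h : P2 -> R) : lipbd h -> intg m2 (fun p => wexp al p * h p).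
  by move=> lh; have [M M0 hM] := lipbd_bound lh; exact: (intgMb (C := M) (intg_wexp al0) lh.1).
by split; apply: key; [exact: lipbd_tre|exact: lipbd_tim].
Qed.

Lemma FT_WT u y : FT (WT u) y = ((2 * pi) ^+ 2 * pser_re al x u.2 y u.1, (2 * pi) ^+ 2 * pser_im al x u.2 y u.1).
Proof.
pose C j (p : P2) := wexp al p * cos (dot2 p (y - x j)); pose S j (p : P2) := wexp al p * sin (dot2 p (y - x j)).
have iC j : intg m2 (C j) by exact: intg_Mcos (intg_wexp al0).
have iS j : intg m2 (S j) by exact: intg_Msin (intg_wexp al0).
have IC j : I[m2] (C j) = (2 * pi) ^+ 2 * poisson al (y - x j) by exact: wexp_fourier_cos.
have IS j : I[m2] (S j) = 0 by exact: wexp_fourier_sin.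
have dB j (p : P2) : dot2 p (y - x j) = dot2 p y - dot2 p (x j) by rewrite /dot2 /=; ring.
congr (_, _).
- rewrite /fre (_ : (fun p => _) = fun p => \sum_(j < u.1) ((u.2 j).1 * C j p - (u.2 j).2 * S j p)).
    rewrite I_sum => [|j]; last exact: intgB (intgZ _ (iC _)) (intgZ _ (iS _)).
    rewrite /pser_re /series/= big_mkord mulr_sumr; apply: eq_bigr => j _.
    by rewrite (I_B (intgZ _ (iC _)) (intgZ _ (iS _))) !I_Z// IC IS; ring.
  apply/funext => p; rewrite /WT /Tre /Tim /tre /tim /= -!mulrA !mulr_suml -mulrBr -sumrB mulr_sumr.
  by apply: eq_bigr => j _; rewrite /C /S dB cosB sinB; ring.
- rewrite /fim (_ : (fun p => _) = fun p => \sum_(j < u.1) ((u.2 j).2 * C j p + (u.2 j).1 * S j p)).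
    rewrite I_sum => [|j]; last exact: intgD (intgZ _ (iC _)) (intgZ _ (iS _)).
    rewrite /pser_im /series/= big_mkord mulr_sumr; apply: eq_bigr => j _.
    by rewrite (I_D (intgZ _ (iC _)) (intgZ _ (iS _))) !I_Z// IC IS; ring.
  apply/funext => p; rewrite /WT /Tre /Tim /tre /tim /= -!mulrA !mulr_suml -mulrDr -big_split/= mulr_sumr.
  by apply: eq_bigr => j _; rewrite /C /S dB cosB sinB; ring.
Qed.

Lemma wform_wexpE u v : wform x (wexp al) u v = (2 * pi) ^+ 2 *
  \sum_(k < v.1) ((v.2 k).1 * pser_re al x u.2 (x k) u.1 + (v.2 k).2 * pser_im al x u.2 (x k) u.1).
Proof.
transitivity (I[m2] (fun p => (WT u p).1 * Tre x v p + (WT u p).2 * Tim x v p)).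
  by congr (I[_] _); apply/funext => p; rewrite /WT /=; ring.
rewrite I_pair_points; last exact: L1v_WT.
by rewrite mulr_sumr; apply: eq_bigr => k _; rewrite FT_WT /=; ring.
Qed.

End point_evaluation.

Section weighted_bounds.
Context {R : realType}.
Local Notation P2 := (plane R).
Local Notation m2 := (@leb2 R).
Variables (x : nat -> R * R) (de B : R).
Hypotheses (de0 : 0 < de) (B1 : 1 <= B) (riesz : riesz_bounds (Sq de) x B).
Variable al : R.
Hypothesis al0 : 0 < al.

Let k := tailK (expR (- (al * de))).

Lemma tailK_ge0 (z : R) : 0 <= z -> 0 <= tailK z.
Proof. by move=> z0; apply: addr_ge0 => //; apply: divr_ge0; [exact: mulr_ge0|exact: sqr_ge0]. Qed.

Lemma tail_const_ge0 : 0 <= k. Proof. by apply: tailK_ge0; exact: expR_ge0. Qed.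

Definition wout (p : P2) : R := wexp al p * (1 - sqi de p).
Definition win (p : P2) : R := wexp al p * sqi de p.

Lemma wout_ge0 p : 0 <= wout p.
Proof. by apply: mulr_ge0; [exact/ltW/wexp_gt0|rewrite subr_ge0 sqi_le1]. Qed.
Lemma intg_wout : intg m2 wout.
Proof.
apply: (intg_wexpM al0); first exact: measB (meas_cst 1) (meas_sqi de).
by move=> p; rewrite ger0_norm ?subr_ge0 ?sqi_le1// gerBl sqi_ge0.
Qed.
Lemma intg_win : intg m2 win.
Proof. by apply: (intg_wexpM al0); [exact: meas_sqi|move=> p; rewrite ger0_norm ?sqi_ge0 ?sqi_le1]. Qed.

Lemma wform_split u v : wform x (wexp al) u v = wform x win u v + wform x wout u v.
Proof.
rewrite -I_D; [|exact: (intg_wform x intg_win)|exact: (intg_wform x intg_wout)].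
by congr (I[_] _); apply/funext => p; rewrite /win /wout; ring.
Qed.

Lemma wform_win_le u : wform x win u u <= snorm x de u.2 u.1.
Proof.
rewrite -ip_sE_snorm ip_sE !wformE; apply: I_le.
- exact: (intg_wform x intg_win u u).
- exact: intg_sqi_tsq.
- by move=> p; rewrite ler_wpM2r ?tsq_ge0// ler_piMl ?sqi_ge0// wexp_le1.
Qed.

Lemma wform_wout_le u : wform x wout u u <= k * (B ^+ 2 * nrm u.2 u.1).
Proof.
have [_] := tail_le de0 B1 riesz al0 u.2 u.1; apply: le_trans; rewrite wformE le_eqVlt; apply/orP; left; apply/eqP.
by congr (I[_] _); apply/funext => p; rewrite /wout mulrA.
Qed.

Lemma wform_wexp_le u : wform x (wexp al) u u <= (1 + k) * (B ^+ 2 * nrm u.2 u.1).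
Proof.
rewrite wform_split mulrDl mul1r; apply: lerD; last exact: wform_wout_le.
by apply: le_trans (wform_win_le u) _; exact: (riesz_le B1 riesz).
Qed.

(** The weight is smallest on S at the corners, where |xi| = sqrt 2 delta. *)
Lemma wform_wexp_ge u : expR (- (al * de * Num.sqrt 2)) * snorm x de u.2 u.1 <= wform x (wexp al) u u.
Proof.
have i1 := intg_sqi_tsq x de u.2 u.1.
rewrite wformE -I_Z//; apply: I_le; first exact: intgZ.
  exact: (intg_wform x (intg_wexp al0) u u).
move=> p; rewrite mulrA; apply: ler_wpM2r; first exact: tsq_ge0.
rewrite sqiE indicE; case: (pselect (Sq de p)) => [Sp|nSp]; last by rewrite memNset// mulr0 ltW// wexp_gt0.
rewrite mem_set// mulr1 /wexp ler_expR lerN2 -mulrA ler_pM2l//.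
have -> : de * Num.sqrt 2 = Num.sqrt (de ^+ 2 * 2).
  by rewrite sqrtrM ?sqr_ge0// sqrtr_sqr gtr0_norm.
apply: ler_wsqrtr; case: Sp => a1 b1.
have h1 : `|p.1| <= de by rewrite ler_norml a1.
have h2 : `|p.2| <= de by rewrite ler_norml b1.
have sq (y : R) : `|y| <= de -> y ^+ 2 <= de ^+ 2.
  by move=> h; rewrite -(real_normK (num_real y)) lerXn2r// nnegrE// ltW.
have := sq _ h1; have := sq _ h2; lra.
Qed.

(** (a + i b) times a unimodular number has real part at most |a + i b| <= t |a + i b|^2 + 1 / (4
    t). *)
Lemma amgm_weight (t C s a b w : R) : 0 < t -> 0 < w -> C ^+ 2 + s ^+ 2 = 1 ->
  w * a * C - w * b * s <= t * (w * (a ^+ 2 + b ^+ 2)) + (4 * t)^-1 * w.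
Proof.
move=> t0 w0 Cs; set r := (4 * t)^-1; have tr : t * r = 4^-1 by rewrite /r; field; rewrite gt_eqF.
have X2 : (a * C - b * s) ^+ 2 <= a ^+ 2 + b ^+ 2.
  have : (a * C - b * s) ^+ 2 + (a * s + b * C) ^+ 2 = (a ^+ 2 + b ^+ 2) * (C ^+ 2 + s ^+ 2) by ring.
  by rewrite Cs mulr1 => <-; rewrite lerDl sqr_ge0.
have X1 : a * C - b * s <= t * (a ^+ 2 + b ^+ 2) + r.
  have h1 := ler_wpM2l (ltW t0) X2; have := mulr_ge0 (ltW t0) (sqr_ge0 (a * C - b * s - 2 * r)).
  have -> : t * (a * C - b * s - 2 * r) ^+ 2 =
    t * (a * C - b * s) ^+ 2 - 4 * (t * r) * (a * C - b * s) + 4 * (t * r) * r by ring.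
  rewrite tr; lra.
have := ler_wpM2l (ltW w0) X1; lra.
Qed.

(** Take the values g_alpha(y - x_j) themselves as coefficients of u: the transform of W E_u at y is
    then (2 pi)^2 S, S being the sum to be bounded. The same value is at most t W(u, u) + const / t,
    and W(u, u) <= K S, so a small t absorbs S. Uniformity in y makes the interpolation series
    converge everywhere. *)
Lemma poisson_sqr_summable : exists G, 0 <= G /\ forall y n, \sum_(j < n) poisson al (y - x j) ^+ 2 <= G.
Proof.
pose K := (1 + k) * B ^+ 2; pose c := (2 * pi) ^+ 2 : R; pose Iw := I[m2] (wexp al).
have K0 : 0 < K.
  apply: mulr_gt0; first by rewrite ltr_pwDl// tail_const_ge0.
  by rewrite exprn_gt0// (lt_le_trans ltr01).
have c0 : 0 < c by rewrite exprn_gt0// mulr_gt0// pi_gt0.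
have Iw0 : 0 <= Iw by apply: I_ge0 => p; apply: ltW; exact: wexp_gt0.
(* With this t, the term t K S is half of the left side c S. *)
pose t := c / (2 * K).
have t0 : 0 < t by rewrite divr_gt0// mulr_gt0.
exists (Iw / (2 * t) / c); split; first by apply: divr_ge0; [apply: divr_ge0 => //; apply: mulr_ge0 => //|]; exact: ltW.
move=> y n; pose u : coefs := (n, fun j => (poisson al (y - x j), 0)).
set S := \sum_(j < n) _.
have nS : nrm u.2 u.1 = S by apply: eq_bigr => j _; rewrite /csq /= expr0n addr0.
have pS : (FT (WT x al u) y).1 = c * S.
  by rewrite FT_WT//= /pser_re /series/= big_mkord; congr (_ * _); apply: eq_bigr => j _; rewrite expr2.
have hW : wform x (wexp al) u u <= K * S by rewrite -nS /K -mulrA wform_wexp_le.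
have iF : intg m2 (fun p => wexp al p * tsq x u.2 u.1 p).
  exact: (intg_wform x (intg_wexp al0) u u).
have [l1 l2] := L1v_WT x al0 u.
have : c * S <= t * wform x (wexp al) u u + (4 * t)^-1 * Iw.
  rewrite -pS wformE -(I_Z _ iF) -(I_Z _ (intg_wexp al0)).
  rewrite -(I_D (intgZ _ iF) (intgZ _ (intg_wexp al0))); apply: I_le.
  - exact: intgB (intg_Mcos y l1) (intg_Msin y l2).
  - exact: intgD (intgZ _ iF) (intgZ _ (intg_wexp al0)).
  - move=> p; rewrite /WT /tsq /Tre /Tim /=; have := wexp_gt0 al p.
    have := cos2Dsin2 (dot2 p y).
    move: (cos _) (sin _) (tre _ _ _ _) (tim _ _ _ _) (wexp al p) => C s a b w h1 h2; exact: amgm_weight t0 h2 h1.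
move=> h; have wK : t * wform x (wexp al) u u <= c / 2 * S.
  apply: (le_trans (ler_wpM2l (ltW t0) hW)); rewrite mulrA; apply: ler_wpM2r.
    by apply: sumr_ge0 => j _; exact: sqr_ge0.
  by rewrite /t le_eqVlt; apply/orP; left; apply/eqP; field; rewrite gt_eqF.
rewrite ler_pdivlMr//.
have -> : Iw / (2 * t) = 2 * ((4 * t)^-1 * Iw) by field; rewrite gt_eqF.
rewrite mulrC; lra.
Qed.

End weighted_bounds.

(** * Convergence of sequences and series *)

Section sequence_lemmas.
Context {R : realType}.

Lemma cvg_finite_sum (f : nat -> nat -> R) (a : nat -> R) M : (forall j, (fun n => f n j) @ \oo --> a j) ->
  (fun n => \sum_(j < M) f n j) @ \oo --> \sum_(j < M) a j.
Proof.
move=> h; elim: M => [|M IH].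
  by rewrite big_ord0; under eq_fun do rewrite big_ord0; exact: cvg_cst.
by rewrite big_ord_recr/=; under eq_fun do rewrite big_ord_recr/=; exact: cvgD.
Qed.

Lemma geometric_cvg0 (C : R) : (fun n : nat => C * 4^-1 ^+ n) @ \oo --> (0 : R).
Proof.
rewrite -[X in _ --> X](mulr0 C); apply: cvgMr; apply: cvg_expr.
by rewrite ger0_norm ?invr_ge0// invf_lt1// ltr1n.
Qed.

Lemma geometric_eventually_lt (C e : R) : 0 < e -> exists n, C * 4^-1 ^+ n < e.
Proof.
move=> e0; have [N _ h] := cvgr_lt _ (geometric_cvg0 C) _ e0.
by exists N; exact: (h N (leqnn N)).
Qed.

Lemma sqr_lt_norm (y e : R) : 0 < e -> y ^+ 2 < e ^+ 2 -> `|y| < e.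
Proof.
by move=> e0 h; rewrite -(@ltr_pXn2r _ 2) ?nnegrE ?(ltW e0)// real_normK ?num_real.
Qed.

Lemma geometric_cauchy (s : nat -> R) (C : R) :
  (forall n m, (n <= m)%N -> (s m - s n) ^+ 2 <= C * 4^-1 ^+ n) -> cvgn s.
Proof.
move=> h; apply/cauchy_cvgP/cauchy_exP => e e0.
have [N hN] := geometric_eventually_lt C (exprn_gt0 2 e0).
exists (s N); exists N => // m /= Nm; rewrite -ball_normE /ball_ /=.
by rewrite distrC; apply: (sqr_lt_norm e0); exact: le_lt_trans (h _ _ Nm) hN.
Qed.

Lemma sqr_close_cvg (s : nat -> R) (b C : R) :
  (forall n, exists N, forall m, (N <= m)%N -> (s m - b) ^+ 2 <= C * 4^-1 ^+ n) -> s @ \oo --> b.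
Proof.
move=> h; apply/cvgrPdist_lt => e e0.
have [n hn] := geometric_eventually_lt C (exprn_gt0 2 e0).
have [N hN] := h n; exists N => // m /= Nm.
by rewrite distrC; apply: (sqr_lt_norm e0); exact: le_lt_trans (hN _ Nm) hn.
Qed.

Lemma sum_CS (a b : nat -> R) M :
  (\sum_(j < M) a j * b j) ^+ 2 <= (\sum_(j < M) a j ^+ 2) * (\sum_(j < M) b j ^+ 2).
Proof.
apply: psd_discr => [|t]; first by apply: sumr_ge0 => j _; exact: sqr_ge0.
rewrite (_ : _ + _ + _ = \sum_(j < M) (t * a j + b j) ^+ 2); first by apply: sumr_ge0 => j _; exact: sqr_ge0.
rewrite mulr_sumr !mulr_suml -!big_split/=; apply: eq_bigr => j _; ring.
Qed.

Lemma csq_ge0 (c : R * R) : 0 <= csq c. Proof. by rewrite addr_ge0 ?sqr_ge0. Qed.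

Lemma sum_csq_mono (c : nat -> R * R) n N : (n <= N)%N -> \sum_(j < n) csq (c j) <= \sum_(j < N) csq (c j).
Proof.
move=> nN; rewrite (big_ord_widen N (fun j => csq (c j)) nN) [X in X <= _]big_mkcond/=.
by apply: ler_sum => j _; case: ifP => // _; exact: csq_ge0.
Qed.

Lemma l2seq_tail (a : nat -> R * R) (e : R) : l2seq a -> 0 < e ->
  exists N, forall n m, (N <= n)%N -> (n <= m)%N -> \sum_(j < m) csq (a j) - \sum_(j < n) csq (a j) <= e.
Proof.
move=> ca e0; set L := limn (series (fun j => csq (a j))).
have Le : L - e < L by rewrite gtrBl.
have [N _ hN] := cvgr_gt _ ca (L - e) Le.
have mono n m : (n <= m)%N -> series (fun j => csq (a j)) n <= series (fun j => csq (a j)) m.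
  by move=> nm; rewrite /series /= !big_mkord; exact: sum_csq_mono.
have nd : nondecreasing_seq (series (fun j => csq (a j))) by move=> n m; exact: mono.
exists N => n m Nn nm; have := hN n Nn; have := nondecreasing_cvgn_le nd ca m.
rewrite -/L /series /= !big_mkord; lra.
Qed.

Lemma l2seq_bounded (a : nat -> R * R) (C : R) : (forall M, \sum_(j < M) csq (a j) <= C) -> l2seq a.
Proof.
move=> h; apply: nondecreasing_is_cvgn.
  by move=> n m nm; rewrite /series /= !big_mkord; exact: sum_csq_mono.
by exists C => _ [M _ <-]; rewrite /series /= big_mkord.
Qed.

Lemma l2seq_le (a : nat -> R * R) : l2seq a -> exists C, forall M, \sum_(j < M) csq (a j) <= C.
Proof.
move=> ca; exists (limn (series (fun j => csq (a j)))) => M.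
have nd : nondecreasing_seq (series (fun j => csq (a j))).
  by move=> n m nm; rewrite /series /= !big_mkord; exact: sum_csq_mono.
by have := nondecreasing_cvgn_le nd ca M; rewrite /series /= big_mkord.
Qed.

Lemma cvg_series_mul (a b : nat -> R) (C D : R) : (forall M, \sum_(j < M) a j ^+ 2 <= C) ->
  (forall M, \sum_(j < M) b j ^+ 2 <= D) -> cvgn (series (fun j => a j * b j)).
Proof.
move=> ha hb; apply: normed_cvg; apply: (@series_le_cvg _ _ (fun j => a j ^+ 2 + b j ^+ 2)).
- by move=> n; exact: normr_ge0.
- by move=> n; rewrite addr_ge0 ?sqr_ge0.
- move=> n /=; rewrite normrM -(real_normK (num_real (a n))) -(real_normK (num_real (b n))).
  have := sqr_ge0 (`|a n| - `|b n|); have := sqr_ge0 (`|a n|); have := sqr_ge0 (`|b n|).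
  have -> : (`|a n| - `|b n|) ^+ 2 = `|a n| ^+ 2 + `|b n| ^+ 2 - 2 * (`|a n| * `|b n|) by ring.
  lra.
- apply: nondecreasing_is_cvgn.
    move=> n m nm; apply: nondecreasing_series => // k _ _; by rewrite addr_ge0 ?sqr_ge0.
  by exists (C + D) => _ [M _ <-]; rewrite /series /= big_mkord big_split/=; apply: lerD; [exact: ha|exact: hb].
Qed.

End sequence_lemmas.

Lemma triangle_sqr (R : realType) (s t b K G C z : R) : (s - t) ^+ 2 <= K * z * G -> (t - b) ^+ 2 <= C * z ->
  (s - b) ^+ 2 <= (2 * (K * G) + 2 * C) * z.
Proof. by have := sqr_ge0 (s - t - (t - b)); lra. Qed.

Lemma sqi_idem (R : realType) (de : R) p (y : R) : sqi de p * (sqi de p * y) = sqi de p * y.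
Proof. by rewrite mulrA sqi_sqr. Qed.

Lemma sum_unit1 (R : realType) k (g1 g2 : nat -> R) :
  \sum_(i < (@unit1 R k).1) (((@unit1 R k).2 i).1 * g1 i + ((@unit1 R k).2 i).2 * g2 i) = g1 k.
Proof.
rewrite (sum_unit (f := fun i => ((@unit1 R k).2 i).1 * g1 i + ((@unit1 R k).2 i).2 * g2 i)) => [|i /negbTE e];
  by rewrite /unit1 /= ?eqxx ?e /= ?mul1r !mul0r addr0.
Qed.

Lemma sum_unit2 (R : realType) k (g1 g2 : nat -> R) :
  \sum_(i < (@unit2 R k).1) (((@unit2 R k).2 i).1 * g1 i + ((@unit2 R k).2 i).2 * g2 i) = g2 k.
Proof.
rewrite (sum_unit (f := fun i => ((@unit2 R k).2 i).1 * g1 i + ((@unit2 R k).2 i).2 * g2 i)) => [|i /negbTE e];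
  by rewrite /unit2 /= ?eqxx ?e /= ?mul1r !mul0r add0r.
Qed.

Section interpolation.
Context {R : realType}.
Local Notation P2 := (plane R).
Local Notation m2 := (@leb2 R).
Variables (x : nat -> R * R) (de B : R).
Hypotheses (de0 : 0 < de) (B1 : 1 <= B) (riesz : riesz_bounds (Sq de) x B).
Variable al : R.
Hypothesis al0 : 0 < al.
Variable F : P2 -> R * R.
Hypothesis hF : L2on (Sq de) F.
Variable f : R * R -> R * R.
Hypothesis fE : forall y, f y = ((2 * pi)^-1 * Rintegral m2 (Sq de) (fun xi => (cmul_exp F y xi).1),
                     (2 * pi)^-1 * Rintegral m2 (Sq de) (fun xi => (cmul_exp F y xi).2)).

Let H := resS de F.
Let W := wform x (wexp al).
(* (2 pi)^2 sum_k <v_k, f(x_k)>, see [dataE] *)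
Definition data (v : coefs) : R := 2 * pi * ip m2 (resS de F) (sE x de v).

Lemma resS_idem p : H p = resS de H p.
Proof. by rewrite /H /resS /=; congr (_, _); rewrite sqi_idem. Qed.

Lemma L2v_H : L2v m2 H. Proof. exact: L2v_resS. Qed.
Lemma L1v_H : L1v H. Proof. exact: L1v_supp L2v_H resS_idem. Qed.

Lemma FT_H y : FT H y = (2 * pi * (f y).1, 2 * pi * (f y).2).
Proof.
have p0 : 2 * pi != 0 :> R by rewrite mulf_neq0 ?gt_eqF ?pi_gt0.
rewrite fE /= !mulrA !mulfV// !mul1r !Rintegral_Sq.
by congr (_, _); congr (I[_] _); apply/funext => p; rewrite /H /resS /cmul_exp /=; ring.
Qed.

Lemma dataE v : data v = (2 * pi) ^+ 2 * \sum_(k < v.1) ((v.2 k).1 * (f (x k)).1 + (v.2 k).2 * (f (x k)).2).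
Proof.
rewrite /data (_ : ip m2 _ _ = I[m2] (fun p => (H p).1 * Tre x v p + (H p).2 * Tim x v p)).
  rewrite (I_pair_points _ _ L1v_H) !mulr_sumr.
  by apply: eq_bigr => k _; rewrite FT_H /=; ring.
congr (I[_] _); apply/funext => p; rewrite /vdot /sE /H /resS /=.
by congr (_ + _); rewrite mulrACA sqi_sqr mulrA.
Qed.

Lemma data_comb t u v : data (comb t u v) = data u + t * data v.
Proof.
have lE w := L2v_sE x de w; rewrite /data ip_sym sE_comb (ip_lin t (lE u) (lE v) L2v_H).
by rewrite ![ip m2 (sE _ _ _) _]ip_sym; ring.
Qed.

Let w := expR (- (al * de * Num.sqrt 2)).
Let w0 : 0 < w. Proof. exact: expR_gt0. Qed.

Lemma data_le v : data v ^+ 2 <= (2 * pi) ^+ 2 * ip m2 H H / w * W v v.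
Proof.
have h1 := ip_CS L2v_H (L2v_sE x de v); rewrite ip_sE_snorm in h1.
have h2 := wform_wexp_ge x de0 al0 v; rewrite -/w -/(W v v) in h2.
rewrite /data exprMn (_ : _ / w * _ = (2 * pi) ^+ 2 * (ip m2 H H * (w^-1 * W v v))); last by ring.
apply: ler_wpM2l; first exact: sqr_ge0.
apply: (le_trans h1); rewrite mulrC; apply: ler_wpM2l; first exact: ip_ge0.
by rewrite ler_pdivlMl.
Qed.

(** Coercivity on coefficients, from the lower Riesz bound and the minimum of W on S; it makes
    near-minimizers Cauchy in l^2. *)
Lemma nrm_le_wform v : nrm v.2 v.1 <= B ^+ 2 / w * W v v.
Proof.
apply: (le_trans (riesz_ge B1 riesz _ _)); rewrite (_ : _ / w * _ = B ^+ 2 * (w^-1 * W v v)); last by ring.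
apply: ler_wpM2l; first exact: sqr_ge0.
by rewrite ler_pdivlMl//; exact: (wform_wexp_ge x de0 al0 v).
Qed.

Lemma sum_comb_le (t : R) (u v : coefs) M : \sum_(j < M) csq ((comb t u v).2 j) <= nrm (comb t u v).2 (comb t u v).1.
Proof.
set c := comb t u v; have c0 j : (c.1 <= j)%N -> csq (c.2 j) = 0.
  rewrite /c /comb /= geq_max => /andP[h1 h2]; rewrite /trunc !ltnNge h1 h2 /=.
  by rewrite /csq /= mulr0 addr0 expr0n addr0.
apply: (le_trans (sum_csq_mono c.2 (leq_maxl M c.1))); rewrite /nrm.
rewrite [X in _ <= X](big_ord_widen (maxn M c.1) (fun j => csq (c.2 j)) (leq_maxr _ _)).
rewrite [X in _ <= X]big_mkcond/=; apply: ler_sum => j _; case: ltnP => // h.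
by rewrite c0.
Qed.

(** Near-minimizers of W v v - 2 [data] v nearly satisfy the interpolation equations in tested form.
    By coercivity they are Cauchy in l^2, and square summability of the Poisson values lets the
    equations pass to the limit. *)
Lemma interpolant_exists : exists a, l2seq a /\ interpolates al x a f.
Proof.
have [G [G0 hG]] := poisson_sqr_summable de0 B1 riesz al0.
have Bsym : forall u v, W u v = W v u by exact: wform_sym.
have Blin : forall t u v z, W (comb t u v) z = W u z + t * W v z := wform_lin x (intg_wexp al0).
have wge0 (p : P2) : 0 <= wexp al p by apply: ltW; exact: wexp_gt0.
have Bpos : forall v, 0 <= W v v := wform_ge0 x wge0.
have C0 : 0 <= (2 * pi) ^+ 2 * ip m2 H H / w.
  by apply: divr_ge0; [apply: mulr_ge0; [exact: sqr_ge0|exact: ip_ge0]|exact: ltW].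
pose e n : R := 4^-1 ^+ n / 4.
have e0 n : 0 < e n by rewrite divr_gt0// exprn_gt0// invr_gt0.
have /choice[u hu] : forall n, exists u, forall z, (W u z - data z) ^+ 2 <= e n * W z z.
  by move=> n; exact: (near_minimizer (0%N, fun=> (0, 0)) Bsym Blin data_comb Bpos C0 data_le (e0 n)).
pose K := B ^+ 2 / w; have K0 : 0 <= K by rewrite divr_ge0 ?sqr_ge0// ltW.
pose tc n j := trunc (u n).1 (u n).2 j.
have cau M n m : (n <= m)%N ->
    \sum_(j < M) (((tc m j).1 - (tc n j).1) ^+ 2 + ((tc m j).2 - (tc n j).2) ^+ 2) <= K * 4^-1 ^+ n.
  move=> nm; have h1 := near_minimizer_cauchy Blin Bpos (ltW (e0 m)) (ltW (e0 n)) (hu m) (hu n).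
  have h2 := nrm_le_wform (comb (-1) (u m) (u n)); have h3 := sum_comb_le (-1) (u m) (u n) M.
  rewrite (eq_bigr (fun j : 'I_M => csq ((comb (-1) (u m) (u n)).2 j))); last first.
    by move=> j _; rewrite /csq /comb /= !mulN1r.
  apply: (le_trans h3); apply: (le_trans h2); apply: ler_wpM2l => //; apply: (le_trans h1).
  have : e m <= e n.
    by rewrite /e ler_pM2r ?invr_gt0// ler_wiXn2l ?invr_ge0// invf_le1// ler1n.
  rewrite /e; lra.
have term n m j : (n <= m)%N -> ((tc m j).1 - (tc n j).1) ^+ 2 + ((tc m j).2 - (tc n j).2) ^+ 2 <= K * 4^-1 ^+ n.
  move=> nm; apply: le_trans (cau j.+1 n m nm); rewrite big_ord_recr/= lerDr.
  by apply: sumr_ge0 => i _; rewrite addr_ge0 ?sqr_ge0.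
have c1 j : cvgn (fun n => (tc n j).1).
  apply: (@geometric_cauchy _ _ K) => n m nm; apply: le_trans (term n m j nm).
  by rewrite lerDl sqr_ge0.
have c2 j : cvgn (fun n => (tc n j).2).
  apply: (@geometric_cauchy _ _ K) => n m nm; apply: le_trans (term n m j nm).
  by rewrite lerDr sqr_ge0.
pose a j : R * R := (limn (fun n => (tc n j).1), limn (fun n => (tc n j).2)).
(* For fixed n and M, let m tend to infinity in [cau]; the sum is finite, so coordinatewise
   convergence suffices. *)
have diff n M : \sum_(j < M) (((a j).1 - (tc n j).1) ^+ 2 + ((a j).2 - (tc n j).2) ^+ 2) <= K * 4^-1 ^+ n.
  have cv : (fun m => \sum_(j < M) (((tc m j).1 - (tc n j).1) ^+ 2 + ((tc m j).2 - (tc n j).2) ^+ 2)) @ \oo -->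
      \sum_(j < M) (((a j).1 - (tc n j).1) ^+ 2 + ((a j).2 - (tc n j).2) ^+ 2).
    apply: (cvg_finite_sum (f := fun m j => ((tc m j).1 - (tc n j).1) ^+ 2 + ((tc m j).2 - (tc n j).2) ^+ 2)
      (a := fun j => ((a j).1 - (tc n j).1) ^+ 2 + ((a j).2 - (tc n j).2) ^+ 2)) => j.
    have sq (s : nat -> R) (b c : R) : s @ \oo --> b -> (fun m => (s m - c) ^+ 2) @ \oo --> (b - c) ^+ 2.
      move=> cs; rewrite expr2; under eq_fun do rewrite expr2.
      by apply: cvgM; apply: cvgB => //; exact: cvg_cst.
    by apply: cvgD; apply: sq; [exact: c1|exact: c2].
  rewrite -(cvg_lim (@Rhausdorff R) cv); apply: limr_le; first exact: (cvgP _ cv).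
  by exists n => // m /= nm; exact: cau.
exists a; split.
  pose C := 2 * K + 2 * nrm (u 0%N).2 (u 0%N).1; apply: (@l2seq_bounded _ _ C) => M.
  have tn : \sum_(j < M) csq (tc 0%N j) <= nrm (u 0%N).2 (u 0%N).1.
    apply: (le_trans (sum_csq_mono (tc 0%N) (leq_maxl M (u 0%N).1))).
    rewrite (big_trunc (f := fun _ => @csq R) (u 0%N).2 (leq_maxr M (u 0%N).1))// => j.
    by rewrite /csq /= expr0n addr0.
  apply: (@le_trans _ _ (\sum_(j < M) (2 * (((a j).1 - (tc 0%N j).1) ^+ 2 + ((a j).2 - (tc 0%N j).2) ^+ 2) + 2 * csq (tc 0%N j)))).
    apply: ler_sum => j _; rewrite /csq.
    have := sqr_ge0 ((a j).1 - 2 * (tc 0%N j).1); have := sqr_ge0 ((a j).2 - 2 * (tc 0%N j).2).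
    nra.
  rewrite big_split/= -!mulr_sumr /C; have := diff 0%N M; rewrite expr0 mulr1; lra.
(* Here [pj] is a coordinate projection, so that real and imaginary parts are treated at once. *)
have limit (pj : R * R -> R) k (b : R) (C : R) :
    pj (0, 0) = 0 ->
    (forall n M, \sum_(j < M) (pj (a j) - pj (tc n j)) ^+ 2 <= K * 4^-1 ^+ n) ->
    (forall n, (\sum_(j < (u n).1) pj ((u n).2 j) * poisson al (x k - x j) - b) ^+ 2 <= C * 4^-1 ^+ n) ->
    (series (fun j => pj (a j) * poisson al (x k - x j))) @ \oo --> b.
  move=> p0 hp hb; apply: (@sqr_close_cvg _ _ _ (2 * (K * G) + 2 * C)) => n.
  exists (u n).1 => M hM.
  have tE : \sum_(j < (u n).1) pj ((u n).2 j) * poisson al (x k - x j) = \sum_(j < M) pj (tc n j) * poisson al (x k - x j).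
    rewrite (big_trunc (f := fun j c => pj c * poisson al (x k - x j)) _ hM)// => j.
    by rewrite p0 mul0r.
  have h1 := hb n; rewrite tE in h1; have h2 := sum_CS (fun j => pj (a j) - pj (tc n j)) (fun j => poisson al (x k - x j)) M.
  have h3 : (\sum_(j < M) (pj (a j) - pj (tc n j)) * poisson al (x k - x j)) ^+ 2 <= K * 4^-1 ^+ n * G.
    apply: (le_trans h2); apply: ler_pM; [| |exact: hp|exact: hG];
      by apply: sumr_ge0 => j _; exact: sqr_ge0.
  rewrite /series /= big_mkord.
  have e1 : \sum_(j < M) (pj (a j) - pj (tc n j)) * poisson al (x k - x j) =
     \sum_(j < M) pj (a j) * poisson al (x k - x j) - \sum_(j < M) pj (tc n j) * poisson al (x k - x j).
    by rewrite -sumrB; apply: eq_bigr => j _; rewrite mulrBl.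
  rewrite e1 in h3; exact: triangle_sqr h3 h1.
pose c := (2 * pi) ^+ 2 : R; have c0 : 0 < c by rewrite exprn_gt0// mulr_gt0// pi_gt0.
(* For v a unit sequence, s is a real or imaginary part of the n-th approximate interpolant at a
   node and b that of f there; the factor 4 comes from [e n]. *)
have conclude n (v : coefs) (s b : R) : W (u n) v = c * s -> data v = c * b ->
    (s - b) ^+ 2 <= W v v / (4 * c ^+ 2) * 4^-1 ^+ n.
  move=> e1 e2; have := hu n v; rewrite e1 e2 -mulrBr exprMn /e => h.
  rewrite -(ler_pM2l (exprn_gt0 2 c0)); apply: (le_trans h); rewrite le_eqVlt; apply/orP; left; apply/eqP.
  by field; rewrite gt_eqF.
move=> k; split.
- apply: (limit fst k _ (W (unit1 k) (unit1 k) / (4 * c ^+ 2))) => // n; last first.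
    apply: conclude; last by rewrite dataE (sum_unit1 k (fun i => (f (x i)).1) (fun i => (f (x i)).2)).
    rewrite /W (wform_wexpE _ al0).
    by rewrite (sum_unit1 k (fun i => pser_re al x (u n).2 (x i) (u n).1) (fun i => pser_im al x (u n).2 (x i) (u n).1)) /pser_re /series/= big_mkord.
  move=> M; apply: le_trans (diff n M); apply: ler_sum => j _; by rewrite lerDl sqr_ge0.
- apply: (limit snd k _ (W (unit2 k) (unit2 k) / (4 * c ^+ 2))) => // n; last first.
    apply: conclude; last by rewrite dataE (sum_unit2 k (fun i => (f (x i)).1) (fun i => (f (x i)).2)).
    rewrite /W (wform_wexpE _ al0).
    by rewrite (sum_unit2 k (fun i => pser_re al x (u n).2 (x i) (u n).1) (fun i => pser_im al x (u n).2 (x i) (u n).1)) /pser_im /series/= big_mkord.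
  move=> M; apply: le_trans (diff n M); apply: ler_sum => j _; by rewrite lerDr sqr_ge0.
Qed.

End interpolation.

(** * The norm bound *)

Section real_inequalities.
Context {R : realType}.
Implicit Types q M B phi s t w r X d : R.

Lemma sqr_le_mul (u a b : R) : 0 <= a -> 0 <= b -> u ^+ 2 <= a ^+ 2 * b ^+ 2 -> `|u| <= a * b.
Proof.
move=> a0 b0 h; rewrite -(@ler_pXn2r _ 2) ?nnegrE ?normr_ge0 ?mulr_ge0//.
by rewrite real_normK ?num_real// exprMn.
Qed.

(** Used with sg^2 = e^(-sqrt 2 alpha delta), X = |h|_S, r^2 = W(u, u), d the data at u and phi = 2
    pi |F|_S. Testing against u itself gives r^2 <= |d| + s r <= (phi / sg + s) r, and X <= r /
    sg. *)
Lemma in_square_bound (sg phi s r X d : R) : 0 < sg -> sg <= 1 -> 0 <= phi -> 0 <= s -> 0 <= r -> 0 <= X ->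
  sg ^+ 2 * X ^+ 2 <= r ^+ 2 -> (r ^+ 2 - d) ^+ 2 <= s ^+ 2 * r ^+ 2 ->
  d ^+ 2 <= phi ^+ 2 / sg ^+ 2 * r ^+ 2 -> X <= (phi + s) / sg ^+ 2.
Proof.
move=> sg0 sg1 phi0 s0 r0 X0 h1 h2 h3.
have a1 := sqr_le_mul s0 r0 h2.
have a2 : `|d| <= phi / sg * r by apply: sqr_le_mul => //; [exact/divr_ge0/ltW|rewrite expr_div_n].
have a3 : sg * X <= r.
  by rewrite -(@ler_pXn2r _ 2) ?nnegrE ?mulr_ge0 ?(ltW sg0)// exprMn.
have a4 : r ^+ 2 <= (s + phi / sg) * r.
  have := ler_norm (r ^+ 2 - d); have := ler_norm d; lra.
have a5 : r <= s + phi / sg.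
  have [r00|rn0] := eqVneq r 0; first by rewrite r00 addr_ge0// divr_ge0// ltW.
  by rewrite -(@ler_pM2r _ r) -?expr2// lt0r rn0.
rewrite ler_pdivlMr ?exprn_gt0//.
have e : sg * (s + phi / sg) = sg * s + phi by field; rewrite gt_eqF.
have a6 : sg * (sg * X) <= sg * r by rewrite ler_pM2l.
have a7 : sg * r <= sg * (s + phi / sg) by rewrite ler_pM2l.
have a8 : sg * s <= s by rewrite ler_piMl.
rewrite mulrC expr2 -mulrA; lra.
Qed.

(** Here z is the full form at a test sequence b, c and o are its parts inside and outside S, D is
    the data at b, and bt = |E_b|_S. The claim is the triangle inequality for c = (z - D) + D -
    o. *)
Lemma test_bound (c phi s k1 z D o C bt : R) : 0 <= phi -> 0 <= s -> 0 <= k1 -> 0 <= bt -> 0 <= C ->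
  z = c + o -> (z - D) ^+ 2 <= s ^+ 2 * (C ^+ 2 * bt ^+ 2) -> D ^+ 2 <= phi ^+ 2 * bt ^+ 2 ->
  o ^+ 2 <= k1 ^+ 2 * bt ^+ 2 -> c ^+ 2 <= (phi + s * C + k1) ^+ 2 * bt ^+ 2.
Proof.
move=> phi0 s0 k10 bt0 C0 e h1 h2 h3.
have a1 : `|z - D| <= s * C * bt.
  by apply: sqr_le_mul => //; [exact: mulr_ge0|rewrite exprMn -mulrA].
have a2 := sqr_le_mul phi0 bt0 h2; have a3 := sqr_le_mul k10 bt0 h3.
have a4 : `|c| <= (phi + s * C + k1) * bt.
  rewrite ler_norml; move: a1 a2 a3; rewrite !ler_norml => /andP[? ?] /andP[? ?] /andP[? ?].
  by apply/andP; split; lra.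
rewrite -exprMn -(real_normK (num_real c)) lerXn2r ?nnegrE ?normr_ge0//.
by apply: mulr_ge0 => //; apply: addr_ge0 => //; apply: addr_ge0 => //; apply: mulr_ge0.
Qed.

(** The factors q and q^2 contained in the tail constants cancel M / q and its square up to powers
    of M. What remains is 1 + 8 / (1 - z)^2 <= 11 for z <= 9 / 100, since 8 / 0.91^2 < 10. So the
    left side is at most (1 + 11)^2 + 11 = 155 times B^8 M^2, and 155 <= 13^2. *)
Lemma final_constant (q M B : R) : 0 < q -> q <= 3 / 10 -> 1 <= M -> 1 <= B ->
  (1 + tailK q * B ^+ 4 * (M / q)) ^+ 2 + tailK (q ^+ 2) * B ^+ 4 * (M / q) ^+ 2 <= 169 * B ^+ 8 * M ^+ 2.
Proof.
move=> q0 q3 M1 B1.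
have q2 : q ^+ 2 <= 9 / 100 by nra.
have q20 : 0 < q ^+ 2 by rewrite exprn_gt0.
have bd (z : R) : 0 < z -> z <= 9 / 100 -> 8 / (1 - z) ^+ 2 <= 10.
  move=> z0 z1; rewrite ler_pdivrMr; last by rewrite exprn_gt0// subr_gt0; lra.
  nra.
have b1 := bd _ q20 q2; have b2 : 8 / (1 - (q ^+ 2) ^+ 2) ^+ 2 <= 10 by apply: bd; [rewrite exprn_gt0|nra].
have e1 : tailK q * (M / q) = M * (1 + 8 / (1 - q ^+ 2) ^+ 2).
  rewrite /tailK; field; rewrite (gt_eqF q0) /= subr_eq0 eq_sym lt_eqF//; lra.
have e2 : tailK (q ^+ 2) * (M / q) ^+ 2 = M ^+ 2 * (1 + 8 / (1 - (q ^+ 2) ^+ 2) ^+ 2).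
  rewrite /tailK; field; rewrite (gt_eqF q0) /= subr_eq0 eq_sym lt_eqF//; nra.
have B4 : 1 <= B ^+ 4 by rewrite exprn_ege1.
rewrite [X in (1 + X) ^+ 2](_ : _ = B ^+ 4 * (tailK q * (M / q))); last by ring.
rewrite [X in _ + X <= _](_ : _ = B ^+ 4 * (tailK (q ^+ 2) * (M / q) ^+ 2)); last by ring.
rewrite e1 e2 (_ : B ^+ 8 = (B ^+ 4) ^+ 2); last by rewrite -exprM.
have x10 : 0 <= 8 / (1 - q ^+ 2) ^+ 2 by apply: divr_ge0 => //; exact: sqr_ge0.
move: b1 b2 x10 B4; set x1 := 8 / (1 - q ^+ 2) ^+ 2; set x2 := 8 / (1 - (q ^+ 2) ^+ 2) ^+ 2.
set b := B ^+ 4; move=> b1 b2 x10 B4.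
have bM : 1 <= b * M by rewrite -[1]mulr1 ler_pM.
have t1 : 1 + b * (M * (1 + x1)) <= 12 * (b * M).
  have h : b * M * (1 + x1) <= b * M * 11 by apply: ler_wpM2l; lra.
  by rewrite mulrA; lra.
have t0 : 0 <= 1 + b * (M * (1 + x1)).
  by rewrite addr_ge0// !mulr_ge0// ?addr_ge0//; apply: le_trans ler01 _.
have t2 : (1 + b * (M * (1 + x1))) ^+ 2 <= (12 * (b * M)) ^+ 2.
  by rewrite lerXn2r// nnegrE//; exact: le_trans t0 t1.
have t3 : b * M ^+ 2 * (1 + x2) <= b * M ^+ 2 * 11.
  by apply: ler_wpM2l; [apply: mulr_ge0; [exact: le_trans ler01 B4|exact: sqr_ge0]|lra].
have t4 : b * M ^+ 2 <= b ^+ 2 * M ^+ 2.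
  by rewrite ler_wpM2r ?sqr_ge0// expr2 ler_peMl//; exact: le_trans ler01 B4.
have t5 : 0 <= b ^+ 2 * M ^+ 2 by apply: mulr_ge0; exact: sqr_ge0.
have e3 : (12 * (b * M)) ^+ 2 = 144 * (b ^+ 2 * M ^+ 2) by ring.
rewrite e3 in t2; rewrite [b * (M ^+ 2 * _)]mulrA -mulrA; lra.
Qed.

End real_inequalities.

Section interpolant_bound.
Context {R : realType}.
Local Notation P2 := (plane R).
Local Notation m2 := (@leb2 R).
Variables (x : nat -> R * R) (de B : R).
Hypotheses (de0 : 0 < de) (B1 : 1 <= B) (riesz : riesz_bounds (Sq de) x B).
Hypothesis complete : exp_complete (Sq de) x.
Variable al : R.
Hypothesis al0 : 0 < al.
Variable F : P2 -> R * R.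
Hypothesis hF : L2on (Sq de) F.

Let H := resS de F.
Let W := wform x (wexp al).
Let k := tailK (expR (- (al * de))).
Let K1 := (1 + k) * B ^+ 2.
Let phi := Num.sqrt (ip m2 H H).
Let w := expR (- (al * de * Num.sqrt 2)).
Let k0 : 0 <= k := tail_const_ge0 de al.
Let Bp : 0 < B. Proof. exact: lt_le_trans ltr01 B1. Qed.
Let w0 : 0 < w. Proof. exact: expR_gt0. Qed.

Lemma nrm_comb_tail (a : nat -> R * R) N M : (N <= M)%N ->
  nrm (comb (-1) (M, a) (N, a)).2 (comb (-1) (M, a) (N, a)).1 = \sum_(j < M) csq (a j) - \sum_(j < N) csq (a j).
Proof.
move=> NM; rewrite /nrm /comb /= (maxn_idPl NM).
rewrite (big_ord_widen M (fun j => csq (a j)) NM) [X in _ - X]big_mkcond/= -sumrB.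
apply: eq_bigr => j _; rewrite /trunc ltn_ord; case: ltnP => _ /=; rewrite /csq /=.
  by rewrite !mulN1r !subrr expr0n addr0.
by rewrite !mulr0 !addr0 subr0.
Qed.

Section given_interpolant.
Variable f : R * R -> R * R.
Hypothesis fE : forall y, f y = ((2 * pi)^-1 * Rintegral m2 (Sq de) (fun xi => (cmul_exp F y xi).1),
                     (2 * pi)^-1 * Rintegral m2 (Sq de) (fun xi => (cmul_exp F y xi).2)).
Variable a : nat -> R * R.
Hypotheses (l2a : l2seq a) (ia : interpolates al x a f).

(** Since b is finite, the form involves partial sums of the interpolant at finitely many nodes
    only. *)
Lemma wform_cvg_data b : (fun M => W (M, a) b) @ \oo --> data x de F b.
Proof.
rewrite (dataE x hF fE); under eq_fun do rewrite /W (wform_wexpE _ al0) /=.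
apply: cvgMr; apply: (cvg_finite_sum (f := fun M j => (b.2 j).1 * pser_re al x a (x j) M + (b.2 j).2 * pser_im al x a (x j) M)
  (a := fun j => (b.2 j).1 * (f (x j)).1 + (b.2 j).2 * (f (x j)).2)) => j.
by apply: cvgD; apply: cvgMr; have [h1 h2] := ia j.
Qed.

(** By Cauchy-Schwarz for W, two truncations tested against b differ by at most the W-norm of the
    segment of a between them, which is controlled by the l^2 tail of a uniformly in b. Then the
    longer truncation tends to the full data. *)
Lemma truncation_near_interpolant (e : R) : 0 < e ->
  exists N0, forall N, (N0 <= N)%N -> forall b, (W (N, a) b - data x de F b) ^+ 2 <= e * W b b.
Proof.
move=> e0; have K10 : 0 < K1 by rewrite mulr_gt0 ?exprn_gt0// ltr_pwDl.
have [N0 hN] := l2seq_tail l2a (divr_gt0 e0 K10).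
exists N0 => N NN b.
have c : (fun M => (W (N, a) b - W (M, a) b) ^+ 2) @ \oo --> (W (N, a) b - data x de F b) ^+ 2.
  rewrite expr2; under eq_fun do rewrite expr2.
  by apply: cvgM; apply: cvgB; [exact: cvg_cst|exact: wform_cvg_data|exact: cvg_cst|exact: wform_cvg_data].
rewrite -(cvg_lim (@Rhausdorff R) c); apply: limr_le; first exact: (cvgP _ c).
exists N => // M /= NM.
have lin : W (comb (-1) (M, a) (N, a)) b = W (M, a) b - W (N, a) b.
  by rewrite /W (wform_lin x (intg_wexp al0)) mulN1r.
rewrite -sqrrN opprB -lin.
have wge0 (p : P2) : 0 <= wexp al p by apply: ltW; exact: wexp_gt0.
apply: (le_trans (wform_CS x (intg_wexp al0) wge0 _ _)); rewrite mulrC.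
apply: ler_wpM2r; first exact: (wform_ge0 x wge0).
apply: (le_trans (wform_wexp_le de0 B1 riesz al0 _)); rewrite mulrA -/K1 nrm_comb_tail//.
by rewrite -ler_pdivlMl// mulrC; exact: hN.
Qed.

End given_interpolant.

Section near_interpolant.
Variables (s : R) (u : @coefs R).
Hypotheses (s0 : 0 < s) (near : forall b, (W u b - data x de F b) ^+ 2 <= s ^+ 2 * W b b).

Let X := Num.sqrt (snorm x de u.2 u.1).
Let sE2 (v : @coefs R) : Num.sqrt (snorm x de v.2 v.1) ^+ 2 = snorm x de v.2 v.1.
Proof. by rewrite sqr_sqrtr// snorm_ge0. Qed.
Let phi2 : phi ^+ 2 = ip m2 H H.
Proof. by rewrite sqr_sqrtr// ip_ge0. Qed.
Let wge0 (p : P2) : 0 <= wexp al p. Proof. by apply: ltW; exact: wexp_gt0. Qed.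

Lemma trunc_norm_le : X <= (2 * pi * phi + s) / w.
Proof.
have Wuu : 0 <= W u u by exact: (wform_ge0 x wge0).
pose sg := Num.sqrt w; have sg2 : sg ^+ 2 = w by rewrite sqr_sqrtr// ltW.
rewrite -sg2; apply: (@in_square_bound _ sg _ s (Num.sqrt (W u u)) _ (data x de F u)).
- by rewrite sqrtr_gt0.
- by rewrite -sqrtr1 ler_wsqrtr// -expR0 ler_expR oppr_le0 !mulr_ge0 ?sqrtr_ge0// ltW.
- by rewrite !mulr_ge0 ?sqrtr_ge0 ?pi_ge0.
- exact: ltW.
- exact: sqrtr_ge0.
- exact: sqrtr_ge0.
- by rewrite sg2 sE2 sqr_sqrtr//; exact: wform_wexp_ge.
- by rewrite sqr_sqrtr//; exact: near.
- rewrite sg2 (sqr_sqrtr Wuu) (exprMn 2 (2 * pi) phi) phi2; exact: (data_le x de0 al0 hF u).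
Qed.

Lemma L2v_WT : L2v m2 (WT x al u).
Proof.
have key (h : P2 -> R) : lipbd h -> meas (fun p => wexp al p * h p) /\ intg m2 (fun p => (wexp al p * h p) ^+ 2).
  move=> lh; have [M M0 hM] := lipbd_bound lh; have mh := lh.1.
  have mw : meas (fun p => wexp al p * h p) := measM (meas_wexp al) mh.
  split => //; have i1 := intgMb (C := M) (intg_wexp al0) mh hM.
  have := intgMb (C := M) i1 mw; rewrite /=.
  have e : (fun p => (wexp al p * h p) ^+ 2) = (fun p => wexp al p * h p * (wexp al p * h p)).
    by apply/funext => p; rewrite expr2.
  rewrite e; apply=> p; rewrite normrM; apply: (le_trans _ (hM p)).
  by rewrite ler_piMl// ger0_norm// wexp_le1.
have [a1 a2] := key _ (lipbd_tre x u.2 u.1); have [a3 a4] := key _ (lipbd_tim x u.2 u.1).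
by split.
Qed.

(** Bound for |W h|_S; its terms come from the data, from the residual s, and from the part of the
    form outside S. *)
Let Cb := 2 * pi * phi + s * (Num.sqrt K1 * B) + k * B ^+ 4 * X.

(** Duality on S: the pairing with E_b is the full form minus its part outside S, the former is near
    the data by hypothesis, the latter is bounded by Cauchy-Schwarz for [wout]. Passing from [nrm]
    to [snorm] on u and on b turns B^2 into B^4. *)
Lemma resS_WT_le : ip m2 (resS de (WT x al u)) (resS de (WT x al u)) <= Cb ^+ 2.
Proof.
have nb (v : @coefs R) : nrm v.2 v.1 <= B ^+ 2 * snorm x de v.2 v.1 := riesz_ge B1 riesz _ _.
apply: (dense_bound complete (resS_L2v de L2v_WT)) => [p|b|]; [| |exact: sqr_ge0].
  by rewrite /resS /=; congr (_, _); rewrite sqi_idem.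
have -> : ip m2 (resS de (WT x al u)) (sE x de b) = wform x (win de al) u b.
  congr (I[_] _); apply/funext => p; rewrite /vdot /resS /sE /WT /win /=.
  have := sqi_sqr de p; move: (sqi de p) (wexp al p) => c v cc.
  transitivity (v * (c * c) * (Tre x u p * Tre x b p + Tim x u p * Tim x b p)); first by ring.
  by rewrite cc.
rewrite ip_sE_snorm -(sE2 b).
apply: (@test_bound _ _ _ s _ (W u b) (data x de F b) (wform x (wout de al) u b) (Num.sqrt K1 * B)).
- by rewrite !mulr_ge0 ?sqrtr_ge0 ?pi_ge0.
- exact: ltW.
- by rewrite !mulr_ge0 ?sqrtr_ge0 ?exprn_ge0// ltW.
- exact: sqrtr_ge0.
- by rewrite mulr_ge0 ?sqrtr_ge0// ltW.
- by rewrite /W (wform_split x de al0).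
- apply: (le_trans (near b)); apply: ler_wpM2l; first exact: sqr_ge0.
  apply: (le_trans (wform_wexp_le de0 B1 riesz al0 _)); rewrite mulrA -/K1 sE2 exprMn.
  rewrite sqr_sqrtr; last by rewrite mulr_ge0 ?sqr_ge0// addr_ge0.
  rewrite (_ : K1 * B ^+ 2 * _ = K1 * (B ^+ 2 * snorm x de b.2 b.1)); last by ring.
  by apply: ler_wpM2l; [apply: mulr_ge0; [exact: addr_ge0|exact: sqr_ge0]|exact: nb].
- have := ip_CS (L2v_H hF) (L2v_sE x de b); rewrite ip_sE_snorm => h.
  rewrite /data sE2 (exprMn 2 (2 * pi) phi) phi2 (exprMn 2 (2 * pi) (ip _ _ _)).
  rewrite (_ : _ * snorm _ _ _ _ = (2 * pi) ^+ 2 * (snorm x de b.2 b.1 * ip m2 H H)); last by ring.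
  by apply: ler_wpM2l h; exact: sqr_ge0.
- apply: (le_trans (wform_CS x (intg_wout de al0) (wout_ge0 de al) _ _)).
  have t (v : @coefs R) : wform x (wout de al) v v <= k * B ^+ 4 * snorm x de v.2 v.1.
    apply: (le_trans (wform_wout_le de0 B1 riesz al0 v)); rewrite -/k -mulrA; apply: ler_wpM2l => //.
    rewrite (_ : B ^+ 4 = B ^+ 2 * B ^+ 2); last by ring.
    by rewrite -mulrA; apply: ler_wpM2l; [exact: sqr_ge0|exact: nb].
  apply: (le_trans (ler_pM (wform_ge0 x (wout_ge0 de al) _) (wform_ge0 x (wout_ge0 de al) _) (t b) (t u))).
  rewrite exprMn !sE2 le_eqVlt; apply/orP; left; apply/eqP; ring.
Qed.

(** After Bessel, the energy outside S carries the weight W^2 = exp(-2 alpha |xi|), so [tail_le] is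
    used with 2 alpha, that is with q^2 in place of q. *)
Lemma FT_WT_energy : ip m2 (FT (WT x al u)) (FT (WT x al u)) <=
  (2 * pi) ^+ 2 * (Cb ^+ 2 + tailK (expR (- (al * de)) ^+ 2) * B ^+ 4 * X ^+ 2).
Proof.
have [_ h] := L2v_FT (L1v_WT x al0 u) L2v_WT; apply: (le_trans h).
apply: ler_wpM2l; first exact: sqr_ge0.
have al2 : 0 < 2 * al by rewrite mulr_gt0.
have [i2 h2] := tail_le de0 B1 riesz al2 u.2 u.1.
have -> : expR (- (al * de)) ^+ 2 = expR (- (2 * al * de)).
  by rewrite expr2 -expRD; congr expR; ring.
have l1 := resS_L2v de L2v_WT.
have i1 : intg m2 (fun p => csq (resS de (WT x al u) p)) by case: l1 => _ _; exact: intgD.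
have split_ : ip m2 (WT x al u) (WT x al u) = ip m2 (resS de (WT x al u)) (resS de (WT x al u)) +
    I[m2] (fun p => wexp (2 * al) p * ((1 - sqi de p) * tsq x u.2 u.1 p)).
  rewrite !ipE -(I_D i1 i2); congr (I[_] _); apply/funext => p.
  have ww : wexp (2 * al) p = wexp al p ^+ 2.
    by rewrite [RHS]expr2 /wexp -expRD; congr expR; ring.
  rewrite ww /csq /resS /WT /tsq /Tre /Tim /= !sqi_sqrM; ring.
rewrite split_; apply: lerD; first exact: resS_WT_le.
apply: (le_trans h2); rewrite sE2.
rewrite (_ : _ * B ^+ 4 * _ = tailK (expR (- (2 * al * de))) * (B ^+ 2 * (B ^+ 2 * snorm x de u.2 u.1))); last by ring.
apply: ler_wpM2l; first by apply: tailK_ge0; exact: expR_ge0.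
by apply: ler_wpM2l; [exact: sqr_ge0|exact: riesz_ge B1 riesz _ _].
Qed.

End near_interpolant.
End interpolant_bound.

(** Both squares are homogeneous in p + t once c <= t and X <= (p + t) w1 are inserted. *)
Lemma energy_arith (R : realType) (p t c k k2 X B w1 : R) : 0 <= p + t -> 0 <= k -> 0 <= k2 -> 0 <= B -> 0 <= X ->
  0 <= p -> 0 <= c -> 0 <= w1 -> c <= t -> X <= (p + t) * w1 ->
  (p + c + k * B ^+ 4 * X) ^+ 2 + k2 * B ^+ 4 * X ^+ 2 <=
  (p + t) ^+ 2 * ((1 + k * B ^+ 4 * w1) ^+ 2 + k2 * B ^+ 4 * w1 ^+ 2).
Proof.
move=> pt0 k0 k20 B0 X0 p0 c0 w0 ct hX.
have B4 : 0 <= B ^+ 4 by exact: exprn_ge0.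
have kB : 0 <= k * B ^+ 4 by exact: mulr_ge0.
have k2B : 0 <= k2 * B ^+ 4 by exact: mulr_ge0.
rewrite mulrDr -exprMn; apply: lerD.
  rewrite lerXn2r ?nnegrE//; last by have := ler_wpM2l kB hX; lra.
    by rewrite !addr_ge0// mulr_ge0.
  by rewrite mulr_ge0// addr_ge0// mulr_ge0.
rewrite (_ : (p + t) ^+ 2 * _ = k2 * B ^+ 4 * ((p + t) * w1) ^+ 2); last by ring.
apply: ler_wpM2l => //; rewrite lerXn2r ?nnegrE//.
by rewrite mulr_ge0.
Qed.

Section conclusion.
Context {R : realType}.
Local Notation P2 := (plane R).
Local Notation m2 := (@leb2 R).
Variables (x : nat -> R * R) (de B : R).
Hypotheses (de0 : 0 < de) (B1 : 1 <= B) (riesz : riesz_bounds (Sq de) x B).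
Hypothesis complete : exp_complete (Sq de) x.
Variable al : R.
Hypotheses (al0 : 0 < al) (alq : expR (- (al * de)) <= 3 / 10).
Variable F : P2 -> R * R.
Hypothesis hF : L2on (Sq de) F.
Variable f : R * R -> R * R.
Hypothesis fE : forall y, f y = ((2 * pi)^-1 * Rintegral m2 (Sq de) (fun xi => (cmul_exp F y xi).1),
                     (2 * pi)^-1 * Rintegral m2 (Sq de) (fun xi => (cmul_exp F y xi).2)).

Let phi := Num.sqrt (ip m2 (resS de F) (resS de F)).
Let M := expR (al * de * (Num.sqrt 2 - 1)).
Let q := expR (- (al * de)).
Let k := tailK q.
Let w := expR (- (al * de * Num.sqrt 2)).
Let A := 13 * B ^+ 4 * M.

Lemma M_ge1 : 1 <= M.
Proof.
rewrite -expR0 ler_expR; apply: mulr_ge0; first by rewrite mulr_ge0 ?ltW.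
by rewrite subr_ge0 -[X in X <= _]sqrtr1 ler_wsqrtr// ler1n.
Qed.

Lemma inv_wE : w^-1 = M / q.
Proof. by rewrite /w /M /q -!expRN -expRD; congr expR; ring. Qed.

Let A0 : 0 <= A.
Proof. by rewrite !mulr_ge0 ?exprn_ge0 ?expR_ge0// (le_trans ler01). Qed.
Let pi2 : 0 < 2 * pi :> R. Proof. by rewrite mulr_gt0 ?pi_gt0. Qed.
Let phi0 : 0 <= phi. Proof. exact: sqrtr_ge0. Qed.

Lemma near_interpolant_energy (s : R) (u : @coefs R) : 0 < s ->
  (forall b, (wform x (wexp al) u b - data x de F b) ^+ 2 <= s ^+ 2 * wform x (wexp al) b b) ->
  ip m2 (FT (WT x al u)) (FT (WT x al u)) <=
  (2 * pi) ^+ 2 * ((2 * pi * phi + s * (1 + Num.sqrt ((1 + k) * B ^+ 2) * B)) * A) ^+ 2.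
Proof.
(* This margin dominates both residual terms: s in the bound of |h|_S and s sqrt((1 + k) B^2) B in
   the duality bound. *)
move=> s0 near; set t := s * _.
have k0 : 0 <= k by exact: tail_const_ge0.
have B0 : 0 <= B by exact: le_trans ler01 B1.
have c0 : 0 <= Num.sqrt ((1 + k) * B ^+ 2) * B by rewrite mulr_ge0 ?sqrtr_ge0.
have hX := trunc_norm_le de0 al0 hF s0 near.
have := FT_WT_energy de0 B1 riesz complete al0 hF s0 near.
move: hX (sqrtr_ge0 (snorm x de u.2 u.1)); rewrite -/phi -/w -/q -/k.
set X := Num.sqrt (snorm _ _ _ _) => hX X0; move/le_trans; apply.
apply: ler_wpM2l; first exact: sqr_ge0.
rewrite exprMn /A (_ : (13 * B ^+ 4 * M) ^+ 2 = 169 * B ^+ 8 * M ^+ 2); last by ring.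
have K20 : 0 <= tailK (q ^+ 2) by apply: tailK_ge0; exact: sqr_ge0.
have := final_constant (expR_gt0 _) alq M_ge1 B1; rewrite -/q -/k -inv_wE => fc.
have p0 : 0 <= 2 * pi * phi + t.
  by rewrite addr_ge0 ?mulr_ge0 ?(ltW s0) ?pi_ge0// addr_ge0.
apply: le_trans (ler_wpM2l (sqr_ge0 _) fc).
have w0 : 0 <= w^-1 by rewrite invr_ge0 expR_ge0.
have st : s <= t by rewrite /t mulrDr mulr1 lerDl mulr_ge0// ltW.
have ct : s * (Num.sqrt ((1 + k) * B ^+ 2) * B) <= t by rewrite /t mulrDr mulr1 lerDr ltW.
have X1 : X <= (2 * pi * phi + t) * w^-1.
  by apply: (le_trans hX); apply: ler_wpM2r => //; rewrite lerD2l.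
have p1 : 0 <= 2 * pi * phi by rewrite !mulr_ge0 ?pi_ge0.
exact: energy_arith p0 k0 K20 B0 X0 p1 (mulr_ge0 (ltW s0) c0) w0 ct X1.
Qed.

Variable a : nat -> R * R.
Hypotheses (l2a : l2seq a) (ia : interpolates al x a f).

Let psum N (y : P2) : R * R := (pser_re al x a y N, pser_im al x a y N).

Lemma csq_psum N y : csq (psum N y) = (2 * pi) ^- 4 * csq (FT (WT x al (N, a)) y).
Proof.
have := lt0r_neq0 pi2; rewrite FT_WT// /csq /psum /=; move: (2 * pi) => c c0.
by field.
Qed.

Lemma pser_cvg y : cvgn (pser_re al x a y) /\ cvgn (pser_im al x a y).
Proof.
have [G [_ hG]] := poisson_sqr_summable de0 B1 riesz al0; have [C hC] := l2seq_le l2a.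
split; apply: (cvg_series_mul (C := C) (D := G)) => [n|n]; try exact: hG;
  apply: (le_trans _ (hC n)); apply: ler_sum => j _; rewrite ?lerDl ?lerDr; exact: sqr_ge0.
Qed.

(** Fatou's lemma along the truncations. Their residual is taken as t / c1, so that the margin of
    [near_interpolant_energy] is exactly t; the shift by N0 skips the truncations that are still too
    coarse. *)
Lemma interp_energy (t : R) : 0 < t ->
  intg m2 (fun y => csq (poisson_interp al x a y)) /\
  I[m2] (fun y => csq (poisson_interp al x a y)) <= (2 * pi) ^- 2 * ((2 * pi * phi + t) * A) ^+ 2.
Proof.
move=> t0; pose c1 := 1 + Num.sqrt ((1 + k) * B ^+ 2) * B.
have c10 : 0 < c1 by rewrite ltr_pwDl// mulr_ge0 ?sqrtr_ge0// (le_trans ler01).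
have s0 : 0 < t / c1 by exact: divr_gt0.
have [N0 hN] := truncation_near_interpolant de0 B1 riesz al0 hF fE l2a ia (exprn_gt0 2 s0).
apply: (@fatou_bound _ _ _ m2 (fun N y => csq (psum (N + N0)%N y))).
- move=> N; under [X in EFin \o X]funext do rewrite csq_psum.
  have [l1 l2] := L1v_WT x al0 ((N + N0)%N, a); have [[_ _ i1 i2] _] := L2v_FT (L1v_WT x al0 _) (L2v_WT x al0 ((N + N0)%N, a)).
  exact: intgZ (intgD i1 i2).
- by move=> N y; exact: csq_ge0.
- move=> y; have [h1 h2] := pser_cvg y.
  rewrite (@cvg_shiftn N0 _ (fun N => csq (psum N y))) /csq /psum /=.
  have sq (v : nat -> R) (l : R) : v @ \oo --> l -> (fun n => v n ^+ 2) @ \oo --> l ^+ 2.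
    by move=> h; rewrite expr2; under eq_fun do rewrite expr2; exact: cvgM.
  by apply: cvgD; apply: sq.
- move=> N; have := near_interpolant_energy s0 (hN _ (leq_addl N N0)).
  rewrite -/c1 divfK ?gt_eqF// ipE => h.
  have [[_ _ i1 i2] _] := L2v_FT (L1v_WT x al0 _) (L2v_WT x al0 ((N + N0)%N, a)).
  under [X in Rintegral _ _ X]funext do rewrite csq_psum.
  rewrite (I_Z _ (intgD i1 i2)).
  have p4 : 0 <= (2 * pi) ^- 4 :> R by rewrite invr_ge0 exprn_ge0// ltW.
  apply: (le_trans (ler_wpM2l p4 h)); rewrite mulrA le_eqVlt; apply/orP; left; apply/eqP.
  by congr (_ * _); have := lt0r_neq0 pi2; move: (2 * pi) => c cn0; field.
Qed.

(** The given F is tied to f only by its integral representation, so the norm of F on S is compared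
    with that of f through the lower Plancherel bound. *)
Lemma phi_le : phi <= L2norm setT f.
Proof.
have lH := L2v_H hF; have h := plancherel_supp de0 complete lH (resS_idem de F).
rewrite /L2norm -/(Rintegral m2 setT (fun p => csq (f p))) ler_wsqrtr//.
rewrite -(ler_pM2l (exprn_gt0 2 pi2)); apply: (le_trans h).
have [[_ _ i1 i2] _] := L2v_FT (L1v_H hF) lH.
have fF p : csq (f p) = (2 * pi) ^- 2 * csq (FT (resS de F) p).
  by have := lt0r_neq0 pi2; rewrite (FT_H fE) /csq /=; move: (2 * pi) => c c0; field.
under [X in _ <= _ * Rintegral _ _ X]funext do rewrite fF.
by rewrite (I_Z _ (intgD i1 i2)) mulrA mulfV ?mul1r ?ipE// gt_eqF// exprn_gt0.
Qed.

Lemma interp_L2 : L2on setT (poisson_interp al x a) /\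
  L2norm setT (poisson_interp al x a) <= A * L2norm setT f.
Proof.
have [ic _] := interp_energy ltr01; split.
  have mp (s : nat -> P2 -> R) (g : P2 -> R) : (forall N, meas (s N)) -> (forall y, (fun N => s N y) @ \oo --> g y) -> meas g.
    by move=> ms cs; apply: (measurable_fun_cvg (h := s)) => // y _; exact: cs.
  have [mre mim] : (forall N, meas (fun y : P2 => pser_re al x a y N)) /\ (forall N, meas (fun y : P2 => pser_im al x a y N)).
    have e N (y : P2) : pser_re al x a y N = (2 * pi) ^- 2 * (FT (WT x al (N, a)) y).1 /\
       pser_im al x a y N = (2 * pi) ^- 2 * (FT (WT x al (N, a)) y).2.
      by rewrite FT_WT//=; split; rewrite mulrA mulVf ?mul1r// gt_eqF// exprn_gt0.
    split => N; have [[m1 m2' _ _] _] := L2v_FT (L1v_WT x al0 _) (L2v_WT x al0 (N, a)).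
    + by rewrite (_ : (fun y : P2 => _) = fun y => (2 * pi) ^- 2 * (FT (WT x al (N, a)) y).1);
        [exact: measM (meas_cst _) m1|apply/funext => y; case: (e N y)].
    + by rewrite (_ : (fun y : P2 => _) = fun y => (2 * pi) ^- 2 * (FT (WT x al (N, a)) y).2);
        [exact: measM (meas_cst _) m2'|apply/funext => y; case: (e N y)].
  split; [|split].
  - by apply: (mp (fun N y => pser_re al x a y N)) => // y; case: (pser_cvg y).
  - by apply: (mp (fun N y => pser_im al x a y N)) => // y; case: (pser_cvg y).
  - by rewrite (I_EFin ic) ltry.
apply: le_trans (ler_wpM2l A0 phi_le).
(* The residual margin t is sent to 0 here. *)
apply: (@le_of_small _ _ _ ((2 * pi)^-1 * A)) => t /andP[t0 _]; have [_ h] := interp_energy t0.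
rewrite /L2norm -/(Rintegral m2 setT (fun p => csq (poisson_interp al x a p))).
have e : A * phi + t * ((2 * pi)^-1 * A) = (2 * pi)^-1 * ((2 * pi * phi + t) * A).
  by have := lt0r_neq0 pi2; move: (2 * pi) => c cn0; field.
have e0 : 0 <= (2 * pi)^-1 * ((2 * pi * phi + t) * A).
  apply: mulr_ge0; first by rewrite invr_ge0 ltW.
  apply: mulr_ge0 => //; apply: addr_ge0; last exact: ltW.
  by apply: mulr_ge0 => //; exact: ltW.
rewrite e -(ger0_norm e0) -sqrtr_sqr ler_wsqrtr// exprMn; apply: (le_trans h).
by rewrite exprVn.
Qed.

End conclusion.

(** The hypothesis says q <= (sqrt 2 - 1) / sqrt 2 = 1 - 1 / sqrt 2. The rational bound 3 / 10
    amounts to 7 sqrt 2 <= 10, that is 98 <= 100. *)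
Lemma large_alpha (R : realType) (de al : R) : 0 < de ->
  de^-1 * ln (Num.sqrt 2 / (Num.sqrt 2 - 1)) <= al -> 0 < al /\ expR (- (al * de)) <= 3 / 10.
Proof.
move=> de0 h; set r : R := Num.sqrt 2 in h.
have r2 : r ^+ 2 = 2 by rewrite sqr_sqrtr.
have r0 : 0 <= r by exact: sqrtr_ge0.
have r1 : 1 < r by rewrite -(@ltr_pXn2r _ 2) ?nnegrE// r2 expr1n ltr1n.
have r10 : 7 * r <= 10 by rewrite -(@ler_pXn2r _ 2) ?nnegrE ?mulr_ge0// exprMn r2; lra.
have b1 : 1 < r / (r - 1) by rewrite ltr_pdivlMr ?subr_gt0// mul1r gtrBl.
have b0 : 0 < r / (r - 1) by exact: lt_trans ltr01 b1.
have lb : ln (r / (r - 1)) <= al * de by rewrite [al * de]mulrC -ler_pdivrMl.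
have ad0 : 0 < al * de by apply: lt_le_trans lb; exact: ln_gt0.
split; first by rewrite -(pmulr_lgt0 al de0).
apply: (@le_trans _ _ ((r / (r - 1))^-1)).
  by rewrite expRN lef_pV2 ?posrE ?expR_gt0// -[X in X <= _](lnK b0) ler_expR.
rewrite invf_div ler_pdivrMr ?(lt_trans ltr01)//; lra.
Qed.


Theorem theorem1 (R : realType) (delta B alpha : R) (x : nat -> R * R) :
  0 < delta ->
  1 <= B ->
  CIS_with_const (Sq delta) x B ->
  delta^-1 * ln (Num.sqrt 2 / (Num.sqrt 2 - 1)) <= alpha ->
  forall f : R * R -> R * R, PW (Sq delta) f ->
    (exists a, l2seq a /\ interpolates alpha x a f) /\
    (forall a, l2seq a -> interpolates alpha x a f ->
       (forall y, cvgn (pser_re alpha x a y) /\ cvgn (pser_im alpha x a y)) /\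
       L2on setT (poisson_interp alpha x a) /\
       L2norm setT (poisson_interp alpha x a)
         <= 13 * B ^+ 4 * expR (alpha * delta * (Num.sqrt 2 - 1)) * L2norm setT f).
Proof.
move=> de0 B1 [complete riesz] hal f [F [hF fE]].
have [al0 alq] := large_alpha de0 hal.
split; first exact: (interpolant_exists de0 B1 riesz al0 hF fE).
move=> a l2a ia; split; first exact: (pser_cvg de0 B1 riesz al0 l2a).
exact: (interp_L2 de0 B1 riesz complete al0 alq hF fE l2a ia).
Qed.
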